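(* Let $n\ge 4$, $N\ge 1$, and let $T^1$ be the Kuranishi space of the simple $N$-dimensional singular point $0\in f^{-1}(0)$ with $$f(x_1,\ldots,x_{N+1})=\sum_{i=1}^{N-1}x_i^2+x_N^2x_{N+1}+x_{N+1}^{n-1}.$$ The subset of $T^1$ parameterizing small deformations of $0\in f^{-1}(0)$ to a simple node is the union of $n$ hypersurfaces (one for each critical point $p_\Lambda$ of the generic deformation $f_\Lambda$). Moreover, calling $\mathcal{L}$ any of those hypersurfaces, there exists a stratification of nested algebraic subsets giving rise to the following inclusions and c.i.p. squares: $$\mathcal{L}\supset\mathcal{W}_2\supset\mathcal{V}_0^1\cup\mathcal{W}_2^3\supset\mathcal{W}_2^4\supset\cdots\supset\mathcal{W}_2^m\supset\cdots\supset\mathcal{W}_2^{n-1}\quad\text{(upper row)},$$ $$\mathcal{V}_0^2\supset\mathcal{V}_0^3\supset\cdots\supset\mathcal{V}_0^{m-1}\supset\cdots\supset\mathcal{V}_0^{n-2}=\{0\}\quad\text{(lower row)},$$ with vertical inclusions $\mathcal{V}_0^2\subset\mathcal{V}_0^1\cup\mathcal{W}_2^3$ and $\mathcal{V}_0^{m-1}\subset\mathcal{W}_2^m$ for $4\le m\le n-1$, where every square formed by two consecutive vertical inclusions is a c.i.p. square. This diagram verifies the Arnol'd adjacency diagram with upper row $A_1\leftarrow A_2\leftarrow A_3\leftarrow\cdots\leftarrow A_m\leftarrow\cdots\leftarrow A_{n-1}$, lower row $D_4\leftarrow\cdots\leftarrow D_{m+1}\leftarrow\cdots\leftarrow D_n$,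 and vertical adjacencies $A_m\leftarrow D_{m+1}$ for $3\le m\le n-1$. Here - $\mathcal{L}=\{\Lambda\in T^1: y_\Lambda^2z_\Lambda+z_\Lambda^{n-1}+\lambda y_\Lambda+\sum_{i=0}^{n-2}\lambda_iz_\Lambda^i=0\}$, with $(y_\Lambda,z_\Lambda)$ a solution of $$2yz+\lambda=0,\qquad (n-1)z^{n-2}+y^2+\sum_{i=1}^{n-2}i\lambda_iz^{i-1}=0;$$ - $\mathcal{V}_0^m:=\bigcap_{k=0}^m\mathcal{V}_k$ and $\mathcal{W}_2^m:=\bigcap_{k=2}^m\mathcal{W}_k$, where $\mathcal{V}_k,\mathcal{W}_k$ are the hypersurfaces of $\mathcal{L}$ $$\mathcal{V}_k:=\{v_k=0\}\ (0\le k\le n-2),\qquad \mathcal{W}_k:=\begin{cases}\{4v_1v_2-v_0^2=0\}&k=2,\\ \{v_1v_k+v_{k-1}=0\}&3\le k\le n-2,\\ \{v_1+v_{n-2}=0\}&k=n-1,\end{cases}$$ with $v_0:=2y_\Lambda$, $v_1:=z_\Lambda$ and $v_k:=\binom{n-1}{k}z_\Lambda^{n-1-k}+\sum_{i=k}^{n-2}\binom{i}{k}\lambda_iz_\Lambda^{i-k}$ for $k=2,\ldots,n-2$ (for $n=4$ the cases $k=2$ and $k=n-1=3$ are the only ones).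
   Context: The Kuranishi space of the isolated hypersurface singularity $0\in f^{-1}(0)$ is $T^1=\mathbb{C}\{x_1,\ldots,x_{N+1}\}/(f,\partial f/\partial x_1,\ldots,\partial f/\partial x_{N+1})$, the base of its versal deformation. Put $y=x_N$, $z=x_{N+1}$. Here $T^1\cong\langle1,y,z,\ldots,z^{n-2}\rangle_{\mathbb{C}}$, and to $\Lambda=(\lambda_0,\lambda,\lambda_1,\ldots,\lambda_{n-2})\in T^1$ is associated the deformation $U_\Lambda=\{f_\Lambda=0\}$ with $f_\Lambda=f+\lambda y+\sum_{i=0}^{n-2}\lambda_iz^i$. The critical points of $f_\Lambda$ are $p_\Lambda=(0,\ldots,0,y_\Lambda,z_\Lambda)$ with $(y_\Lambda,z_\Lambda)$ one of the $n$ solutions of the polynomial system in the claim; choosing $\mathcal{L}$ means choosing one of these critical points, and $\Lambda\in\mathcal{L}$ means exactly $p_\Lambda\in U_\Lambda$. Simple singularities: an isolated hypersurface singularity is of type $A_m$ (resp. $D_m$, $m\ge4$) if it is equivalent, up to a local biholomorphic change of coordinates, to $\sum_{i=1}^{N}x_i^2+x_{N+1}^{m+1}=0$ (resp. $\sum_{i=1}^{N-1}x_i^2+x_N^2x_{N+1}+x_{N+1}^{m-1}=0$) at the origin. A simple node is an $A_1$ singularity. A class $B$ of singularities is adjacent to a class $A$ (written $A\leftarrow B$) if every singularity in $B$ can be deformed to a singularity in $A$ by an arbitrarily small deformation. A diagram of inclusions of algebraic subsets of $T^1$ ''verifies'' a given adjacency diagram of the same shape if inclusions correspond to adjacency arrows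 and, for generic $\Lambda$ in each subset, $p_\Lambda\in U_\Lambda$ is a singularity of the type in the corresponding position of the adjacency diagram. A square of subset inclusions $A\subset B\subset D$, $A\subset C\subset D$ is a c.i.p. square (complete intersection property) if $A=B\cap C$. Thus the squares here being c.i.p. means $\mathcal{V}_0^{m-1}=\mathcal{V}_0^{m-2}\cap\mathcal{W}_2^m$ for $4\le m\le n-1$.
   Formalization: Algebraicity of the strata and ''generic Λ'' are stated for pairs (Λ, critical point), not in T^1, where they fail for separately chosen p_Λ; inclusions and c.i.p. squares hold in T^1 for every choice; the n hypersurfaces are separate only near Λ with n critical points; node set is a closure. *)

(* Defs.v *)
From mathcomp Require Export all_boot all_order all_algebra.
From mathcomp Require Export all_classical all_reals all_analysis.
From mathcomp Require Export complex.
(* The notations of multinomials clash with those of analysis: they are left out. *)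
From mathcomp Require Export -(notations) mpoly.
Export Order.TTheory GRing.Theory Num.Theory numFieldNormedType.Exports.

Set Implicit Arguments.
Unset Strict Implicit.
Unset Printing Implicit Defensive.

Local Open Scope classical_set_scope.
Local Open Scope ring_scope.

(* The field of complex numbers. Packing it as a numClosedFieldType makes the
   topology of a numeric field apply to it, so that 'differentiable' below means
   complex differentiable, i.e. holomorphic when it holds on an open set. *)
Definition complexes (R : realType) : numClosedFieldType := R[i].

Section AlgebraicSubsets.
Variables (C : numClosedFieldType) (m : nat).
Implicit Types (X S Z H : set 'rV[C]_m) (P : mpoly m C).

Definition zeros P : set 'rV[C]_m := [set x | meval (x 0) P = 0].

Definition algebraic X :=
  exists s : seq (mpoly m C), X = \bigcap_(P in [set` s]) zeros P.

(* H is cut out on X by one equation that vanishes identically on no nonempty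
   open part of X (equivalently, for X algebraic, on no component of X). *)
Definition hypersurface X H :=
  [/\ exists P, H = X `&` zeros P, H !=set0 & X `<=` closure (X `\` H)].

(* Q holds for the generic point of S. The closure is the classical one; since
   Z is algebraic, for S algebraic it agrees with the Zariski closure. *)
Definition generically S (Q : set 'rV[C]_m) :=
  exists Z, [/\ algebraic Z, S `<=` closure (S `\` Z) & S `\` Z `<=` Q].

End AlgebraicSubsets.

Section HypersurfaceSingularities.
Variable C : numClosedFieldType.

Definition critical_points (m : nat) (f : 'rV[C]_m -> C) : set 'rV[C]_m :=
  [set x | differentiable f x /\ 'd f x =1 cst 0].

(* The germs of hypersurfaces {f = 0} at p and {g = 0} at q are isomorphic: a
   biholomorphism phi of a neighborhood of q onto a neighborhood of p carries
   the ideal (f) to the ideal (g). *)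
Definition equivalent_germs (m : nat) (f : 'rV[C]_m -> C) (p : 'rV[C]_m)
    (g : 'rV[C]_m -> C) (q : 'rV[C]_m) :=
  exists (U V : set 'rV[C]_m) (phi psi : 'rV[C]_m -> 'rV[C]_m)
      (u : 'rV[C]_m -> C),
    [/\ [/\ open U, open V, U q, V p & phi q = p],
        (forall x, U x -> [/\ V (phi x), psi (phi x) = x & differentiable phi x]),
        (forall x, V x -> [/\ U (psi x), phi (psi x) = x & differentiable psi x]),
        (forall x, U x -> differentiable u x /\ u x != 0) &
        (forall x, U x -> f (phi x) = u x * g x)].

(* For N >= 1, C^(N+1) is 'rV_(N.-1 + 2): the last two coordinates x_N and
   x_(N+1) are split off. *)
Definition yco (k : nat) (x : 'rV[C]_(k + 2)) : C := rsubmx x 0 ord0.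
Definition zco (k : nat) (x : 'rV[C]_(k + 2)) : C := rsubmx x 0 ord_max.
Definition sum_squares (k : nat) (x : 'rV[C]_(k + 2)) : C :=
  \sum_(i < k) (lsubmx x 0 i) ^+ 2.

Inductive simple_type := A of nat | D of nat.

Definition normal_form (t : simple_type) (k : nat) (x : 'rV[C]_(k + 2)) : C :=
  match t with
  | A m => sum_squares x + yco x ^+ 2 + zco x ^+ m.+1
  | D m => sum_squares x + yco x ^+ 2 * zco x + zco x ^+ m.-1
  end.

Definition singularity_of_type (t : simple_type) (k : nat)
    (f : 'rV[C]_(k + 2) -> C) (p : 'rV[C]_(k + 2)) :=
  equivalent_germs f p (normal_form t (k := k)) 0.

End HypersurfaceSingularities.

Section Kuranishi.
Variables (C : numClosedFieldType) (n : nat).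

(* The Kuranishi space C{x_1, ..., x_(N+1)}/(f, df), with the coordinates
   (lambda, lambda_0, ..., lambda_(n-2)) given by the basis y, 1, z, ..., z^(n-2):
   the coordinate lambda of y is listed first. *)
Definition T1 := 'rV[C]_(1 + n.-1).
Definition lam (L : T1) : C := lsubmx L 0 0.
Definition lami (L : T1) (i : 'I_n.-1) : C := rsubmx L 0 i.

Definition f_ (k : nat) (L : T1) (x : 'rV[C]_(k + 2)) : C :=
  normal_form (D n) x + lam L * yco x
    + \sum_(i < n.-1) lami L i * zco x ^+ i.

(* T^1 x C^2, with elements (Lambda, (y, z)). A point of the critical cover is
   a parameter together with one of the critical points of f_Lambda. *)
Definition pairs := 'rV[C]_((1 + n.-1) + 2).
Definition par (x : pairs) : T1 := lsubmx x.

Definition critical_cover : set pairs := [set x |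
  2 * yco x * zco x + lam (par x) = 0 /\
  n.-1%:R * zco x ^+ n.-2 + yco x ^+ 2
    + \sum_(i < n.-1 | (1 <= i)%N) i%:R * lami (par x) i * zco x ^+ i.-1 = 0].

Definition critical_system (L : T1) : set 'rV[C]_2 :=
  [set q | critical_cover (row_mx L q)].

(* The strata are algebraic subsets of the critical cover; choosing a critical
   point p_Lambda for each Lambda turns them into subsets of T^1, see 'trace'. *)
Definition calL : set pairs := critical_cover `&` [set x |
  yco x ^+ 2 * zco x + zco x ^+ n.-1 + lam (par x) * yco x
    + \sum_(i < n.-1) lami (par x) i * zco x ^+ i = 0].

Definition v (k : nat) (x : pairs) : C :=
  if k == 0%N then 2 * yco x
  else if k == 1%N then zco x
  else 'C(n.-1, k)%:R * zco x ^+ (n.-1 - k)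
       + \sum_(i < n.-1 | (k <= i)%N) 'C(i, k)%:R * lami (par x) i * zco x ^+ (i - k).

Definition V (k : nat) : set pairs := calL `&` [set x | v k x = 0].

Definition W (k : nat) : set pairs := calL `&` [set x |
  if k == 2%N then 4 * v 1 x * v 2 x - v 0 x ^+ 2 = 0
  else if k == n.-1 then v 1 x + v n.-2 x = 0
  else v 1 x * v k x + v k.-1 x = 0].

Definition V0 (m : nat) : set pairs :=
  \bigcap_(k in [set k | (k <= m)%N]) V k.
Definition W2 (m : nat) : set pairs :=
  \bigcap_(k in [set k | (2 <= k <= m)%N]) W k.

(* The stratum of each vertex of the adjacency diagram: its generic point is a
   singularity of that type. The values at A 0 and D m for m < 4 are junk. *)
Definition stratum (t : simple_type) : set pairs :=
  match t with
  | A 1 => calL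
  | A 2 => W 2
  | A 3 => V0 1 `|` W2 3
  | A m => W2 m
  | D m => V0 m.-2
  end.

(* Arnol'd's diagram: 'arrow a b' is the adjacency a <- b. *)
Definition vertex (t : simple_type) : Prop :=
  match t with
  | A m => (1 <= m <= n.-1)%N
  | D m => (4 <= m <= n)%N
  end.

Definition arrow (a b : simple_type) : Prop :=
  [/\ vertex a, vertex b & match a, b with
  | A m, A m' => m' = m.+1
  | D m, D m' => m' = m.+1
  | A m, D m' => (3 <= m)%N /\ m' = m.+1
  | D _, A _ => False
  end].

Definition verifies (k : nat) (S : simple_type -> set pairs) :=
  (forall a b, arrow a b -> S b `<=` S a) /\
  (forall t, vertex t -> S t !=set0 /\
     generically (S t) [set x |
       singularity_of_type t (f_ (k := k) (par x)) (row_mx 0 (rsubmx x))]).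

Definition cip_square (T : Type) (A B B' D : set T) :=
  [/\ A `<=` B /\ B `<=` D, A `<=` B' /\ B' `<=` D & A = B `&` B'].

(* p lists, for every Lambda, the solutions of the critical system. It has n
   entries; they are distinct when f_Lambda has n critical points. *)
Definition critical_choices (p : 'I_n -> T1 -> 'rV[C]_2) :=
  forall L, critical_system L = range (p ^~ L).

Definition trace (p : T1 -> 'rV[C]_2) (S : set pairs) : set T1 :=
  [set L | S (row_mx L (p L))].

(* The critical value at p_Lambda, as a function of Lambda: trace p calL is its
   zero set when p_Lambda is critical. *)
Definition critical_value (p : T1 -> 'rV[C]_2) (L : T1) : C :=
  f_ L (row_mx (0 : 'rV[C]_0) (p L)).

Definition node_locus (k : nat) : set T1 :=
  [set L | exists p, singularity_of_type (A 1) (f_ (k := k) L) p].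

End Kuranishi.

(* Main.v *)
From HB Require Import structures.
Require Import Defs.
From mathcomp Require Import separable ring zify.
Set Implicit Arguments.
Unset Strict Implicit.
Unset Printing Implicit Defensive.
Local Open Scope classical_set_scope.
Local Open Scope ring_scope.

(** Write P(z) = z^(n-1) + sum lambda_i z^i, so that f_Lambda is
    sum x_i^2 + y^2 z + lambda y + P(z), and let (y_Lambda, z_Lambda) be a
    critical point. Substituting y = y_Lambda + s, z = z_Lambda + t, the critical
    equations cancel the terms that are linear in s and t, and what is left is
      value + sum x_i^2 + v_1 s^2 + v_0 s t + s^2 t + sum_(2 <= j < n) v_j t^j
    with v_(n-1) = 1 ([f_expansion]). Conversely the value u and the coefficients
    v_0, ..., v_(n-2) can be prescribed freely: they are polynomial coordinates on
    the critical cover, and the hypersurface L is u = 0 ([critical_cover_chart]).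
    Everything then becomes a question about this polynomial in s and t.

    Where v_1 is not zero, multiply by the unit v_1 + t and complete the square
    in s. What remains is sum_(2 <= j <= n) w_j t^j, with
    w_2 = v_1 v_2 - v_0^2 / 4 and w_j = v_1 v_j + v_(j-1): these are the equations
    of the W_j, and the singularity is A_m when w_(m+1) is the first of them that
    does not vanish ([type_A_generic]). Where v_0 = ... = v_(m-2) = 0 and v_(m-1)
    is not zero, the germ is sum x_i^2 + s^2 t + t^(m-1) times a unit, which is D_m
    ([type_D_generic]); since D_3 = A_3 ([normal_form_D3]), V_0^1 belongs to the
    stratum of A_3. On V_0^(m-2) the equation w_m = 0 reads v_(m-1) = 0, which is
    the complete intersection property ([V0_cip]).

    A polynomial is not zero on a dense part of a stratum as soon as, from every
    point of the stratum, a polynomial path inside the stratum leads to a point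
    where it is not zero ([closure_path]). The coordinates v_j give such paths:
    segments in the linear spaces V_0^m, and on W_2^m the parametrization
    v_1 = - p^2, v_m = q^2, v_0 = 2 i p^(m-1) q, v_j = p^(2(m-j)) q^2.

    Globally, eliminating y = - lambda / (2 z) from the critical equations leaves
    z^2 P'(z) + lambda^2 / 4 = 0, of degree n, hence n critical points
    ([critical_seq]); and z f_Lambda = (y z + lambda / 2)^2 + z P(z) - lambda^2 / 4
    on the plane of (y, z), so that the critical points of value 0 correspond to
    the multiple roots of z P(z) - lambda^2 / 4 ([node_discP]). The resultants of
    these polynomials with their derivatives are polynomials in Lambda: if
    lambda and the first are not zero, there are exactly n critical points, and the
    second is the equation of the closure of the node locus ([closure_node_locus]).

    The only analytic input is the implicit function theorem for a simple root of
    a monic polynomial whose coefficients depend holomorphically on a parameter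
    ([simple_root_branch]). It provides the roots of units and the inverse changes
    of coordinate that normal forms need ([unit_root_coordinate]), as well as the
    local branches of the critical points ([critical_branch]). *)

(** * Polynomial functions *)

Section PolynomialFunctions.
Variable C : numFieldType.

Definition polyfun1 (f : C -> C) := exists r : {poly C}, forall t, f t = r.[t].

Lemma polyfun1C c : polyfun1 (fun=> c).
Proof. by exists c%:P => t; rewrite hornerC. Qed.

Lemma polyfun1_id : polyfun1 id.
Proof. by exists 'X => t; rewrite hornerX. Qed.

Lemma polyfun1D f g : polyfun1 f -> polyfun1 g -> polyfun1 (fun t => f t + g t).
Proof. by move=> [p fp] [q gq]; exists (p + q) => t; rewrite hornerD fp gq. Qed.

Lemma polyfun1M f g : polyfun1 f -> polyfun1 g -> polyfun1 (fun t => f t * g t).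
Proof. by move=> [p fp] [q gq]; exists (p * q) => t; rewrite hornerM fp gq. Qed.

Lemma polyfun1N f : polyfun1 f -> polyfun1 (fun t => - f t).
Proof. by move=> [p fp]; exists (- p) => t; rewrite hornerN fp. Qed.

Lemma polyfun1X f n : polyfun1 f -> polyfun1 (fun t => f t ^+ n).
Proof. by move=> [p fp]; exists (p ^+ n) => t; rewrite horner_exp fp. Qed.

Lemma polyfun1_sum (I : Type) (s : seq I) (P : pred I) (F : I -> C -> C) :
  (forall i, polyfun1 (F i)) -> polyfun1 (fun t => \sum_(i <- s | P i) F i t).
Proof.
move=> pF; have [r rF] := choice pF; exists (\sum_(i <- s | P i) r i) => t.
by rewrite horner_sum; apply: eq_bigr => i _.
Qed.

Lemma polyfun1_prod (I : Type) (s : seq I) (P : pred I) (F : I -> C -> C) :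
  (forall i, polyfun1 (F i)) -> polyfun1 (fun t => \prod_(i <- s | P i) F i t).
Proof.
move=> pF; have [r rF] := choice pF; exists (\prod_(i <- s | P i) r i) => t.
by rewrite horner_prod; apply: eq_bigr => i _.
Qed.

Lemma polyfun1_if (b : bool) f g : polyfun1 f -> polyfun1 g ->
  polyfun1 (fun t => if b then f t else g t).
Proof. by case: b. Qed.

(** Functions rather than polynomials: the equations at hand are expressions in the
    coordinates, whose polynomiality follows from closure properties. *)
Definition polyfun m (f : 'rV[C]_m -> C) :=
  exists P : mpoly m C, forall x : 'rV[C]_m, meval (x 0) P = f x.

Section Closure.
Variable m : nat.
Implicit Types f g : 'rV[C]_m -> C.

Lemma polyfunC (c : C) : polyfun (fun _ : 'rV[C]_m => c).
Proof. by exists (mpolyC m c) => x; rewrite mevalC. Qed.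

Lemma polyfun_coord j : polyfun (fun x : 'rV[C]_m => x 0 j).
Proof. by exists (mpolyX C (mnm1 j)) => x; rewrite mevalXU. Qed.

Lemma polyfunD f g : polyfun f -> polyfun g -> polyfun (fun x => f x + g x).
Proof. by move=> [p fp] [q gq]; exists (p + q) => x; rewrite mevalD fp gq. Qed.

Lemma polyfunM f g : polyfun f -> polyfun g -> polyfun (fun x => f x * g x).
Proof. by move=> [p fp] [q gq]; exists (p * q) => x; rewrite mevalM fp gq. Qed.

Lemma polyfunN f : polyfun f -> polyfun (fun x => - f x).
Proof. by move=> [p fp]; exists (- p) => x; rewrite mevalN fp. Qed.

Lemma polyfun_prod (I : Type) (s : seq I) (P : pred I) (F : I -> 'rV[C]_m -> C) :
  (forall i, polyfun (F i)) -> polyfun (fun x => \prod_(i <- s | P i) F i x).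
Proof.
move=> pF; have [r rF] := choice pF; exists (\prod_(i <- s | P i) r i) => t.
by rewrite rmorph_prod; apply: eq_bigr => i _; exact: rF.
Qed.

Lemma polyfun_sum (I : Type) (s : seq I) (P : pred I) (F : I -> 'rV[C]_m -> C) :
  (forall i, polyfun (F i)) -> polyfun (fun x => \sum_(i <- s | P i) F i x).
Proof.
move=> pF; have [r rF] := choice pF; exists (\sum_(i <- s | P i) r i) => t.
by rewrite raddf_sum; apply: eq_bigr => i _; exact: rF.
Qed.

Lemma polyfunX f k : polyfun f -> polyfun (fun x => f x ^+ k).
Proof. by move=> [p fp]; exists (p ^+ k) => x; rewrite rmorphXn /= fp. Qed.

Lemma polyfunMn f k : polyfun f -> polyfun (fun x => f x *+ k).
Proof. by move=> [p fp]; exists (p *+ k) => x; rewrite raddfMn /= fp. Qed.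

Lemma polyfun_if (b : bool) f g : polyfun f -> polyfun g ->
  polyfun (fun x => if b then f x else g x).
Proof. by case: b. Qed.

Lemma polyfun_det k (F : 'I_k -> 'I_k -> 'rV[C]_m -> C) :
  (forall i j, polyfun (F i j)) -> polyfun (fun x => \det (\matrix_(i, j) F i j x)).
Proof.
move=> pF; rewrite /determinant; apply: polyfun_sum => s.
apply: polyfunM; first exact: polyfunC.
apply: polyfun_prod => i; under eq_fun do rewrite mxE.
exact: pF.
Qed.

End Closure.

Lemma polyfun_path m (f : 'rV[C]_m -> C) (g : C -> 'rV[C]_m) :
  polyfun f -> (forall j, polyfun1 (fun t => g t 0 j)) -> polyfun1 (f \o g).
Proof.
move=> [P fP] pg; rewrite (_ : f \o g = fun t => meval (g t 0) P); last first.
  by apply: funext => t /=; rewrite fP.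
under eq_fun do rewrite mevalE.
apply: polyfun1_sum => mm; apply: polyfun1M; first exact: polyfun1C.
by apply: polyfun1_prod => i; apply: polyfun1X.
Qed.

Lemma poly_nonroot_near0 (r : {poly C}) (d : C) : r != 0 -> 0 < d ->
  exists2 t, `|t| < d & r.[t] != 0.
Proof.
move=> r0 d0.
(* The numbers d / 2, d / 3, ... are too many to be all roots. *)
pose s := [seq d / (j.+2)%:R | j <- iota 0 (size r)].
have us : uniq s.
  rewrite map_inj_uniq ?iota_uniq// => i j /(mulfI (lt0r_neq0 d0)) /invr_inj /eqP.
  by rewrite eqr_nat => /eqP [].
have: ~~ all (root r) s.
  apply/negP => ar; have := max_poly_roots r0 ar us.
  by rewrite size_map size_iota ltnn.
move=> /allPn [t /mapP[j _ ->] nr]; exists (d / j.+2%:R) => //.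
rewrite ger0_norm; last by rewrite divr_ge0 ?ler0n ?ltW.
by rewrite ltr_pdivrMr ?ltr0n// ltr_pMr// ltr1n.
Qed.

End PolynomialFunctions.

(** * Differentiability of scalar functions *)

Section Differentiability.
Variables (C : numFieldType) (X : normedModType C).
Implicit Types (f g : X -> C) (x : X).

Lemma differentiablefC (c : C) x : differentiable (fun _ : X => c) x.
Proof. exact: differentiable_cst. Qed.

Lemma differentiablefD f g x : differentiable f x -> differentiable g x ->
  differentiable (fun y => f y + g y) x.
Proof. exact: differentiableD. Qed.

Lemma differentiablefN f x : differentiable f x -> differentiable (fun y => - f y) x.
Proof. exact: differentiableN. Qed.

Lemma differentiablefM f g x : differentiable f x -> differentiable g x ->
  differentiable (fun y => f y * g y) x.
Proof. exact: differentiableM. Qed.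

Lemma differentiablefV f x : f x != 0 -> differentiable f x ->
  differentiable (fun y => (f y)^-1) x.
Proof. by move=> ? ?; exact: differentiableV. Qed.

Lemma differentiablefX f n x : differentiable f x -> differentiable (fun y => f y ^+ n) x.
Proof.
case: n => [|n] df; first by under eq_fun do rewrite expr0; exact: differentiablefC.
by have := @differentiableX _ _ f n x df; rewrite exprfctE.
Qed.

Lemma differentiablef_sum (I : Type) (s : seq I) (P : pred I) (F : I -> X -> C) x :
  (forall i, P i -> differentiable (F i) x) ->
  differentiable (fun y => \sum_(i <- s | P i) F i y) x.
Proof.
move=> dF; elim: s => [|i s IH].
  by under eq_fun do rewrite big_nil; exact: differentiablefC.
under eq_fun do rewrite big_cons.
by case Pi: (P i) => //; apply: differentiablefD => //; exact: dF.
Qed.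

Lemma differentiablef_prod (I : Type) (s : seq I) (P : pred I) (F : I -> X -> C) x :
  (forall i, P i -> differentiable (F i) x) ->
  differentiable (fun y => \prod_(i <- s | P i) F i y) x.
Proof.
move=> dF; elim: s => [|i s IH].
  by under eq_fun do rewrite big_nil; exact: differentiablefC.
under eq_fun do rewrite big_cons.
by case Pi: (P i) => //; apply: differentiablefM => //; exact: dF.
Qed.

Lemma differentiable_rV m (F : X -> 'rV[C]_m) x :
  (forall j, differentiable (fun y => F y 0 j) x) -> differentiable F x.
Proof.
move=> dF.
rewrite (_ : F = \sum_(j < m) (fun y => F y 0 j *: delta_mx 0 j)).
  by apply: differentiable_sum => j; exact: differentiableZl.
apply/funext => y; rewrite {1}(row_sum_delta (F y)) fct_sumE.
by [].
Qed.

End Differentiability.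

Lemma differentiable_rV_coord (C : numFieldType) m (x : 'rV[C]_m) j :
  differentiable (fun y : 'rV[C]_m => y 0 j) x.
Proof. exact: differentiable_coord. Qed.

Lemma differentiablef_comp (C : numFieldType) (X Y Z : normedModType C)
  (f : X -> Y) (g : Y -> Z) x :
  differentiable f x -> differentiable g (f x) -> differentiable (fun y => g (f y)) x.
Proof. exact: differentiable_comp. Qed.

Lemma polyfun_differentiable (C : numFieldType) m (f : 'rV[C]_m -> C) x :
  polyfun f -> differentiable f x.
Proof.
move=> [P fP]; rewrite (_ : f = fun x : 'rV[C]_m => meval (x 0) P); last first.
  by apply/funext => y; rewrite fP.
under eq_fun do rewrite mevalE.
apply: differentiablef_sum => i _; apply: differentiablefM; first exact: differentiablefC.
by apply: differentiablef_prod => j _; apply: differentiablefX; exact: differentiable_rV_coord.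
Qed.

Lemma polyfun1_differentiable (C : numFieldType) (f : C -> C) x :
  polyfun1 f -> differentiable f x.
Proof.
move=> [p fp]; rewrite (_ : f = fun x => \sum_(i < size p) p`_i * x ^+ i); last first.
  by apply/funext => y; rewrite fp horner_coef.
apply: differentiablef_sum => i _; apply: differentiablefM; first exact: differentiablefC.
by apply: differentiablefX; exact: ex_diff.
Qed.

(** Along the path, [h] is a polynomial in one variable; it is not the zero
    polynomial because of its value at 1, so it has non-roots arbitrarily near 0. *)
Lemma closure_path (C : numFieldType) m (S : set 'rV[C]_m) (h : 'rV[C]_m -> C)
    (g : C -> 'rV[C]_m) :
  polyfun h -> (forall j, polyfun1 (fun t => g t 0 j)) ->
  (forall t, S (g t)) -> h (g 1) != 0 ->
  closure (S `\` [set x | h x = 0]) (g 0).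
Proof.
move=> ph pg gS h1 B nB.
have [r hr] := polyfun_path ph pg.
have r0 : r != 0.
  by apply: contra_neq h1 => r0; have /= -> := hr 1; rewrite r0 horner0.
have dg : differentiable g 0.
  by apply: differentiable_rV => j; exact: polyfun1_differentiable.
have := differentiable_continuous dg; move=> /(_ _ nB).
move=> /nbhs_ballP [d /= d0 dB].
have [t td rt] := poly_nonroot_near0 r0 d0.
exists (g t); split.
  by split => // /=; have /= -> := hr t; exact/eqP.
by apply: dB; rewrite /ball /= sub0r normrN.
Qed.

(** * Simple roots depend holomorphically on the coefficients *)

(** As [G] vanishes at [x], the increment of the product is [G] times [E], hence
    [E x] times the differential of [G] up to a term controlled by the continuity
    of [E]. This is how a root that is only known to be continuous is shown to be
    differentiable: its increment is such a product. *)
Lemma differentiable_mul_continuous (C : numFieldType) (X : normedModType C)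
    (G E : X -> C) (x : X) :
  G x = 0 -> differentiable G x -> {for x, continuous E} ->
  differentiable (fun y => G y * E y) x.
Proof.
move=> G0 dG cE.
have [k k0 kG] := linear_lipschitz (diff_continuous dG).
have cdf : continuous (E x \*: 'd G x : X -> C).
  by move=> z; apply: continuousZl_tmp; exact: diff_continuous.
have H : (fun y => G y * E y) \o shift x
   = cst ((fun y => G y * E y) x) + (E x \*: 'd G x : X -> C) +o_ 0 id.
  apply/eqaddoP => _ /posnumP[eps].
  have a0 : 0 < `|E x| + 1 by rewrite ltr_wpDl.
  have e1 : 0 < eps%:num / 2 / (`|E x| + 1) by rewrite !divr_gt0.
  have e2 : 0 < eps%:num / 2 / k by rewrite !divr_gt0.
  have h1 : \forall h \near (0 : X), `|G (h + x) - 'd G x h| <= eps%:num / 2 / (`|E x| + 1) * `|h|.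
    have /eqaddoP := diff_locally dG; move=> /(_ _ e1).
    apply: filterS => h.
    by rewrite !fctE /= G0 add0r.
  have cE' : (fun h => E (h + x)) h @[h --> (0:X)] --> E x.
    rewrite -[in X in _ --> X](add0r x).
    apply: (@continuous_comp _ _ _ (fun h => h + x) E 0).
      exact: (@continuousD _ _ _ id (cst x) 0 (fun _ a => a) (@cst_continuous _ _ _ _)).
    by rewrite add0r.
  have h2 : \forall h \near (0:X), `|E x - E (h + x)| < eps%:num / 2 / k.
    by move/cvgrPdist_lt : cE' => /(_ _ e2).
  have h3 : \forall h \near (0:X), `|E x - E (h + x)| < 1.
    by move/cvgrPdist_lt : cE' => /(_ _ ltr01).
  near=> h.
  rewrite !fctE /= G0 mul0r add0r.
  have -> : G (h + x) * E (h + x) - E x *: 'd G x h =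
    (G (h + x) - 'd G x h) * E (h + x) + 'd G x h * (E (h + x) - E x).
    by rewrite /GRing.scale /=; ring.
  rewrite (le_trans (ler_normD _ _))// !normrM [leRHS](_ : _ = eps%:num / 2 / (`|E x| + 1) *
    `|h| * (`|E x| + 1) + (k * `|h|) * (eps%:num / 2 / k)); last first.
    by field; rewrite !gt_eqF.
  apply: lerD; apply: ler_pM => //.
  - by near: h.
  - have : `|E (h + x)| <= `|E x| + `|E x - E (h + x)|.
      by rewrite -[X in `|X| <= _](subKr (E x)) ler_normB.
    move=> /le_trans; apply; rewrite lerD2l ltW//; near: h; exact: h3.
  - by rewrite distrC ltW//; near: h; exact: h2.
have dE : 'd (fun y => G y * E y) x = (E x \*: 'd G x) :> (X -> C).
  exact: diff_unique.
by apply/diff_locallyP; split; rewrite dE.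
Unshelve. all: by end_near. Qed.

Lemma near_eq_diff (C : numFieldType) (X Y : normedModType C) (f g : X -> Y) (x : X) :
  differentiable f x -> (\forall y \near x, f y = g y) ->
  differentiable g x /\ 'd g x = 'd f x :> (X -> Y).
Proof.
move=> df fg; have fgx : f x = g x by exact: (nbhs_singleton fg).
have H : g \o shift x = cst (g x) + 'd f x +o_ 0 id.
  apply/eqaddoP => _ /posnumP[eps].
  have /eqaddoP /(_ eps%:num) := diff_locally df.
  have fg0 : \forall h \near (0 : X), f (h + x) = g (h + x).
    by move: fg; rewrite (near_shift 0 x) subr0.
  move=> /(_ (gt0 _)) h; apply: filterS2 h fg0 => {}h.
  by rewrite !fctE /= fgx => + <-.
have dE := diff_unique (diff_continuous df) H.
split=> //; apply/diff_locallyP; rewrite dE; split => //.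
exact: diff_continuous.
Qed.

Lemma near_all (C : numFieldType) (X : normedModType C) (x : X) (P : X -> Prop) :
  (forall y, P y) -> \forall y \near x, P y.
Proof. by move=> aP; apply: nearW. Qed.

Lemma near_comp (C : numFieldType) (X Y : normedModType C) (f : X -> Y) (x : X)
    (P : Y -> Prop) :
  differentiable f x -> (\forall y \near f x, P y) -> \forall z \near x, P (f z).
Proof. by move=> df; exact: (differentiable_continuous df). Qed.

Lemma near_neq0 (C : numFieldType) (X : normedModType C) (f : X -> C) (x : X) :
  differentiable f x -> f x != 0 -> \forall y \near x, f y != 0.
Proof.
move=> df fx; have /cvgrPdist_lt /(_ `|f x|) := differentiable_continuous df.
rewrite normr_gt0 => /(_ fx); apply: filterS => y.
by apply: contraTneq => ->; rewrite subr0 ltxx.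
Qed.

Lemma near_dist_lt (C : numFieldType) (X : normedModType C) (f : X -> C) (x : X) (e : C) :
  differentiable f x -> 0 < e -> \forall y \near x, `|f x - f y| < e.
Proof. by move=> df e0; have /cvgrPdist_lt /(_ e e0) := differentiable_continuous df. Qed.

(** The modulus of [p.[z]] is the product of the distances from [z] to the roots. *)
Lemma monic_root_near (C : numClosedFieldType) (p : {poly C}) (z e : C) :
  p \is monic -> 0 < e -> `|p.[z]| < e ^+ (size p).-1 ->
  exists2 r, root p r & `|z - r| < e.
Proof.
move=> pm e0; have [s ps] := closed_field_poly_normal p.
rewrite (monicP pm) scale1r in ps.
have -> : (size p).-1 = size s by rewrite ps size_prod_XsubC.
have -> : `|p.[z]| = \prod_(r <- s) `|z - r|.
  rewrite ps horner_prod normr_prod; apply: eq_bigr => r _.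
  by rewrite hornerXsubC.
move=> lt; suff /hasP[r rs zr] : has (fun r => `|z - r| < e) s.
  by exists r => //; rewrite ps root_prod_XsubC.
apply: contraTT lt => /hasPn ns.
suff ge : e ^+ size s <= \prod_(r <- s) `|z - r|.
  by apply/negP => lt; have := lt_le_trans lt ge; rewrite ltxx.
elim: s ns {ps} => [|r s IH] ns; first by rewrite big_nil.
rewrite big_cons exprS; apply: ler_pM; rewrite ?exprn_ge0 ?(ltW e0)//.
  have := ns r (mem_head _ _).
  by rewrite real_leNgt// ger0_real// ltW.
by apply: IH => t ts; apply: ns; rewrite inE ts orbT.
Qed.

Lemma differentiable_fst (C : numFieldType) (X Y : normedModType C) (p : X * Y) :
  differentiable (fun q : X * Y => q.1) p.
Proof.
have lin : linear (fun q : X * Y => q.1) by [].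
pose M := GRing.isLinear.Build _ _ _ _ _ lin.
pose f : {linear _ -> _} := HB.pack (fun q : X * Y => q.1) M.
apply: (@linear_differentiable _ _ _ f).
by move=> z; exact: cvg_fst.
Qed.

Lemma differentiable_snd (C : numFieldType) (X Y : normedModType C) (p : X * Y) :
  differentiable (fun q : X * Y => q.2) p.
Proof.
have lin : linear (fun q : X * Y => q.2) by [].
pose M := GRing.isLinear.Build _ _ _ _ _ lin.
pose f : {linear _ -> _} := HB.pack (fun q : X * Y => q.2) M.
apply: (@linear_differentiable _ _ _ f).
by move=> z; exact: cvg_snd.
Qed.

Lemma common_lower_bound (C : numFieldType) (a b : C) : 0 < a -> 0 < b ->
  exists2 m, 0 < m & m <= a /\ m <= b.
Proof.
move=> a0 b0; have [ab|ba] := real_leP (gtr0_real a0) (gtr0_real b0).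
  by exists a.
by exists b => //; split => //; exact: ltW.
Qed.

(** A germ of holomorphic root of [q x] through [z0], together with its local
    uniqueness, which lets two branches be compared. *)
Definition root_branch (C : numFieldType) (X : normedModType C) (q : X -> {poly C})
    (x0 : X) (z0 : C) (zeta : X -> C) :=
  [/\ zeta x0 = z0,
      \forall x \near x0, differentiable zeta x,
      \forall x \near x0, root (q x) (zeta x) &
      exists2 e, 0 < e & \forall x \near x0,
        forall z, `|z0 - z| < e -> root (q x) z -> z = zeta x].

Section SimpleRoots.
Variables (C : numClosedFieldType) (X : normedModType C) (d : nat).
Variable c : nat -> X -> C.

Definition monic_family x : {poly C} := 'X^d + \poly_(i < d) c i x.

Lemma monic_family_monic x : monic_family x \is monic.
Proof. by rewrite monicE lead_coefDl ?lead_coefXn// size_polyXn ltnS size_poly. Qed.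

Lemma size_monic_family x : size (monic_family x) = d.+1.
Proof. by rewrite size_polyDl size_polyXn// ltnS size_poly. Qed.

Lemma monic_familyE x z : (monic_family x).[z] = z ^+ d + \sum_(i < d) c i x * z ^+ i.
Proof. by rewrite hornerD hornerXn horner_poly. Qed.

(** The divided difference: q_x(a) - q_x(b) = (a - b) D x a b, and D x a a is the
    derivative. It does not vanish near a simple root, which gives uniqueness. *)
Let D x (a b : C) := \sum_(j < d) a ^+ (d.-1 - j) * b ^+ j +
  \sum_(i < d) c i x * \sum_(j < i) a ^+ (i.-1 - j) * b ^+ j.

Let subD x a b : (monic_family x).[a] - (monic_family x).[b] = (a - b) * D x a b.
Proof.
rewrite !monic_familyE opprD addrACA mulrDr -subrXX; congr (_ + _).
rewrite -sumrB mulr_sumr; apply: eq_bigr => i _.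
by rewrite -mulrBr mulrCA -subrXX.
Qed.

Let derivD x a : (monic_family x)^`().[a] = D x a a.
Proof.
rewrite derivD derivXn hornerD hornerMn hornerXn; congr (_ + _).
  rewrite (eq_bigr (fun=> a ^+ d.-1)) ?sumr_const ?card_ord// => j _.
  by rewrite -exprD subnK// -ltnS (ltn_predK (ltn_ord j)).
rewrite poly_def raddf_sum /= horner_sum; apply: eq_bigr => i _.
rewrite derivZ hornerZ derivXn hornerMn hornerXn; congr (_ * _).
rewrite (eq_bigr (fun=> a ^+ i.-1)) ?sumr_const ?card_ord// => j _.
by rewrite -exprD subnK// -ltnS (ltn_predK (ltn_ord j)).
Qed.

Let D_differentiable x a b : (forall i, (i < d)%N -> differentiable (c i) x) ->
  differentiable (fun p : X * (C * C) => D p.1 p.2.1 p.2.2) (x, (a, b)).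
Proof.
move=> dc.
have d1 := @differentiable_fst C X (C * C)%type (x, (a, b)).
have d2 : differentiable (fun p : X * (C * C) => p.2.1) (x, (a, b)).
  by apply: differentiablef_comp; [exact: differentiable_snd | exact: differentiable_fst].
have d3 : differentiable (fun p : X * (C * C) => p.2.2) (x, (a, b)).
  by apply: differentiablef_comp; [exact: differentiable_snd | exact: differentiable_snd].
apply: differentiablefD; apply: differentiablef_sum => i _.
  by apply: differentiablefM; apply: differentiablefX.
apply: differentiablefM; first by apply: differentiablef_comp => //=; exact: dc.
by apply: differentiablef_sum => j _; apply: differentiablefM; apply: differentiablefX.
Qed.

Let near_diff (x0 : X) := forall i, (i < d)%N -> \forall x \near x0, differentiable (c i) x.

Let near_root x0 z0 e : (forall i, (i < d)%N -> differentiable (c i) x0) ->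
  root (monic_family x0) z0 -> 0 < e ->
  \forall x \near x0, exists2 r, root (monic_family x) r & `|z0 - r| < e.
Proof.
move=> dc /eqP r0 e0.
have dq : differentiable (fun x => (monic_family x).[z0]) x0.
  under eq_fun do rewrite monic_familyE.
  apply: differentiablefD; first exact: differentiablefC.
  by apply: differentiablef_sum => i _; apply: differentiablefM;
    [exact: dc | exact: differentiablefC].
have /cvgrPdist_lt /(_ (e ^+ d)) := differentiable_continuous dq.
rewrite exprn_gt0// => /(_ isT); apply: filterS => x.
rewrite r0 sub0r normrN => lt; apply: monic_root_near => //.
  exact: monic_family_monic.
by rewrite size_monic_family.
Qed.

Let near_D x0 z0 : (forall i, (i < d)%N -> differentiable (c i) x0) ->
  D x0 z0 z0 != 0 -> exists2 e, 0 < e & \forall x \near x0,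
    forall a b, `|z0 - a| < e -> `|z0 - b| < e -> D x a b != 0.
Proof.
move=> dc Dn0.
have dD := D_differentiable z0 z0 dc.
have /cvgrPdist_lt /(_ `|D x0 z0 z0|) := differentiable_continuous dD.
rewrite normr_gt0 => /(_ Dn0) /nbhs_ballP [e /= e0 eB].
exists e => //; apply/nbhs_ballP; exists e => // x xB a b az bz.
have /eB /= : ball (x0, (z0, z0)) e (x, (a, b)) by [].
by apply: contraTneq => ->; rewrite subr0 ltxx.
Qed.

(** A root of q_x near [z0] exists because q_x(z0) is small ([monic_root_near]); it
    is unique because the divided difference does not vanish. At a nearby [x1],
    zeta(x1) is again a simple root, so that existence and uniqueness show that
    zeta is continuous there; then zeta(x1) - zeta(x) equals q_x(zeta(x1)) divided
    by the divided difference, a differentiable function vanishing at [x1] times a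
    continuous one, hence is differentiable. *)
Lemma simple_root_branch x0 z0 :
  near_diff x0 -> root (monic_family x0) z0 ->
  ~~ root (monic_family x0)^`() z0 ->
  exists zeta, root_branch monic_family x0 z0 zeta.
Proof.
move=> ndc rz0; rewrite rootE derivD => D0.
have nc : \forall x \near x0, forall i, (i < d)%N -> differentiable (c i) x.
  have : \forall x \near x0, forall i : 'I_d, differentiable (c i) x.
    by apply: filter_forall => i; exact: ndc.
  by apply: filterS => x H i id; exact: (H (Ordinal id)).
have [e e0 eD] := near_D (nbhs_singleton nc) D0.
pose S x := [set z | `|z0 - z| < e /\ root (monic_family x) z].
pose zeta x := xget z0 (S x).
have nr : \forall x \near x0, S x !=set0.
  apply: filterS (near_root (nbhs_singleton nc) rz0 e0) => x [r rr lr].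
  by exists r.
have zetaS x : S x !=set0 -> S x (zeta x).
  by move=> [z Sz]; exact: xgetI Sz.
have uniqS x : (forall a b, `|z0 - a| < e -> `|z0 - b| < e -> D x a b != 0) ->
    forall z, S x z -> z = zeta x.
  move=> Dx z Sz; have [l1 /eqP r1] := zetaS x (ex_intro _ _ Sz); case: Sz => l2 /eqP r2.
  have := subD x z (zeta x); rewrite r1 r2 subr0 => /esym /eqP.
  by rewrite mulf_eq0 (negPf (Dx _ _ l2 l1)) orbF subr_eq0 => /eqP.
exists zeta; split.
- by apply/esym/uniqS; [exact: nbhs_singleton eD | split=> //; rewrite subrr normr0].
- have nbN : nbhs x0 ((fun x => forall i, (i < d)%N -> differentiable (c i) x) `&`
    ((fun x => forall a b, `|z0 - a| < e -> `|z0 - b| < e -> D x a b != 0) `&`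
     (fun x => S x !=set0))).
    by apply: filterI nc (filterI eD nr).
  move: (nbhs_interior nbN); apply: filterS => x1.
  move=> nb1; have [nc1 [eD1 nr1]] := nbhs_singleton nb1.
  have [l1 /eqP r1] := zetaS x1 nr1.
  have rt1 : root (monic_family x1) (zeta x1) by apply/eqP.
  have czeta : {for x1, continuous zeta}.
    apply/cvgrPdist_lt => eps eps0.
    have d1 : 0 < e - `|z0 - zeta x1| by rewrite subr_gt0.
    have [m m0 [me md]] := common_lower_bound eps0 d1.
    have := near_root nc1 rt1 m0.
    move: nb1; apply: filterS2 => x [_ [Dx _]] [r rr lr].
    suff <- : r = zeta x.
      by exact: lt_le_trans lr me.
    apply: (uniqS x Dx); split => //.
    rewrite (le_lt_trans (ler_distD (zeta x1) _ _))// -ltrBrDl.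
    by exact: lt_le_trans lr md.
  pose G x := (monic_family x).[zeta x1].
  have dG : differentiable G x1.
    rewrite /G; under eq_fun do rewrite monic_familyE.
    apply: differentiablefD; first exact: differentiablefC.
    by apply: differentiablef_sum => i _; apply: differentiablefM;
      [exact: nc1 | exact: differentiablefC].
  pose E x := (D x (zeta x) (zeta x1))^-1.
  have cE : {for x1, continuous E}.
    have dD := D_differentiable (zeta x1) (zeta x1) nc1.
    rewrite /E.
    have cD : {for x1, continuous (fun x => D x (zeta x) (zeta x1))}.
      apply/cvgrPdist_lt => eps eps0.
      have /cvgrPdist_lt /(_ eps eps0) := differentiable_continuous dD.
      move=> /nbhs_ballP[del /= del0 B].
      have nz : \forall x \near x1, `|zeta x1 - zeta x| < del.
        by move/cvgrPdist_lt : czeta => /(_ _ del0).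
      apply: filterS2 (nbhsx_ballx x1 _ del0) nz => x h1 h2.
      apply: (B (x, (zeta x, zeta x1))); split => //; split => //.
      exact: ballxx.
    by apply: continuousV => //; exact: eD1.
  have df : differentiable (fun x => zeta x1 - G x * E x) x1.
    apply: differentiablefD; first exact: differentiablefC.
    by apply: differentiablefN; apply: differentiable_mul_continuous.
  apply: (proj1 (near_eq_diff df _)).
  move: nb1; apply: filterS => x [_ [Dx nrx]].
  have [l2 /eqP r2] := zetaS x nrx.
  have := subD x (zeta x) (zeta x1); rewrite r2 sub0r /G /E => /eqP.
  rewrite eqr_oppLR => /eqP ->.
  by rewrite mulNr mulfK ?Dx// opprK addrC subrK.
- by apply: filterS nr => x /zetaS [].
- by exists e => //; apply: filterS eD => x Dx z lz rz; apply: uniqS.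
Qed.

End SimpleRoots.

Lemma polynomial_root_branch (C : numClosedFieldType) (X : normedModType C) (d : nat)
    (q : X -> {poly C}) x0 z0 :
  (forall x, q x \is monic) -> (forall x, size (q x) = d.+1) ->
  (forall i x, differentiable (fun x => (q x)`_i) x) ->
  root (q x0) z0 -> ~~ root (q x0)^`() z0 ->
  exists zeta, root_branch q x0 z0 zeta.
Proof.
move=> qm qs dq.
pose c i x := (q x)`_i.
have -> : q = monic_family d c.
  apply/funext => x; apply/polyP => i; rewrite /monic_family coefD coefXn coef_poly.
  have [id|di|->] := ltngtP i d; rewrite ?add0r ?addr0//.
    by rewrite nth_default ?qs.
  by have /monicP := qm x; rewrite lead_coefE qs.
by apply: simple_root_branch => i _; apply: near_all => x; exact: dq.
Qed.

(** * Roots of units *)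

Section UnitRoots.
Variable C : numClosedFieldType.

(** Let beta be a holomorphic K-th root of the unit [E]. The function T = t beta(t)^j
    is a local coordinate: its inverse is t = T / rho(T)^j, where rho is beta
    expressed in terms of T. With d the size of [E], the equation rho^K = E(T / rho^j)
    becomes monic after multiplication by rho^(j d):
    rho^(K + j d) = sum_i E_i T^i rho^(j (d - i)),
    and at T = 0 the K-th roots of E(0) are simple roots of it. *)
Lemma unit_root_coordinate (E : {poly C}) (K j : nat) : E.[0] != 0 -> (0 < K)%N ->
  exists be rho : C -> C,
  [/\ \forall t \near 0, [/\ differentiable be t, be t != 0 & be t ^+ K = E.[t]],
      \forall t \near 0, [/\ differentiable rho t, rho t != 0 &
          rho t ^+ K = E.[t / rho t ^+ j]],
      \forall t \near 0, rho (t * be t ^+ j) = be t &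
      \forall t \near 0, be (t / rho t ^+ j) = rho t].
Proof.
move=> E0 K0; pose D := (K + j * size E)%N.
have [w0 w0E] : exists w0, w0 ^+ K = E.[0].
  by exists (K.-root E.[0]); rewrite rootCK.
have w00 : w0 != 0.
  by apply: contra_neq E0 => w00; rewrite -w0E w00 expr0n gtn_eqF.
have sXC n (p : {poly C}) : (size p <= n)%N -> size ('X^n - p) = n.+1.
  by move=> pn; rewrite size_polyDl size_polyXn// size_polyN ltnS.
have mXC n (p : {poly C}) : (size p <= n)%N -> 'X^n - p \is monic.
  by move=> pn; rewrite monicE lead_coefDl ?lead_coefXn// size_polyXn size_polyN ltnS.
have [be [be0 dbe rbe [eb eb0 ube]]] : exists be,
    root_branch (fun t => 'X^K - E.[t]%:P) 0 w0 be.
  have sE t : (size E.[t]%:P <= K)%N := leq_trans (size_polyC_leq1 _) K0.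
  apply: (@polynomial_root_branch _ _ K) => [t|t|i t||].
  - exact: mXC.
  - exact: sXC.
  - apply: polyfun1_differentiable.
    under eq_fun do rewrite coefB coefXn coefC.
    apply: polyfun1D; first exact: polyfun1C.
    apply: polyfun1N; apply: polyfun1_if; last exact: polyfun1C.
    by exists E.
  - by rewrite rootE !hornerE w0E subrr.
  - rewrite rootE derivB derivXn derivC subr0 hornerMn hornerXn.
    by rewrite mulrn_eq0 expf_eq0 (negPf w00) andbF orbF -lt0n.
pose q (T : C) : {poly C} := 'X^D - \sum_(i < size E) (E`_i * T ^+ i) *: 'X^(j * (size E - i)).
have qE T z : (q T).[z] = z ^+ D - \sum_(i < size E) E`_i * T ^+ i * z ^+ (j * (size E - i)).
  rewrite hornerD hornerN hornerXn horner_sum; congr (_ - _).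
  by apply: eq_bigr => i _; rewrite hornerZ hornerXn.
have sq T : (size (\sum_(i < size E) (E`_i * T ^+ i) *: 'X^(j * (size E - i)))%R <= D)%N.
  apply: leq_trans (size_sum _ _ _) _; apply/bigmax_leqP => i _.
  apply: leq_trans (size_scale_leq _ _) _; rewrite size_polyXn /D.
  by rewrite -add1n leq_add// leq_mul2l leq_subr orbT.
have sumE t z : z != 0 -> \sum_(i < size E) E`_i * (t * z ^+ j) ^+ i * z ^+ (j * (size E - i))
    = E.[t] * z ^+ (j * size E).
  move=> z0; rewrite horner_coef mulr_suml; apply: eq_bigr => i _.
  rewrite exprMn -!mulrA; congr (_ * (_ * _)).
  by rewrite -exprM -exprD -mulnDr subnKC// ltnW.
have root_q t T z : z != 0 -> T = t * z ^+ j -> root (q T) z = (z ^+ K == E.[t]).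
  move=> z0 ->; rewrite rootE qE sumE// /D exprD -mulrBl mulf_eq0 expf_eq0.
  by rewrite (negPf z0) andbF orbF subr_eq0.
have [rho [rho0 drho rrho [er er0 urho]]] : exists rho, root_branch q 0 w0 rho.
  apply: (@polynomial_root_branch _ _ D) => [t|t|i t||].
  - exact: mXC.
  - exact: sXC.
  - apply: polyfun1_differentiable.
    under eq_fun do rewrite coefB coefXn coef_sum.
    apply: polyfun1D; first exact: polyfun1C.
    apply: polyfun1N; apply: polyfun1_sum => l.
    under eq_fun do rewrite coefZ.
    apply: polyfun1M; last exact: polyfun1C.
    apply: polyfun1M; first exact: polyfun1C.
    by apply: polyfun1X; exact: polyfun1_id.
  - by rewrite (root_q 0) ?mul0r// w0E.
  - have -> : q 0 = 'X^D - E.[0] *: 'X^(j * size E).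
      rewrite /q; congr (_ - _).
      have sE : (0 < size E)%N.
        by rewrite lt0n size_poly_eq0; apply: contra_neq E0 => ->; rewrite horner0.
      rewrite (bigD1 (Ordinal sE)) //= subn0 expr0 mulr1 -horner_coef0 big1 ?addr0// => i.
      by rewrite -val_eqE /= => i0; rewrite expr0n (negPf i0) mulr0 scale0r.
    rewrite rootE derivB derivZ !derivXn hornerD hornerN hornerZ !hornerMn !hornerXn.
    apply/eqP => /(congr1 (fun z => z * w0)); rewrite mul0r mulrBl.
    have wS n : w0 ^+ n.-1 *+ n * w0 = w0 ^+ n *+ n.
      by case: n => [|n]; rewrite ?mulr0n ?mul0r// mulrnAl -exprSr.
    rewrite -mulrA !wS mulrnAr -w0E -exprD -mulrnBr ?leq_addl// addnK => /eqP.
    by rewrite mulrn_eq0 expf_eq0 (negPf w00) andbF orbF gtn_eqF.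
have db0 := nbhs_singleton dbe; have dr0 := nbhs_singleton drho.
have bn0 : \forall t \near 0, be t != 0 by apply: near_neq0; rewrite ?be0.
have rn0 : \forall t \near 0, rho t != 0 by apply: near_neq0; rewrite ?rho0.
have bK : \forall t \near 0, be t ^+ K = E.[t].
  apply: filterS rbe => t; rewrite rootE !hornerE subr_eq0.
  by move=> /eqP.
exists be, rho; split.
- by apply: filterS3 dbe bn0 bK.
- apply: filterS3 drho rn0 rrho => t dt rt rtK; split => //.
  by apply/eqP; rewrite -(root_q _ t)// divfK// expf_neq0.
- have dT : differentiable (fun t : C => t * be t ^+ j) 0.
    by apply: differentiablefM; [exact: ex_diff | exact: differentiablefX].
  have T0 : 0 * be 0 ^+ j = 0 by rewrite mul0r.
  have := near_comp dT; rewrite T0 => /(_ _ urho) n1.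
  have := near_dist_lt db0 er0; rewrite be0 => n2.
  have n3 : \forall t \near 0, be t != 0 /\ be t ^+ K = E.[t] by apply: filterS2 bn0 bK.
  apply: filterS3 n3 n1 n2 => t [bt0 btK] u l.
  by apply/esym/u => //; rewrite (root_q t) ?btK.
- have dT : differentiable (fun t : C => t / rho t ^+ j) 0.
    apply: differentiablefM; first exact: ex_diff.
    apply: differentiablefV; last exact: differentiablefX.
    by rewrite rho0 expf_neq0.
  have T0 : 0 / rho 0 ^+ j = 0 by rewrite mul0r.
  have := near_comp dT; rewrite T0 => /(_ _ ube) n1.
  have := near_dist_lt dr0 eb0; rewrite rho0 => n2.
  have n3 : \forall t \near 0, rho t != 0 /\ root (q t) (rho t) by apply: filterS2 rn0 rrho.
  apply: filterS3 n3 n1 n2 => t [rt0 rtK] u l.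
  apply/esym/u => //; rewrite rootE !hornerE subr_eq0.
  by rewrite -(root_q _ t)// divfK// expf_neq0.
Qed.
End UnitRoots.

(** * Isomorphisms of germs and normal forms *)

Section Germs.
Variable C : numClosedFieldType.

(** Open sets that phi and psi exchange are obtained by shrinking: the interior of
    the domain of validity on one side, intersected with the preimage of the other. *)
Lemma local_biholomorphism_equivalent_germs m (f g u : 'rV[C]_m -> C) (p q : 'rV[C]_m)
    (phi psi : 'rV[C]_m -> 'rV[C]_m) :
  phi q = p ->
  (\forall x \near q, differentiable phi x /\ psi (phi x) = x) ->
  (\forall x \near p, differentiable psi x /\ phi (psi x) = x) ->
  (\forall x \near q, [/\ differentiable u x, u x != 0 & f (phi x) = u x * g x]) ->
  equivalent_germs f p g q.
Proof.
move=> phiq nphi npsi nu.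
pose A := [set x | [/\ differentiable phi x, psi (phi x) = x &
   [/\ differentiable u x, u x != 0 & f (phi x) = u x * g x]]].
pose B := [set x | differentiable psi x /\ phi (psi x) = x].
have nA : nbhs q A by apply: filterS2 nphi nu => x [? ?] ?.
have nB : nbhs p B by apply: filterS npsi => x [].
have psip : psi p = q by rewrite -phiq; case: (nbhs_singleton nA).
have sA : A° `<=` A := @interior_subset _ A.
have sB : B° `<=` B := @interior_subset _ B.
have oU : open (A° `&` phi @^-1` B°).
  rewrite openE => x [Ax Bx]; rewrite /interior; apply: filterI.
    by apply: open_nbhs_nbhs; split => //; exact: open_interior.
  have [dx _ _] := sA _ Ax; have := differentiable_continuous dx; apply.
  by apply: open_nbhs_nbhs; split => //; exact: open_interior.
have oV : open (B° `&` psi @^-1` A°).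
  rewrite openE => x [Bx Ax]; rewrite /interior; apply: filterI.
    by apply: open_nbhs_nbhs; split => //; exact: open_interior.
  have [dx _] := sB _ Bx; have := differentiable_continuous dx; apply.
  by apply: open_nbhs_nbhs; split => //; exact: open_interior.
exists (A° `&` phi @^-1` B°), (B° `&` psi @^-1` A°), phi, psi, u; split.
- split => //; first by split => //=; rewrite phiq.
  by split => //=; rewrite psip.
- move=> x [Ax Bx]; have [d e _] := sA _ Ax; split => //.
  by split => //=; rewrite e.
- move=> x [Bx Ax]; have [d e] := sB _ Bx; split => //.
  by split => //=; rewrite e.
- by move=> x [Ax _]; have [_ _ [? ? _]] := sA _ Ax.
- by move=> x [Ax _]; have [_ _ [_ _ ?]] := sA _ Ax.
Qed.

Lemma equivalent_germs_trans m (f g h : 'rV[C]_m -> C) (p q r : 'rV[C]_m) :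
  equivalent_germs f p g q -> equivalent_germs g q h r -> equivalent_germs f p h r.
Proof.
move=> [U1 [V1 [phi1 [psi1 [u1 [[oU1 oV1 U1q V1p e1] h1 k1 l1 m1]]]]]].
move=> [U2 [V2 [phi2 [psi2 [u2 [[oU2 oV2 U2r V2q e2] h2 k2 l2 m2]]]]]].
have n1 : nbhs q U1 by exact: open_nbhs_nbhs.
have n1' : nbhs p V1 by exact: open_nbhs_nbhs.
have n2 : nbhs r U2 by exact: open_nbhs_nbhs.
have n2' : nbhs q V2 by exact: open_nbhs_nbhs.
have psi1p : psi1 p = q by rewrite -e1; case: (h1 _ U1q).
have c2 : \forall x \near r, U1 (phi2 x).
  by have [_ _ d] := h2 _ U2r; apply: near_comp => //; rewrite e2.
have c1 : \forall x \near p, V2 (psi1 x).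
  by have [_ _ d] := k1 _ V1p; apply: near_comp => //; rewrite psi1p.
apply: (@local_biholomorphism_equivalent_germs _ f h (fun x => u1 (phi2 x) * u2 x)
  p r (phi1 \o phi2) (psi2 \o psi1)).
- by rewrite /= e2.
- apply: filterS2 n2 c2 => x U2x U1x /=.
  have [_ -> d1] := h1 _ U1x; have [_ e d2] := h2 _ U2x; split => //.
  exact: differentiablef_comp.
- apply: filterS2 n1' c1 => x V1x V2x /=.
  have [_ e d1] := k1 _ V1x; have [_ -> d2] := k2 _ V2x; split => //.
  exact: differentiablef_comp.
- apply: filterS2 n2 c2 => x U2x U1x.
  have [d1 z1] := l1 _ U1x; have [d2 z2] := l2 _ U2x.
  have [_ _ d] := h2 _ U2x.
  split; last by rewrite /= m1// m2// mulrA.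
    by apply: differentiablefM => //; exact: differentiablef_comp.
  by rewrite mulf_neq0.
Qed.


Section NormalForms.
Variable k : nat.
Implicit Types (x p : 'rV[C]_(k + 2)) (l : 'I_k -> C) (s t : C).

Definition xco x i : C := lsubmx x 0 i.

Definition point l s t : 'rV[C]_(k + 2) :=
  row_mx (\row_i l i) (\row_j (if j == ord0 then s else t)).

Lemma xco_point l s t i : xco (point l s t) i = l i.
Proof. by rewrite /xco row_mxKl mxE. Qed.

Lemma yco_point l s t : yco (point l s t) = s.
Proof. by rewrite /yco row_mxKr mxE eqxx. Qed.

Lemma zco_point l s t : zco (point l s t) = t.
Proof. by rewrite /zco row_mxKr mxE. Qed.

Lemma point_eta x : point (xco x) (yco x) (zco x) = x.
Proof.
rewrite -[RHS]hsubmxK; congr row_mx; apply/rowP => i; rewrite mxE//.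
case: ifP => [/eqP -> //|]; rewrite /zco => i0; congr (rsubmx x 0 _).
by apply/val_inj; case: i i0 => -[|[|]].
Qed.

Lemma point_eq x l s t : (forall i, xco x i = l i) -> yco x = s -> zco x = t ->
  x = point l s t.
Proof.
by move=> /funext <- <- <-; rewrite point_eta.
Qed.

Lemma sum_squares_xco x : sum_squares x = \sum_i xco x i ^+ 2.
Proof. by []. Qed.

Lemma xco0 i : xco 0 i = 0. Proof. by rewrite /xco !mxE. Qed.
Lemma yco0 : yco (0 : 'rV[C]_(k + 2)) = 0. Proof. by rewrite /yco !mxE. Qed.
Lemma zco0 : zco (0 : 'rV[C]_(k + 2)) = 0. Proof. by rewrite /zco !mxE. Qed.

Lemma differentiable_xco i x : differentiable (fun x => xco x i) x.
Proof. by rewrite /xco; under eq_fun do rewrite mxE; exact: differentiable_rV_coord. Qed.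

Lemma differentiable_yco x : differentiable (@yco C k) x.
Proof. by rewrite /yco; under eq_fun do rewrite mxE; exact: differentiable_rV_coord. Qed.

Lemma differentiable_zco x : differentiable (@zco C k) x.
Proof. by rewrite /zco; under eq_fun do rewrite mxE; exact: differentiable_rV_coord. Qed.

Lemma differentiable_point (X : normedModType C) (L : X -> 'I_k -> C) (S T : X -> C) (z : X) :
  (forall i, differentiable (fun y => L y i) z) -> differentiable S z ->
  differentiable T z -> differentiable (fun y => point (L y) (S y) (T y)) z.
Proof.
move=> dl ds dt; apply: differentiable_rV => j; rewrite /point.
case: (split_ordP j) => i ->.
  by under eq_fun do rewrite row_mxEl mxE; exact: dl.
under eq_fun do rewrite row_mxEr mxE.
by case: (i == ord0).
Qed.

Lemma differentiable_translate p x : differentiable (fun y => p + y) x.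
Proof. by apply: differentiableD; [exact: differentiable_cst | exact: ex_diff]. Qed.

Lemma differentiable_translateN p x : differentiable (fun y => y - p) x.
Proof. by under eq_fun do rewrite addrC; exact: differentiable_translate. Qed.

Lemma near_zco x (P : C -> Prop) : (\forall t \near zco x, P t) -> \forall y \near x, P (zco y).
Proof. by move=> nP; apply: near_comp => //; exact: differentiable_zco. Qed.

(** s^2 t + t^2 = (t + s^2 / 2)^2 - s^4 / 4, and the factor - 1 / 4 is absorbed in
    [s] by a fourth root of - 4. *)
Lemma normal_form_D3 : singularity_of_type (A 3) (@normal_form C (D 3) k) 0.
Proof.
have [c c4] : exists c : C, c ^+ 4 = - 4 by exists (4.-root (- 4)); rewrite rootCK.
have c0 : c != 0 by apply: contra_eq_neq c4 => ->; rewrite expr0n eq_sym oppr_eq0 pnatr_eq0.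
pose phi x := point (xco x) (c * zco x) (yco x - (c * zco x) ^+ 2 / 2).
pose psi x := point (xco x) (zco x + yco x ^+ 2 / 2) (yco x / c).
have dphi x : differentiable phi x.
  apply: differentiable_point => [i||]; first exact: differentiable_xco.
    by apply: differentiablefM; [exact: differentiablefC | exact: differentiable_zco].
  apply: differentiablefD; first exact: differentiable_yco.
  apply: differentiablefN; apply: differentiablefM; last exact: differentiablefC.
  by apply: differentiablefX; apply: differentiablefM;
    [exact: differentiablefC | exact: differentiable_zco].
have dpsi x : differentiable psi x.
  apply: differentiable_point => [i||]; first exact: differentiable_xco.
    apply: differentiablefD; first exact: differentiable_zco.
    by apply: differentiablefM; [apply: differentiablefX;
      exact: differentiable_yco | exact: differentiablefC].
  by apply: differentiablefM; [exact: differentiable_yco | exact: differentiablefC].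
apply: (@local_biholomorphism_equivalent_germs _ _ _ (fun=> 1) _ _ phi psi).
- apply/esym/point_eq => [i||]; rewrite ?xco0 ?yco0 ?zco0 ?mulr0//.
  by rewrite expr0n mul0r subr0.
- apply: near_all => x; split => //; apply/esym/point_eq => [i||].
  + by rewrite xco_point.
  + by rewrite zco_point yco_point subrK.
  + by rewrite yco_point mulrC mulKf.
- apply: near_all => x; split => //; apply/esym/point_eq => [i||].
  + by rewrite xco_point.
  + by rewrite /psi zco_point [c * _]mulrC divfK.
  + by rewrite /psi zco_point yco_point [c * _]mulrC divfK// addrK.
- apply: near_all => x; split; [exact: differentiablefC | by rewrite oner_eq0|].
  rewrite mul1r /= !sum_squares_xco yco_point zco_point.
  under eq_bigr do rewrite xco_point.
  rewrite -!addrA; congr (_ + _).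
  transitivity (yco x ^+ 2 - c ^+ 4 / 4 * zco x ^+ 4); first by field.
  by rewrite c4 mulNr divff ?pnatr_eq0// mulN1r opprK.
Qed.

(** Let beta^(2 (m - 1)) = E. In the coordinates S = s / beta and T = t beta^2, the term
    s^2 t is S^2 T and t^(m - 1) E(t) is T^(m - 1). *)
Lemma type_D_of_expansion m (f : 'rV[C]_(k + 2) -> C) p (E : {poly C}) :
  (1 < m)%N -> E.[0] != 0 ->
  (forall x, f (p + x) =
     sum_squares x + yco x ^+ 2 * zco x + zco x ^+ m.-1 * E.[zco x]) ->
  singularity_of_type (D m) f p.
Proof.
move=> m1 E0 fE.
have m0 : (0 < 2 * m.-1)%N by rewrite muln_gt0 /= -subn1 subn_gt0.
have [be [rho [nb nr nrb nbr]]] := unit_root_coordinate 2 E0 m0.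
pose phi x := p + point (xco x) (yco x * rho (zco x)) (zco x / rho (zco x) ^+ 2).
pose psi' x := point (xco x) (yco x / be (zco x)) (zco x * be (zco x) ^+ 2).
pose psi x := psi' (x - p).
have phi0 : phi 0 = p.
  rewrite /phi (_ : point _ _ _ = 0) ?addr0//.
  by apply/esym/point_eq => [i||]; rewrite ?xco0 ?yco0 ?zco0 ?mul0r.
have phidiff x : differentiable rho (zco x) -> rho (zco x) != 0 -> differentiable phi x.
  move=> dx rx; rewrite /phi; apply: differentiablef_comp (differentiable_translate _ _).
  have drz : differentiable (fun x => rho (zco x)) x by apply: differentiablef_comp => //;
    exact: differentiable_zco.
  apply: differentiable_point => [i||]; first exact: differentiable_xco.
    by apply: differentiablefM => //; exact: differentiable_yco.
  apply: differentiablefM; first exact: differentiable_zco.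
  by apply: differentiablefV; [rewrite expf_neq0|exact: differentiablefX].
have psidiff x : differentiable be (zco x) -> be (zco x) != 0 -> differentiable psi' x.
  move=> dx bx; rewrite /psi'.
  have drz : differentiable (fun x => be (zco x)) x by apply: differentiablef_comp => //;
    exact: differentiable_zco.
  apply: differentiable_point => [i||]; first exact: differentiable_xco.
    by apply: differentiablefM; [exact: differentiable_yco | exact: differentiablefV].
  apply: differentiablefM; first exact: differentiable_zco.
  exact: differentiablefX.
pose P t := [/\ differentiable rho t, rho t != 0,
  rho t ^+ (2 * m.-1) = E.[t / rho t ^+ 2] & be (t / rho t ^+ 2) = rho t].
pose Q t := [/\ differentiable be t, be t != 0 & rho (t * be t ^+ 2) = be t].
have nP : \forall x \near (0 : 'rV[C]_(k + 2)), P (zco x).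
  by apply: near_zco; rewrite zco0; apply: filterS2 nr nbr => t [].
have nQ : \forall x \near (0 : 'rV[C]_(k + 2)), Q (zco x).
  by apply: near_zco; rewrite zco0; apply: filterS2 nb nrb => t [].
apply: (@local_biholomorphism_equivalent_germs _ _ _ (fun=> 1) _ _ phi psi) => //.
- apply: filterS nP => x [d1 r1 _ e1]; split; first exact: phidiff.
  rewrite /psi /phi addrC addKr; apply/esym/point_eq => [i||].
  + by rewrite xco_point.
  + by rewrite yco_point zco_point e1 mulfK.
  + by rewrite zco_point e1 divfK// expf_neq0.
- have := near_comp (differentiable_translateN p p) (_ : \forall y \near p - p, Q (zco y)).
  rewrite subrr => /(_ nQ).
  apply: filterS => x [d1 r1 e1]; split.
    by apply: (@differentiablef_comp _ _ _ _ (fun x => x - p));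
      [exact: differentiable_translateN | exact: psidiff].
  rewrite /psi /phi; transitivity (p + (x - p)); last by rewrite addrC subrK.
  congr (p + _); apply/esym/point_eq => [i||].
  + by rewrite xco_point.
  + by rewrite yco_point zco_point e1 divfK.
  + by rewrite zco_point e1 mulfK// expf_neq0.
- apply: filterS nP => x [d1 r1 EE _].
  split; [exact: differentiablefC | by rewrite oner_eq0|].
  rewrite mul1r /phi fE /= !sum_squares_xco yco_point zco_point -EE.
  under eq_bigr do rewrite xco_point.
  rewrite exprM -exprMn divfK ?expf_neq0//; congr (_ + _ + _).
  by field.
Qed.

(** Up to the unit a + t, the function is in normal form in the coordinates
    X_i = sqrt(a + t) x_i, S = (a + t) s + b t and T = t beta, where
    beta^(m + 1) = E. *)
Lemma type_A_of_expansion m (f : 'rV[C]_(k + 2) -> C) p (E : {poly C}) (a b : C) :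
  a != 0 -> E.[0] != 0 ->
  (forall x, (a + zco x) * f (p + x) = (a + zco x) * sum_squares x +
     ((a + zco x) * yco x + b * zco x) ^+ 2 + zco x ^+ m.+1 * E.[zco x]) ->
  singularity_of_type (A m) f p.
Proof.
move=> a0 E0 fE.
have [be [rho [nb nr nrb nbr]]] := unit_root_coordinate 1 E0 (ltn0Sn m).
have a0' : (a%:P + 'X).[0] != 0 by rewrite !hornerE.
(* A holomorphic square root of a + t. *)
have [sg [_ [nsg _ _ _]]] := unit_root_coordinate 0 a0' (ltn0Sn 1).
pose T t := t / rho t.
pose phi x := p + point (fun i => xco x i / sg (T (zco x)))
  ((yco x - b * T (zco x)) / (a + T (zco x))) (T (zco x)).
pose psi' x := point (fun i => sg (zco x) * xco x i) ((a + zco x) * yco x + b * zco x)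
  (zco x * be (zco x)).
pose psi x := psi' (x - p).
pose u x := (a + T (zco x))^-1.
have [dr r0 _] := nbhs_singleton nr.
have dT t : differentiable rho t -> rho t != 0 -> differentiable T t.
  move=> dt rt; rewrite /T; apply: differentiablefM; first exact: ex_diff.
  exact: differentiablefV.
have T0 : T 0 = 0 by rewrite /T mul0r.
have phi0 : phi 0 = p.
  rewrite /phi (_ : point _ _ _ = 0) ?addr0//.
  apply/esym/point_eq => [i||]; rewrite ?xco0 ?yco0 ?zco0 ?T0 ?mul0r//.
  by rewrite mulr0 subr0 mul0r.
have na : \forall t \near (0 : C), a + t != 0.
  apply: near_neq0; last by rewrite addr0.
  by apply: differentiablefD; [exact: differentiablefC | exact: ex_diff].
pose P t := [/\ differentiable T t, a + T t != 0, rho t ^+ m.+1 = E.[T t], be (T t) = rho t &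
    [/\ rho t != 0, differentiable sg (T t), sg (T t) != 0 & sg (T t) ^+ 2 = a + T t]].
have nsT : \forall t \near (0 : C), [/\ differentiable sg (T t), sg (T t) != 0 &
    sg (T t) ^+ 2 = (a%:P + 'X).[T t]].
  apply: (near_comp (P := fun t => [/\ differentiable sg t, sg t != 0 &
    sg t ^+ 2 = (a%:P + 'X).[t]]) (dT _ dr r0)).
  by rewrite T0.
have naT : \forall t \near (0 : C), a + T t != 0.
  by apply: (near_comp (P := fun t => a + t != 0) (dT _ dr r0)); rewrite T0.
have nP0 : \forall t \near (0 : C), P t.
  have n1 : \forall t \near (0 : C), [/\ differentiable rho t, rho t != 0,
     rho t ^+ m.+1 = E.[T t] & be (T t) = rho t].
    by apply: filterS2 nr nbr => t; rewrite /T expr1 => -[? ? ?] ?.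
  apply: filterS3 naT nsT n1 => t at0 [d1 s1 e1] [d2 r2 e2 e3].
  split => //; first exact: dT.
  by split => //; rewrite e1 !hornerE.
pose Q t := [/\ differentiable be t, be t != 0, T (t * be t) = t, a + t != 0 &
    differentiable sg t /\ sg t != 0].
have nQ0 : \forall t \near (0 : C), Q t.
  have n1 : \forall t \near (0 : C), differentiable sg t /\ sg t != 0.
    by apply: filterS nsg => t [].
  have n2 : \forall t \near (0 : C), [/\ differentiable be t, be t != 0 & T (t * be t) = t].
    apply: filterS2 nb nrb => t [d1 b1 _]; rewrite /T expr1 => ->; split => //.
    by rewrite mulfK.
  by apply: filterS3 na n1 n2 => t ? ? [].
have nP : \forall x \near (0 : 'rV[C]_(k + 2)), P (zco x).
  by apply: near_zco; rewrite zco0.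
have nQ : \forall x \near (0 : 'rV[C]_(k + 2)), Q (zco x).
  by apply: near_zco; rewrite zco0.
have dTz x : P (zco x) -> differentiable (fun x => T (zco x)) x.
  by case=> dTx _ _ _ _; apply: differentiablef_comp => //; exact: differentiable_zco.
have daTz x : P (zco x) -> differentiable (fun x => a + T (zco x)) x.
  by move=> Px; apply: differentiablefD; [exact: differentiablefC | exact: dTz].
apply: (@local_biholomorphism_equivalent_germs _ _ _ u _ _ phi psi) => //.
- apply: filterS nP => x Px; have [dTx aT E1 e1 [r1 ds s1 e2]] := Px; split.
    rewrite /phi; apply: differentiablef_comp (differentiable_translate _ _).
    apply: differentiable_point => [i||]; last exact: dTz.
      apply: differentiablefM; first exact: differentiable_xco.
      by apply: differentiablefV => //; apply: differentiablef_comp => //; exact: dTz.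
    apply: differentiablefM; last by apply: differentiablefV => //; exact: daTz.
    apply: differentiablefD; first exact: differentiable_yco.
    by apply: differentiablefN; apply: differentiablefM; [exact: differentiablefC | exact: dTz].
  rewrite /psi /phi addrC addKr; apply/esym/point_eq => [i||].
  + by rewrite xco_point zco_point mulrC divfK.
  + by rewrite yco_point zco_point [(a + _) * _]mulrC divfK// subrK.
  + by rewrite zco_point e1 /T divfK.
- have := near_comp (differentiable_translateN p p) (_ : \forall y \near p - p, Q (zco y)).
  rewrite subrr => /(_ nQ).
  apply: filterS => x [d1 b1 e1 a1 [ds s1]]; split.
    apply: (@differentiablef_comp _ _ _ _ (fun x => x - p)); first exact: differentiable_translateN.
    rewrite /psi'; apply: differentiable_point => [i||].
    * apply: differentiablefM; last exact: differentiable_xco.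
      by apply: differentiablef_comp => //; exact: differentiable_zco.
    * apply: differentiablefD; apply: differentiablefM; try exact: differentiable_yco;
      try exact: differentiable_zco; try exact: differentiablefC.
      by apply: differentiablefD; [exact: differentiablefC | exact: differentiable_zco].
    * apply: differentiablefM; first exact: differentiable_zco.
      by apply: differentiablef_comp => //; exact: differentiable_zco.
  rewrite /psi /phi; transitivity (p + (x - p)); last by rewrite addrC subrK.
  congr (p + _); apply/esym/point_eq => [i||].
  + by rewrite xco_point zco_point e1 mulrC mulKf.
  + by rewrite yco_point zco_point e1 addrK mulrC mulKf.
  + by rewrite zco_point e1.
- apply: filterS nP => x Px; have [dTx aT E1 e1 [r1 ds s1 e2]] := Px; split.
  + by apply: differentiablefV => //; exact: daTz.
  + by rewrite invr_eq0.
  apply: (mulfI aT); rewrite mulVKf// /phi.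
  set y := point _ _ _; have zy : zco y = T (zco x) by rewrite zco_point.
  rewrite -{1}zy fE !sum_squares_xco zy yco_point [(a + _) * (_ / _)]mulrC divfK// subrK.
  congr (_ + _ + _).
    rewrite mulr_sumr; apply: eq_bigr => i _.
    by rewrite xco_point -e2 -exprMn mulrC divfK.
  by rewrite -E1 -exprMn /T divfK.
Qed.

End NormalForms.
End Germs.

(** * The critical points of a deformation *)

Section Differential.
Variables (C : numFieldType) (X : normedModType C).
Implicit Types (f g df dg : X -> C) (x : X).

Lemma is_difffC (c : C) x : is_diff x (fun _ : X => c) (fun=> 0).
Proof. exact: is_diff_cst. Qed.

Lemma is_difffD f g df dg x : is_diff x f df -> is_diff x g dg ->
  is_diff x (fun y => f y + g y) (fun h => df h + dg h).
Proof. exact: is_diffD. Qed.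

Lemma is_difffM f g df dg x : is_diff x f df -> is_diff x g dg ->
  is_diff x (fun y => f y * g y) (fun h => df h * g x + f x * dg h).
Proof.
move=> ? ?; have := @is_diffM C X f g df dg x; move=> /(_ _ _)/is_diff_eq; apply => //.
by apply/funext => h; rewrite !fctE addrC mulrC.
Qed.

Lemma is_difffX f df x m : is_diff x f df ->
  is_diff x (fun y => f y ^+ m) (fun h => m%:R * f x ^+ m.-1 * df h).
Proof.
case: m => [|m] d1.
  under eq_fun do rewrite expr0.
  by apply: is_diff_eq (is_difffC 1 x) _; apply/funext => h; rewrite !mul0r.
have := @is_diffX C X f df m x d1.
by rewrite exprfctE.
Qed.

Lemma is_difff_sum (I : Type) (s : seq I) (P : pred I) (F dF : I -> X -> C) x :
  (forall i, is_diff x (F i) (dF i)) ->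
  is_diff x (fun y => \sum_(i <- s | P i) F i y) (fun h => \sum_(i <- s | P i) dF i h).
Proof.
move=> dFi; elim: s => [|i s IH].
  under eq_fun do rewrite big_nil; under [X in is_diff_def _ _ X]eq_fun do rewrite big_nil.
  exact: is_difffC.
under eq_fun do rewrite big_cons; under [X in is_diff_def _ _ X]eq_fun do rewrite big_cons.
by case: (P i) => //; exact: is_difffD.
Qed.

End Differential.

Lemma is_diff_rV_coord (C : numFieldType) m (j : 'I_m) (x : 'rV[C]_m) :
  is_diff x (fun y : 'rV[C]_m => y 0 j) (fun y : 'rV[C]_m => y 0 j).
Proof.
have lin : linear (fun y : 'rV[C]_m => y 0 j) by move=> a u w; rewrite !mxE.
pose M := GRing.isLinear.Build _ _ _ _ _ lin.
pose f : {linear _ -> _} := HB.pack (fun y : 'rV[C]_m => y 0 j) M.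
apply: DiffDef; first exact: differentiable_rV_coord.
apply: (@diff_lin _ _ _ f); exact: coord_continuous.
Qed.

Section DnDifferential.
Variables (C : numClosedFieldType) (n : nat).

(** The point and the parameters all vary: for constant parameters this is the
    differential of f_Lambda, and for a moving critical point it is the
    differential of the critical value. *)
Lemma is_diff_Dn_function (X : normedModType C) (I : finType) (S dS : I -> X -> C)
    (Y dY Z dZ l dl : X -> C) (c dc : 'I_n.-1 -> X -> C) x :
  (forall i, is_diff x (S i) (dS i)) -> is_diff x Y dY -> is_diff x Z dZ ->
  is_diff x l dl -> (forall i, is_diff x (c i) (dc i)) ->
  is_diff x (fun u => \sum_i S i u ^+ 2 + Y u ^+ 2 * Z u + Z u ^+ n.-1 + l u * Y u
      + \sum_(i < n.-1) c i u * Z u ^+ i)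
    (fun h => \sum_i 2 * S i x * dS i h + (2 * Y x * Z x + l x) * dY h
      + (n.-1%:R * Z x ^+ n.-2 + Y x ^+ 2
          + \sum_(i < n.-1 | (1 <= i)%N) i%:R * c i x * Z x ^+ i.-1) * dZ h
      + (Y x * dl h + \sum_(i < n.-1) Z x ^+ i * dc i h)).
Proof.
move=> dSi dYx dZx dlx dci.
have D1 := is_difff_sum (index_enum I) xpredT (fun i => is_difffX 2 (dSi i)).
have D2 := is_difffM (is_difffX 2 dYx) dZx; have D3 := is_difffX n.-1 dZx;
  have D4 := is_difffM dlx dYx.
have D5 := is_difff_sum (index_enum 'I_n.-1) xpredT (fun i => is_difffM (dci i) (is_difffX i dZx)).
apply: is_diff_eq (is_difffD (is_difffD (is_difffD (is_difffD D1 D2) D3) D4) D5) _.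
apply/funext => h /=.
under [X in X + _ + _ + _ + _ = _]eq_bigr do rewrite expr1.
rewrite [X in _ + X = _]big_split /= [X in (_ + _ + X) * _](_ : _ =
    \sum_(i < n.-1) i%:R * c i x * Z x ^+ i.-1); last first.
  rewrite [RHS](bigID (fun i : 'I_n.-1 => (1 <= i)%N)) /= [X in _ = _ + X]big1 ?addr0//.
  by move=> i; rewrite -ltnNge ltnS leqn0 => /eqP ->; rewrite !mul0r.
rewrite (eq_bigr (fun i : 'I_n.-1 => Z x ^+ i * dc i h)); last by move=> i _; rewrite mulrC.
rewrite [X in _ + (_ + X) = _](_ : _ = (\sum_(i < n.-1) i%:R * c i x * Z x ^+ i.-1) * dZ h);
  last first.
  by rewrite mulr_suml; apply: eq_bigr => i _; ring.
by rewrite expr1; ring.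
Qed.

Implicit Type L : T1 C n.

(** The part of f_Lambda that only involves [z]; for j >= 2, v_j is its j-th Taylor
    coefficient at z_Lambda. *)
Definition zpoly L : {poly C} := 'X^(n.-1) + \sum_(i < n.-1) lami L i *: 'X^i.

Lemma zpolyE L z : (zpoly L).[z] = z ^+ n.-1 + \sum_(i < n.-1) lami L i * z ^+ i.
Proof.
rewrite hornerD hornerXn horner_sum; congr (_ + _).
by apply: eq_bigr => i _; rewrite hornerZ hornerXn.
Qed.

Lemma nderivn_zpolyE L j z : (zpoly L)^`N(j).[z] = 'C(n.-1, j)%:R * z ^+ (n.-1 - j)
  + \sum_(i < n.-1) 'C(i, j)%:R * lami L i * z ^+ (i - j).
Proof.
rewrite raddfD /= nderivnXn hornerD hornerMn hornerXn mulr_natl; congr (_ + _).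
rewrite raddf_sum horner_sum; apply: eq_bigr => i _.
by rewrite /= nderivnZ nderivnXn hornerZ hornerMn hornerXn mulrnAr mulr_natl mulrnAl.
Qed.

Lemma f_zpolyE k L (x : 'rV[C]_(k + 2)) : f_ L x =
  sum_squares x + yco x ^+ 2 * zco x + lam L * yco x + (zpoly L).[zco x].
Proof. by rewrite /f_ /= zpolyE; ring. Qed.

Lemma deriv_zpolyE L z : (zpoly L)^`().[z] =
  n.-1%:R * z ^+ n.-2 + \sum_(i < n.-1 | (1 <= i)%N) i%:R * lami L i * z ^+ i.-1.
Proof.
rewrite -poly.nderivn1 nderivn_zpolyE bin1 subn1; congr (_ + _).
rewrite (bigID (fun i : 'I_n.-1 => (1 <= i)%N)) /= [X in _ + X]big1 ?addr0.
  by apply: eq_bigr => i _; rewrite bin1 subn1.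
by move=> i; rewrite -ltnNge ltnS leqn0 => /eqP ->; rewrite !mul0r.
Qed.

Lemma critical_coverE (x : pairs C n) : critical_cover x <->
  2 * yco x * zco x + lam (par x) = 0 /\ (zpoly (par x))^`().[zco x] + yco x ^+ 2 = 0.
Proof. by rewrite /critical_cover /= deriv_zpolyE addrAC. Qed.

Lemma v_nderivn (x : pairs C n) j : (2 <= j)%N -> v j x = (zpoly (par x))^`N(j).[zco x].
Proof.
case: j => [|[|j]] // _; rewrite nderivn_zpolyE /v /=; congr (_ + _).
rewrite [RHS](bigID (fun i : 'I_n.-1 => (j.+2 <= i)%N)) /= [X in _ = _ + X]big1 ?addr0//.
by move=> i; rewrite -ltnNge => ij; rewrite bin_small// !mul0r.
Qed.

Lemma yco_row_mx k (l : 'rV[C]_k) (q : 'rV[C]_2) : yco (row_mx l q) = q 0 ord0.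
Proof. by rewrite /yco row_mxKr. Qed.

Lemma zco_row_mx k (l : 'rV[C]_k) (q : 'rV[C]_2) : zco (row_mx l q) = q 0 ord_max.
Proof. by rewrite /zco row_mxKr. Qed.

Lemma par_row_mx (L : T1 C n) (q : 'rV[C]_2) : par (row_mx L q) = L.
Proof. exact: row_mxKl. Qed.

Lemma sum_squares_row_mx k (q : 'rV[C]_2) : sum_squares (row_mx (0 : 'rV[C]_k) q) = 0.
Proof. by rewrite /sum_squares row_mxKl big1// => i _; rewrite mxE expr0n. Qed.

Lemma is_diff_f_ k L (x : 'rV[C]_(k + 2)) : is_diff x (f_ L)
  (fun h => \sum_i 2 * xco x i * xco h i + (2 * yco x * zco x + lam L) * yco h
     + ((zpoly L)^`().[zco x] + yco x ^+ 2) * zco h).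
Proof.
have dx i : is_diff x (fun y => xco y i) (fun y => xco y i).
  by rewrite /xco; under eq_fun do rewrite mxE; exact: is_diff_rV_coord.
have dy : is_diff x (fun y => yco y) (fun y => yco y).
  by rewrite /yco; under eq_fun do rewrite mxE; exact: is_diff_rV_coord.
have dz : is_diff x (fun y => zco y) (fun y => zco y).
  by rewrite /zco; under eq_fun do rewrite mxE; exact: is_diff_rV_coord.
apply: is_diff_eq (is_diff_Dn_function dx dy dz (is_difffC (lam L) x) (fun i => is_difffC
  (lami L i) x)) _.
apply/funext => h; rewrite deriv_zpolyE mulr0 add0r [X in _ + X = _]big1 => [|i _].
  by rewrite addr0 [X in _ + X * _]addrAC.
by rewrite mulr0.
Qed.

(** The partial derivatives along the x_i are 2 x_i, so that critical points lie in
    the plane of (y, z); the other two are the critical system. *)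
Lemma critical_pointsE k L :
  critical_points (f_ (k := k) L) = [set row_mx 0 q | q in critical_system L].
Proof.
apply/seteqP; split => [x [_ dx]|_ [q Lq <-]].
- have dE h := congr1 (fun f => f h) (diff_val (is_diff_def := is_diff_f_ L x)).
  have {}dE h := etrans (esym (dE h)) (dx h).
  have x0 i : xco x i = 0.
    have := dE (point (fun j => (j == i)%:R) 0 0).
    rewrite /cst yco_point zco_point !mulr0 !addr0 (bigD1 i)//= big1.
      by rewrite xco_point eqxx mulr1 addr0 => /eqP; rewrite mulf_eq0 pnatr_eq0 => /eqP.
    by move=> j ji; rewrite xco_point (negPf ji) mulr0.
  (* The differential is evaluated on the two last basis vectors. *)
  have e1 := dE (point (fun=> 0) 1 0); have e2 := dE (point (fun=> 0) 0 1).
  move: e1 e2; rewrite !yco_point !zco_point !mulr0 !mulr1 !addr0.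
  have s0 s t : \sum_i 2 * xco x i * xco (point (fun=> 0) s t) i = 0.
    by rewrite big1// => j _; rewrite xco_point mulr0.
  rewrite !s0 !add0r /cst => e1 e2.
  exists (rsubmx x).
    apply/critical_coverE; rewrite par_row_mx !yco_row_mx !zco_row_mx; split => //.
  rewrite -[RHS]hsubmxK; congr row_mx; apply/rowP => i.
  by rewrite [LHS]mxE; apply/esym; exact: (x0 i).
- have [e1 e2] := (critical_coverE _).1 Lq.
  rewrite par_row_mx !yco_row_mx !zco_row_mx in e1 e2.
  split; first exact: (ex_diff (is_diff_def := is_diff_f_ L _)).
  rewrite (diff_val (is_diff_def := is_diff_f_ L _)) => h.
  rewrite !yco_row_mx !zco_row_mx e1 e2 !mul0r !addr0 big1// => i _.
  by rewrite /xco row_mxKl mxE mulr0 mul0r.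
Qed.

(** The coefficients of the remainder after the square is completed. Up to the
    factor 4 for j = 2, they are the equations of the W_j: for j = n - 1 this uses
    the convention v_(n-1) = 1 that the formula for v_j implies. *)
Definition wcoef j (x : pairs C n) : C :=
  if j == 2%N then v 1 x * v 2 x - v 0 x ^+ 2 / 4 else v 1 x * v j x + v j.-1 x.

Lemma v_top (x : pairs C n) : (3 <= n)%N -> v n.-1 x = 1.
Proof.
move=> n3; rewrite v_nderivn; last by case: n n3 => [|[|[]]].
rewrite nderivn_zpolyE binn subnn mulr1 big1 ?addr0// => i _.
by rewrite bin_small// !mul0r.
Qed.

Lemma v_large (x : pairs C n) j : (2 <= j)%N -> (n <= j)%N -> v j x = 0.
Proof.
move=> j2 nj; rewrite v_nderivn// nderivn_zpolyE bin_small ?mul0r ?add0r.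
  rewrite big1// => i _; rewrite bin_small ?mul0r//.
  by apply: leq_trans (ltn_ord i) _; apply: leq_trans (leq_pred _) nj.
by case: n nj j2 => [|m]; [case: j | ].
Qed.

Lemma size_zpoly L : size (zpoly L) = n.-1.+1.
Proof.
rewrite size_polyDl size_polyXn// ltnS; apply: leq_trans (size_sum _ _ _) _.
apply/bigmax_leqP => i _; apply: leq_trans (size_scale_leq _ _) _.
by rewrite size_polyXn.
Qed.

(** The critical equations give lambda = - 2 y z and P'(z) = - y^2, which removes the
    linear terms from the Taylor expansion. *)
Lemma f_expansion k (x : pairs C n) (w : 'rV[C]_(k + 2)) : (2 < n)%N -> critical_cover x ->
  f_ (par x) (row_mx 0 (rsubmx x) + w) = f_ (par x) (row_mx (0 : 'rV[C]_k) (rsubmx x))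
   + sum_squares w + v 1 x * yco w ^+ 2 + v 0 x * yco w * zco w + yco w ^+ 2 * zco w
   + \sum_(2 <= j < n) v j x * zco w ^+ j.
Proof.
move=> n2 /critical_coverE [e1 e2].
have yD : yco (row_mx 0 (rsubmx x) + w) = yco x + yco w.
  by rewrite /yco linearD /= row_mxKr mxE.
have zD : zco (row_mx 0 (rsubmx x) + w) = zco x + zco w.
  by rewrite /zco linearD /= row_mxKr mxE.
have sD : sum_squares (row_mx 0 (rsubmx x) + w) = sum_squares w.
  by rewrite /sum_squares linearD /= row_mxKl add0r.
rewrite !f_zpolyE yD zD sD sum_squares_row_mx.
have -> : yco (row_mx (0 : 'rV[C]_k) (rsubmx x)) = yco x by rewrite /yco row_mxKr.
have -> : zco (row_mx (0 : 'rV[C]_k) (rsubmx x)) = zco x by rewrite /zco row_mxKr.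
have T : (zpoly (par x)).[zco x + zco w] = (zpoly (par x)).[zco x]
    + (zpoly (par x))^`().[zco x] * zco w + \sum_(2 <= j < n) v j x * zco w ^+ j.
  rewrite (@nderiv_taylor_wide _ n); last 2 first.
  - exact: mulrC.
  - by rewrite size_zpoly ltn_predL; case: (n) n2.
  rewrite -(big_mkord xpredT (fun i => (zpoly (par x))^`N(i).[zco x] * zco w ^+ i)).
  rewrite big_ltn 1?(ltn_trans _ n2)// big_ltn 1?(ltn_trans _ n2)//.
  rewrite nderivn0 poly.nderivn1 expr0 expr1 mulr1 addrA; congr (_ + _).
  by apply: eq_big_nat => j /andP[j2 _]; rewrite v_nderivn.
rewrite T /v /=.
have -> : lam (par x) = - (2 * yco x * zco x) by apply/eqP; rewrite -addr_eq0 addrC e1.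
have -> : (zpoly (par x))^`().[zco x] = - yco x ^+ 2 by apply/eqP; rewrite -addr_eq0 e2.
by ring.
Qed.

End DnDifferential.

(** * The singularity type at a critical point of value zero *)

Section Strata.
Variables (C : numClosedFieldType) (n : nat).
Hypothesis n4 : (4 <= n)%N.
Implicit Type x : pairs C n.

Let n3 : (3 <= n)%N := ltnW n4.

Definition cvalue x : C :=
  yco x ^+ 2 * zco x + lam (par x) * yco x + (zpoly (par x)).[zco x].

Lemma cvalueE k x : f_ (par x) (row_mx (0 : 'rV[C]_k) (rsubmx x)) = cvalue x.
Proof. by rewrite f_zpolyE sum_squares_row_mx add0r yco_row_mx zco_row_mx. Qed.

Lemma calLE x : calL x <-> critical_cover x /\ cvalue x = 0.
Proof.
rewrite /calL /cvalue zpolyE; split => -[cx /= e]; split => //=; rewrite -[RHS]e; ring.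
Qed.

Lemma W_wcoef j x : (2 <= j <= n.-1)%N -> W j x <-> calL x /\ wcoef j x = 0.
Proof.
move=> /andP[j2 jn]; have [->|jn2] := eqVneq j 2%N.
  rewrite /W /wcoef eqxx; split => -[cx /= e]; split => //=.
    have -> : v 1 x * v 2 x - v 0 x ^+ 2 / 4 = (4 * v 1 x * v 2 x - v 0 x ^+ 2) / 4 by field.
    by rewrite e mul0r.
  have -> : 4 * v 1 x * v 2 x - v 0 x ^+ 2 = 4 * (v 1 x * v 2 x - v 0 x ^+ 2 / 4) by field.
  by rewrite e mulr0.
rewrite /W /wcoef (negPf jn2); have [->|_] := eqVneq j n.-1; last by [].
by rewrite v_top// mulr1.
Qed.

(** Multiplication by v_1 + t turns the coefficients v_j into v_1 v_j + v_(j-1); the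
    term in t^2 that is left over is the one that completing the square produces.
    The sum on the right goes one step further, its last coefficient being
    w_n = v_(n-1) = 1. *)
Lemma sum_wcoef x (t : C) : (v 1 x + t) * (\sum_(2 <= j < n) v j x * t ^+ j) =
  (v 0 x / 2) ^+ 2 * t ^+ 2 + \sum_(2 <= j < n.+1) wcoef j x * t ^+ j.
Proof.
rewrite mulrDl !mulr_sumr.
have -> : \sum_(2 <= j < n) v 1 x * (v j x * t ^+ j) =
    \sum_(2 <= j < n.+1) v 1 x * v j x * t ^+ j.
  rewrite big_nat_recr ?(ltnW n3)//= [v n x]v_large ?leqnn ?(ltnW n3)// mulr0 mul0r addr0.
  by apply: eq_bigr => j _; rewrite mulrA.
have -> : \sum_(2 <= j < n) t * (v j x * t ^+ j) =
    \sum_(3 <= j < n.+1) v j.-1 x * t ^+ j.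
  rewrite [RHS]big_add1 /=; apply: eq_bigr => j _.
  by rewrite exprS mulrCA.
have n2 : (2 < n.+1)%N by rewrite ltnS ltnW.
rewrite !(big_ltn n2) -addrA -big_split /=.
have -> : \sum_(3 <= i < n.+1) wcoef i x * t ^+ i =
   \sum_(3 <= i < n.+1) (v 1 x * v i x * t ^+ i + v i.-1 x * t ^+ i).
  by apply: eq_big_nat => j /andP[j3 _]; rewrite /wcoef gtn_eqF// mulrDl.
by rewrite addrA; congr (_ + _); rewrite /wcoef /=; field.
Qed.

(** Multiply by v_1 + t and complete the square:
    (v_1 + t) (v_1 s^2 + v_0 s t + s^2 t)
      = ((v_1 + t) s + v_0 t / 2)^2 - (v_0 / 2)^2 t^2.
    By [sum_wcoef] the rest is t^(m+1) times a unit. *)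
Lemma type_A_generic k m x : (1 <= m <= n.-1)%N -> calL x -> v 1 x != 0 ->
  (forall j, (2 <= j <= m)%N -> wcoef j x = 0) -> wcoef m.+1 x != 0 ->
  singularity_of_type (A m) (f_ (k := k) (par x)) (row_mx 0 (rsubmx x)).
Proof.
move=> /andP[m1 mn] /calLE [cx e] v1 wz wm.
pose E := \poly_(i < n - m) wcoef (i + m.+1) x.
have mn' : (m < n)%N by rewrite (leq_ltn_trans mn)// prednK// (ltnW (ltnW n3)).
apply: (@type_A_of_expansion _ k m _ _ E (v 1 x) (v 0 x / 2)) => //.
  by rewrite horner_coef0 coef_poly subn_gt0 mn'.
move=> w; rewrite f_expansion// cvalueE e add0r.
set t := zco w; set s := yco w; set q := sum_squares w.
have -> : t ^+ m.+1 * E.[t] = \sum_(2 <= j < n.+1) wcoef j x * t ^+ j.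
  rewrite (@big_cat_nat _ _ _ m.+1)//=; last by rewrite ltnS ltnW.
  rewrite [X in X + _]big1_seq ?add0r; last first.
    by move=> j /=; rewrite mem_index_iota ltnS => /wz ->; rewrite mul0r.
  rewrite horner_poly mulr_sumr -[in RHS](add0n m.+1) big_addn subSS big_mkord.
  by apply: eq_bigr => i _; by rewrite exprD; ring.
have := sum_wcoef x t; set S := \sum_(2 <= j < n) _; set S' := \sum_(2 <= j < n.+1) _.
move=> SS'; have -> : S' = (v 1 x + t) * S - (v 0 x / 2) ^+ 2 * t ^+ 2.
  by rewrite SS' addrC addKr.
by field.
Qed.

Lemma V0_coords m x : V0 m x -> calL x /\ forall j, (j <= m)%N -> v j x = 0.
Proof. by move=> Vx; split; [case: (Vx 0%N) | move=> j jm; case: (Vx j)]. Qed.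

Lemma V0I m x : calL x -> (forall j, (j <= m)%N -> v j x = 0) -> V0 m x.
Proof. by move=> cx vx j jm; split => //; exact: vx. Qed.

(** Without v_0 and v_1 the quadratic part in [s] is gone and s^2 t remains. The
    range includes D_3, which is needed for the component V_0^1 of the A_3
    stratum. *)
Lemma type_D_generic k m x : (3 <= m <= n)%N -> V0 m.-2 x -> v m.-1 x != 0 ->
  singularity_of_type (D m) (f_ (k := k) (par x)) (row_mx 0 (rsubmx x)).
Proof.
move=> /andP[m3 mn] /V0_coords[/calLE [cx e] vz] vm.
have m2 : (2 <= m.-1)%N by rewrite -ltnS prednK// (ltn_trans _ m3).
pose E := \poly_(i < n - m.-1) v (i + m.-1) x.
have mn' : (m.-1 < n)%N by rewrite prednK// (ltn_trans _ m3).
apply: (@type_D_of_expansion _ k m _ _ E) => //; first exact: ltn_trans m3.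
  by rewrite horner_coef0 coef_poly subn_gt0 mn'.
move=> w; rewrite f_expansion// cvalueE e add0r.
rewrite (vz 0%N)// (vz 1%N); last by rewrite -ltnS prednK// -ltnS prednK// (ltn_trans _ m3).
rewrite !mul0r !addr0; congr (_ + _).
rewrite (@big_cat_nat _ _ _ m.-1)//=; last exact: ltnW.
rewrite [X in X + _]big1_seq ?add0r; last first.
  move=> j /=; rewrite mem_index_iota => /andP[_ jm]; rewrite vz ?mul0r//.
  by rewrite -ltnS prednK// (leq_trans _ m2).
rewrite horner_poly mulr_sumr -[in LHS](add0n m.-1) big_addn big_mkord.
by apply: eq_bigr => i _; by rewrite exprD; ring.
Qed.

Lemma type_A_of_V01 k x : V0 1 x -> v 2 x != 0 ->
  singularity_of_type (A 3) (f_ (k := k) (par x)) (row_mx 0 (rsubmx x)).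
Proof.
move=> Vx v2; have D3 := @type_D_generic k 3 x; rewrite n3 in D3.
exact: equivalent_germs_trans (D3 isT Vx v2) (normal_form_D3 C k).
Qed.

End Strata.

(** * Coordinates on the critical cover *)

Lemma horner_ext (C : numFieldType) (p q : {poly C}) :
  (forall t, p.[t] = q.[t]) -> p = q.
Proof.
move=> pq; apply/eqP; rewrite -subr_eq0; apply/negPn/negP => pq0.
have [t _] := poly_nonroot_near0 pq0 ltr01.
by rewrite !hornerE pq subrr eqxx.
Qed.

(** Taylor expansion as a composition: the chart below is the inverse shift. *)
Lemma coef_comp_shift (C : numFieldType) (p : {poly C}) (z : C) j :
  (p \Po ('X + z%:P))`_j = p^`N(j).[z].
Proof.
have -> : p \Po ('X + z%:P) = \poly_(i < size p) p^`N(i).[z].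
  apply: horner_ext => t; rewrite horner_comp !hornerE addrC nderiv_taylor; last exact: mulrC.
  by rewrite horner_poly.
rewrite coef_poly; case: ltnP => // pj.
by rewrite nderivn_poly0// horner0.
Qed.

Lemma size_nderivn_leq (C : numFieldType) (p : {poly C}) j :
  (size p^`N(j) <= size p - j)%N.
Proof.
apply/leq_sizeP => i ij; rewrite coef_nderivn nth_default ?mul0rn//.
by rewrite -leq_subLR.
Qed.

Section Parametrization.
Variables (C : numClosedFieldType) (n : nat).
Hypothesis n4 : (4 <= n)%N.
Implicit Types (x : pairs C n) (u : C) (c : nat -> C).

Let n3 : (3 <= n)%N := ltnW n4.
Let n1_gt1 : (1 < n.-1)%N. Proof. by rewrite -ltnS prednK// (ltn_trans _ n3). Qed.
Let nK : n.-1.+1 = n. Proof. by rewrite prednK// (ltn_trans _ n3). Qed.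

(** The expansion of P at z_Lambda for a critical point of value u with v_j = c_j.
    The critical equations force P'(z_Lambda) = - y_Lambda^2, and then
    u = P(z_Lambda) - y_Lambda^2 z_Lambda gives the constant term; the leading
    coefficient is 1 because P is monic. *)
Definition taylor u c : {poly C} := \poly_(j < n)
  (if j == 0%N then (c 0 / 2) ^+ 2 * c 1 + u else if j == 1%N then - (c 0 / 2) ^+ 2
   else if j == n.-1 then 1 else c j).

(** The point of the critical cover whose value is u, with v_j = c_j for j <= n - 2. The
    parameters lambda_i are recovered by shifting the Taylor expansion back. *)
Definition chart u c : pairs C n :=
  row_mx (row_mx (\row_(_ < 1) - (c 0 * c 1))
    (\row_(i < n.-1) (taylor u c \Po ('X - (c 1)%:P))`_i))
    (\row_(j < 2) (if j == ord0 then c 0 / 2 else c 1)).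

Lemma coef_zpoly (L : T1 C n) i : (zpoly L)`_i =
  if (i < n.-1)%N then oapp (lami L) 0 (insub i) else (i == n.-1)%:R.
Proof.
rewrite coefD coefXn coef_sum; case: ltnP => ni.
  rewrite insubT /= (bigD1 (Ordinal ni))//= coefZ coefXn eqxx mulr1.
  rewrite ltn_eqF// add0r big1 ?addr0// => j ji.
  by rewrite coefZ coefXn -val_eqE in ji *; rewrite eq_sym (negPf ji) mulr0.
rewrite big1 ?addr0// => j _.
by rewrite coefZ coefXn gtn_eqF ?mulr0// (leq_trans (ltn_ord j)).
Qed.

Lemma lami_coef (L : T1 C n) (i : 'I_n.-1) : lami L i = (zpoly L)`_i.
Proof. by rewrite coef_zpoly ltn_ord valK. Qed.

Let coef_shift u c i : (taylor u c \Po ('X - (c 1)%:P))`_i = (taylor u c)^`N(i).[- c 1].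
Proof. by rewrite -polyCN coef_comp_shift. Qed.

Let size_taylor u c : (size (taylor u c) <= n)%N.
Proof. exact: size_poly. Qed.

Lemma yco_chart u c : yco (chart u c) = c 0 / 2.
Proof. by rewrite yco_row_mx mxE. Qed.

Lemma zco_chart u c : zco (chart u c) = c 1.
Proof. by rewrite zco_row_mx mxE. Qed.

Lemma lam_chart u c : lam (par (chart u c)) = - (c 0 * c 1).
Proof. by rewrite /par row_mxKl /lam row_mxKl mxE. Qed.

Lemma zpoly_chart u c : zpoly (par (chart u c)) = taylor u c \Po ('X - (c 1)%:P).
Proof.
apply/polyP => i; rewrite coef_zpoly; case: ltnP => ni.
  by rewrite insubT /= /par row_mxKl /lami row_mxKr mxE.
rewrite coef_shift; have [->|ni'] := eqVneq i n.-1.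
  rewrite (@horner_coef_wide _ 1); last first.
    apply: leq_trans (size_nderivn_leq _ _) _.
    by rewrite leq_subLR addn1 nK.
  rewrite big_ord1 expr0 mulr1 coef_nderivn addn0 binn mulr1n coef_poly ltn_predL.
  by rewrite eqxx !gtn_eqF// ?(ltn_trans _ n3)// ltnW.
rewrite nderivn_poly0 ?horner0//; apply: leq_trans (size_taylor _ _) _.
by rewrite -nK ltn_neqAle eq_sym ni'.
Qed.

Lemma nderivn_chart u c j :
  (zpoly (par (chart u c)))^`N(j).[c 1] = (taylor u c)`_j.
Proof.
rewrite -coef_comp_shift zpoly_chart -comp_polyA; congr (_ `_ j).
by rewrite comp_polyB comp_polyX comp_polyC addrK comp_polyXr.
Qed.

Lemma v_chart u c j : (c n.-1 = 1) -> (j < n)%N -> v j (chart u c) = c j.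
Proof.
move=> c1; case: j => [|[|j]] jn.
- by rewrite /v /= yco_chart; field.
- by rewrite /v /= zco_chart.
- rewrite v_nderivn// zco_chart nderivn_chart coef_poly jn /=.
  by case: eqP => // ->.
Qed.

Lemma chart_critical u c : critical_cover (chart u c).
Proof.
apply/critical_coverE; rewrite yco_chart zco_chart lam_chart; split; first by field.
rewrite -poly.nderivn1 nderivn_chart coef_poly (ltn_trans _ n3)//=.
by rewrite addNr.
Qed.

Lemma cvalue_chart u c : cvalue (chart u c) = u.
Proof.
rewrite /cvalue yco_chart zco_chart lam_chart -[(zpoly _).[_]]/((zpoly (par (chart u c))).[c 1]).
rewrite -[zpoly _]nderivn0 nderivn_chart coef_poly (ltn_trans _ n3)//=.
by field.
Qed.

(** All of the critical cover is described by u, v_0, ..., v_(n-2): the value and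
    the v_j determine the Taylor expansion of P at z_Lambda, hence P. *)
Lemma critical_cover_chart x : critical_cover x -> x = chart (cvalue x) (fun j => v j x).
Proof.
move=> /critical_coverE [e1 e2].
have T : taylor (cvalue x) (fun j => v j x) = zpoly (par x) \Po ('X + (zco x)%:P).
  apply/polyP => j; rewrite coef_comp_shift coef_poly; case: ltnP => jn; last first.
    rewrite nderivn_poly0 ?horner0//; apply: leq_trans jn.
    by rewrite size_zpoly nK.
  case: j jn => [|[|j]] jn /=.
  - rewrite nderivn0 /cvalue /v /=.
    have -> : lam (par x) = - (2 * yco x * zco x) by apply/eqP; rewrite -addr_eq0 addrC e1.
    by field.
  - have -> : (zpoly (par x))^`N(1).[zco x] = - yco x ^+ 2.
      by apply/eqP; rewrite poly.nderivn1 -addr_eq0 e2.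
    by rewrite /v /=; field.
  - rewrite -v_nderivn//; case: eqP => // ->.
    by rewrite v_top.
rewrite /chart T -[LHS]hsubmxK; congr row_mx; last first.
  apply/rowP => i; rewrite [RHS]mxE; have [->|i0] := eqVneq i ord0.
    by rewrite /v /= /yco; field.
  rewrite /v /= /zco; congr (rsubmx x 0 _).
  by apply/val_inj; case: i i0 => -[|[|]].
rewrite -[LHS]hsubmxK; congr row_mx; apply/rowP => i; rewrite [RHS]mxE.
  rewrite ord1 -[LHS]/(lam (par x)) /v /=.
  by apply/eqP; rewrite -addr_eq0 addrC mulrAC -e1 ; apply/eqP; ring.
rewrite -[LHS]/(lami (par x) i) lami_coef -comp_polyA; congr (_ `_ i).
suff -> : ('X + (zco x)%:P) \Po ('X - (v 1 x)%:P) = 'X by rewrite comp_polyXr.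
by rewrite comp_polyD comp_polyX comp_polyC subrK.
Qed.

Lemma polyfun1_chart (u : C -> C) (c : nat -> C -> C) :
  polyfun1 u -> (forall j, polyfun1 (c j)) ->
  forall j, polyfun1 (fun t => chart (u t) (c ^~ t) 0 j).
Proof.
move=> pu pc j.
have pT i : polyfun1 (fun t => (taylor (u t) (c ^~ t))`_i).
  under eq_fun do rewrite coef_poly.
  apply: polyfun1_if; last exact: polyfun1C.
  apply: polyfun1_if.
    apply: polyfun1D => //; apply: polyfun1M => //; apply: polyfun1X.
    by apply: polyfun1M => //; exact: polyfun1C.
  apply: polyfun1_if.
    by apply: polyfun1N; apply: polyfun1X; apply: polyfun1M => //; exact: polyfun1C.
  by apply: polyfun1_if; [exact: polyfun1C|].
rewrite /chart; case: (split_ordP j) => i ->.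
  under eq_fun do rewrite row_mxEl.
  case: (split_ordP i) => l ->.
    under eq_fun do rewrite row_mxEl mxE.
    by apply: polyfun1N; exact: polyfun1M.
  under eq_fun do rewrite row_mxEr mxE coef_shift.
  have sN t : (size (taylor (u t) (c ^~ t))^`N(l) <= n)%N.
    apply: leq_trans (size_nderivn_leq _ _) _; rewrite leq_subLR.
    by apply: leq_trans (size_taylor _ _) _; exact: leq_addl.
  under eq_fun do rewrite (horner_coef_wide _ (sN _)).
  apply: polyfun1_sum => m; apply: polyfun1M; last first.
    by apply: polyfun1X; exact: polyfun1N.
  under eq_fun do rewrite coef_nderivn -mulr_natr.
  by apply: polyfun1M; [exact: pT | exact: polyfun1C].
under eq_fun do rewrite row_mxEr mxE.
apply: polyfun1_if => //.
by apply: polyfun1M => //; exact: polyfun1C.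
Qed.

End Parametrization.

(** * Hypersurfaces and the density of generic points *)

Lemma zeros_polyfun (C : numClosedFieldType) m (h : 'rV[C]_m -> C) : polyfun h ->
  exists P, zeros P = [set x | h x = 0].
Proof.
move=> [P hP]; exists P; apply/seteqP; split => y; rewrite /zeros /=; by rewrite hP.
Qed.

Lemma hypersurface_intro (C : numClosedFieldType) m (X H : set 'rV[C]_m) h : polyfun h ->
  H = X `&` [set x | h x = 0] -> H !=set0 -> X `<=` closure (X `\` [set x | h x = 0]) ->
  hypersurface X H.
Proof.
move=> ph HE H0 Xc; have [P PE] := zeros_polyfun ph; split => //.
  by exists P; rewrite HE PE.
apply: subset_trans Xc _; apply: closureS => y [Xy hy]; split => //.
by rewrite HE => -[].
Qed.

Section Density.
Variables (C : numClosedFieldType) (n : nat).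
Hypothesis n4 : (4 <= n)%N.
Implicit Types (x : pairs C n) (h : pairs C n -> C).

Let n3 : (3 <= n)%N := ltnW n4.
Let nK : n.-1.+1 = n. Proof. by rewrite prednK// (ltn_trans _ n3). Qed.
Let n1n : (n.-1 < n)%N. Proof. by rewrite nK. Qed.

Lemma polyfun_yco k : polyfun (@yco C k).
Proof. by rewrite /yco; under eq_fun do rewrite mxE; exact: polyfun_coord. Qed.

Lemma polyfun_zco k : polyfun (@zco C k).
Proof. by rewrite /zco; under eq_fun do rewrite mxE; exact: polyfun_coord. Qed.

Lemma polyfun_lam : polyfun (fun x => lam (par x)).
Proof.
by rewrite /lam /par; under eq_fun do rewrite mxE mxE; exact: polyfun_coord.
Qed.

Lemma polyfun_lami i : polyfun (fun x => lami (par x) i).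
Proof.
by rewrite /lami /par; under eq_fun do rewrite mxE mxE; exact: polyfun_coord.
Qed.

Lemma polyfun_v j : polyfun (fun x => v j x).
Proof.
rewrite /v; case: j => [|[|j]] /=.
- by apply: polyfunM; [exact: polyfunC | exact: polyfun_yco].
- exact: polyfun_zco.
- apply: polyfunD.
    by apply: polyfunM; [exact: polyfunC | apply: polyfunX; exact: polyfun_zco].
  apply: polyfun_sum => i; apply: polyfunM; last by apply: polyfunX; exact: polyfun_zco.
  by apply: polyfunM; [exact: polyfunC | exact: polyfun_lami].
Qed.

Lemma polyfun_wcoef j : polyfun (fun x => wcoef j x).
Proof.
rewrite /wcoef; apply: polyfun_if; apply: polyfunD.
- by apply: polyfunM; exact: polyfun_v.
- apply: polyfunN; apply: polyfunM; last exact: polyfunC.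
  by apply: polyfunX; exact: polyfun_v.
- by apply: polyfunM; exact: polyfun_v.
- exact: polyfun_v.
Qed.

Lemma polyfun_cvalue : polyfun (fun x : pairs C n => cvalue x).
Proof.
rewrite /cvalue; under eq_fun do rewrite zpolyE; apply: polyfunD; first apply: polyfunD.
- by apply: polyfunM; [apply: polyfunX; exact: polyfun_yco | exact: polyfun_zco].
- by apply: polyfunM; [exact: polyfun_lam | exact: polyfun_yco].
- apply: polyfunD; first by apply: polyfunX; exact: polyfun_zco.
  apply: polyfun_sum => i; apply: polyfunM; first exact: polyfun_lami.
  by apply: polyfunX; exact: polyfun_zco.
Qed.

Lemma closure_chart_path (S : set (pairs C n)) h (u : C -> C) (c : nat -> C -> C) x :
  critical_cover x -> polyfun h -> polyfun1 u -> (forall j, polyfun1 (c j)) ->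
  u 0 = cvalue x -> (forall j, c j 0 = v j x) ->
  (forall t, S (chart n (u t) (c ^~ t))) -> h (chart n (u 1) (c ^~ 1)) != 0 ->
  closure (S `\` [set y | h y = 0]) x.
Proof.
move=> cx ph pu pc u0 c0 Sc h1; rewrite (critical_cover_chart n4 cx) -u0.
have -> : (fun j => v j x) = (c ^~ 0) by apply/funext => j; rewrite c0.
pose g t := chart n (u t) (c ^~ t).
have H := @closure_path C _ S h g ph (polyfun1_chart (n:=n) pu pc) Sc h1.
exact: H.
Qed.

Definition segment (a b t : C) : C := a + t * (b - a).

Lemma polyfun1_segment a b : polyfun1 (segment a b).
Proof.
apply: polyfun1D; first exact: polyfun1C.
by apply: polyfun1M; [exact: polyfun1_id | exact: polyfun1C].
Qed.

Lemma segment0 a b : segment a b 0 = a. Proof. by rewrite /segment mul0r addr0. Qed.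
Lemma segment1 a b : segment a b 1 = b. Proof. by rewrite /segment mul1r addrC subrK. Qed.
Lemma segmentxx a t : segment a a t = a. Proof. by rewrite /segment subrr mulr0 addr0. Qed.

Lemma calL_chart c : calL (chart n (0 : C) c).
Proof. by apply/(calLE _).2; split; [exact: chart_critical | exact: cvalue_chart]. Qed.

(** L is an affine space in the coordinates v_j: segments stay inside. *)
Lemma calL_dense h (e : nat -> C) : polyfun h ->
  h (chart n 0 e) != 0 -> @calL C n `<=` closure (@calL C n `\` [set x | h x = 0]).
Proof.
move=> ph he x Lx; have [cx vx] := (calLE x).1 Lx.
apply: (@closure_chart_path _ h (fun=> 0) (fun j => segment (v j x) (e j))) => //.
- exact: polyfun1C.
- by move=> j; exact: polyfun1_segment.
- by move=> j; rewrite segment0.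
- by move=> t; exact: calL_chart.
- by under eq_fun do rewrite segment1.
Qed.

Lemma v_at0 j : (j < n.-1)%N -> v j (0 : pairs C n) = 0.
Proof.
have z0 : zco (0 : pairs C n) = 0 := zco0 C _; have y0 : yco (0 : pairs C n) = 0 := yco0 C _.
case: j => [|[|j]] jn; rewrite /v /= ?z0 ?y0 ?mulr0//.
rewrite expr0n subn_eq0 leqNgt jn mulr0 add0r big1// => i _.
by rewrite /par /lami !mxE mulr0 mul0r.
Qed.

Lemma wcoef_at0 j : (2 <= j <= n.-1)%N -> wcoef j (0 : pairs C n) = 0.
Proof.
move=> /andP[j2 jn]; have n1 : (1 < n.-1)%N := leq_trans j2 jn.
rewrite /wcoef !(v_at0 (ltnW n1)) !(v_at0 n1); case: ifP => _.
  by rewrite mul0r expr0n mul0r subr0.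
rewrite mul0r add0r v_at0// prednK// (ltn_trans _ j2)//.
Qed.

Lemma calL_at0 : calL (0 : pairs C n).
Proof.
have z0 : zco (0 : pairs C n) = 0 := zco0 C _; have y0 : yco (0 : pairs C n) = 0 := yco0 C _.
have l0 : lam (par (0 : pairs C n)) = 0 by rewrite /par /lam !mxE.
have li i : lami (par (0 : pairs C n)) i = 0 by rewrite /par /lami !mxE.
have n2 : (0 < n.-2)%N by lia.
apply/calLE; split.
  apply/critical_coverE; rewrite y0 z0 l0 !mulr0 addr0 expr0n addr0; split => //.
  rewrite deriv_zpolyE expr0n gtn_eqF// mulr0 add0r big1// => i _.
  by rewrite li mulr0 mul0r.
rewrite /cvalue y0 z0 l0 !mulr0 !add0r zpolyE expr0n gtn_eqF ?add0r; last lia.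
by rewrite big1// => i _; rewrite li mul0r.
Qed.

(** The critical value is one of the coordinates, so that at a point of L it can be
    moved away from 0 while the v_j stay fixed. *)
Lemma hypersurface_calL : hypersurface (@critical_cover C n) (@calL C n).
Proof.
apply: (hypersurface_intro polyfun_cvalue).
- by apply/seteqP; split => x /calLE.
- by exists 0; exact: calL_at0.
- move=> x cx; have [vx|vx] := eqVneq (cvalue x) 0; last first.
    by apply: subset_closure; split => // /eqP; exact/negP.
  apply: (@closure_chart_path _ _ id (fun j _ => v j x)) => //.
  + exact: polyfun_cvalue.
  + exact: polyfun1_id.
  + by move=> j; exact: polyfun1C.
  + by move=> t; exact: chart_critical.
  + by rewrite cvalue_chart// oner_eq0.
Qed.

Lemma hypersurface_V k : (k <= n.-2)%N -> hypersurface (@calL C n) (@V C n k).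
Proof.
move=> kn; have kn1 : (k < n.-1)%N by lia.
apply: (hypersurface_intro (polyfun_v k)) => //.
- by exists 0; split; [exact: calL_at0 | exact: v_at0].
- apply: (@calL_dense _ (fun=> 1)) => //; first exact: polyfun_v.
  by rewrite v_chart// ?oner_eq0// (ltn_trans kn1).
Qed.

(** Coordinates of a point of L where no w_k vanishes. *)
Definition ones_from1 (j : nat) : C := (j != 0%N)%:R.

Lemma hypersurface_W k : (2 <= k <= n.-1)%N -> hypersurface (@calL C n) (@W C n k).
Proof.
move=> kn; apply: (hypersurface_intro (polyfun_wcoef k)) => //.
- by apply/seteqP; split => x /(W_wcoef n4 x kn).
- by exists 0; apply/(W_wcoef n4 _ kn); split; [exact: calL_at0 | exact: wcoef_at0].
- apply: (@calL_dense _ ones_from1); first exact: polyfun_wcoef.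
  have o1 : ones_from1 n.-1 = 1.
    by rewrite /ones_from1 -lt0n -ltnS nK (ltn_trans _ n3).
  have vE j : (j < n)%N -> v j (chart n 0 ones_from1) = (j != 0%N)%:R by move=> jn; rewrite v_chart.
  move: kn => /andP[k2 kn].
  have kn' : (k < n)%N := leq_ltn_trans kn n1n.
  have e0 : v 0 (chart n 0 ones_from1) = 0 by rewrite vE//; lia.
  have e1 j : (1 <= j <= k)%N -> v j (chart n 0 ones_from1) = 1.
    by move=> jk; rewrite vE; [rewrite -lt0n; case: (j) jk | lia].
  rewrite /wcoef e0 (e1 1%N) ?(e1 2%N) ?(e1 k) ?(e1 k.-1); try lia.
  case: ifP => _; rewrite mul1r; last by rewrite -mulr2n pnatr_eq0.
  by rewrite expr0n mul0r subr0 oner_eq0.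
Qed.

(** V_0^m is a linear space in the coordinates v_j; the segments go to the point
    whose remaining coordinates are all 1. *)
Lemma V0_dense m h : polyfun h -> (m <= n.-2)%N ->
  (forall x, V0 m x -> (forall j, (m < j < n)%N -> v j x = 1) -> h x != 0) ->
  @V0 C n m `<=` closure (@V0 C n m `\` [set x | h x = 0]).
Proof.
move=> ph mn hn x /V0_coords[Lx vx]; have [cx vx0] := (calLE x).1 Lx.
pose e j : C := (m < j)%N%:R.
have VE t : V0 m (chart n 0 (fun j => segment (v j x) (e j) t)).
  apply: V0I; first exact: calL_chart.
  move=> j jm; rewrite v_chart//; last lia.
    by rewrite vx// /e ltnNge jm segmentxx.
  by rewrite v_top// /e (_ : (m < n.-1)%N) ?segmentxx//; lia.
apply: (@closure_chart_path _ h (fun=> 0) (fun j => segment (v j x) (e j))) => //.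
- exact: polyfun1C.
- by move=> j; exact: polyfun1_segment.
- by move=> j; rewrite segment0.
- apply: hn => //.
  move=> j /andP[mj jn]; rewrite v_chart//.
    by rewrite segment1 /e mj.
  by rewrite segment1 /e (_ : (m < n.-1)%N)//; lia.
Qed.

Lemma W2_wcoef m x : (2 <= m <= n.-1)%N -> W2 m x <->
  calL x /\ forall j, (2 <= j <= m)%N -> wcoef j x = 0.
Proof.
move=> mn; split => [Wx|[Lx wx] j /= jm].
  have m2 : (2 <= 2 <= m)%N by lia.
  split; first by have [] := Wx 2%N m2.
  move=> j jm; have jn : (2 <= j <= n.-1)%N by lia.
  by have /(W_wcoef n4 _ jn) [] := Wx j jm.
have jn : (2 <= j <= n.-1)%N by lia.
by apply/(W_wcoef n4 _ jn); split => //; exact: wx.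
Qed.

(** Solving v_1 v_j + v_(j-1) = 0 downwards from v_m, and then w_2 = 0 for v_0: the
    stratum is parametrized by v_1, v_m and a square root. *)
Lemma W2_v m x : (2 <= m <= n.-1)%N -> W2 m x ->
  v 0 x ^+ 2 = - 4 * (- v 1 x) ^+ m.-1 * v m x /\
  forall j, (2 <= j <= m)%N -> v j x = (- v 1 x) ^+ (m - j) * v m x.
Proof.
move=> mn /(W2_wcoef _ mn)[Lx wx].
have vj j : (2 <= j <= m)%N -> v j x = (- v 1 x) ^+ (m - j) * v m x.
  move=> /andP[j2 jm]; rewrite -{1}(subKn jm).
  have : (m - j <= m - 2)%N by lia.
  elim: (m - j)%N => [|i IH] im; first by rewrite subn0 expr0 mul1r.
  have := wx (m - i)%N; rewrite /wcoef ifF; last lia.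
  rewrite -subnS IH; last lia.
  have mi : (2 <= m - i <= m)%N by lia.
  move=> /(_ mi) /eqP; rewrite addrC addr_eq0 exprS => /eqP ->.
  by rewrite !mulNr mulrA.
split => //; have := wx 2%N; rewrite /wcoef eqxx.
have -> : v 2 x = (- v 1 x) ^+ (m - 2) * v m x by apply: vj; lia.
have -> : m.-1 = (m - 2).+1 by lia.
move=> w2; rewrite [(- v 1 x) ^+ _.+1]exprS.
have : v 1 x * ((- v 1 x) ^+ (m - 2) * v m x) = v 0 x ^+ 2 / 4.
  by apply/eqP; rewrite -subr_eq0 w2//; lia.
move=> e; have -> : v 0 x ^+ 2 = 4 * (v 0 x ^+ 2 / 4) by field.
by rewrite -e; ring.
Qed.

Lemma W2_chart m (c : nat -> C) : (2 <= m <= n.-1)%N -> c n.-1 = 1 ->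
  c 0%N ^+ 2 = - 4 * (- c 1%N) ^+ m.-1 * c m ->
  (forall j, (2 <= j <= m)%N -> c j = (- c 1%N) ^+ (m - j) * c m) ->
  W2 m (chart n 0 c).
Proof.
move=> mn c1 c0 cj; apply/(W2_wcoef _ mn); split; first exact: calL_chart.
move=> j jm; rewrite /wcoef !v_chart//; try lia.
case: eqP => [j2|j2].
  rewrite c0 (cj 2%N); last lia.
  have -> : m.-1 = (m - 2).+1 by lia.
  by rewrite [(- c 1%N) ^+ _.+1]exprS; field.
rewrite (cj j)// (cj j.-1); last lia.
have -> : (m - j.-1 = (m - j).+1)%N by lia.
by rewrite exprS; ring.
Qed.

(** By [W2_v] the polynomial parametrization v_1 = - p^2, v_m = q^2,
    v_0 = 2 i p^(m-1) q, v_j = p^(2(m-j)) q^2 is onto. It is followed to p = 1,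
    q = 2 while the other coordinates go to 1; there w_(m+1) = - 1 + 4. If
    m = n - 1, then v_m = 1 forces q to be constant, and w_(m+1) = 1. *)
Lemma W2_dense m h : polyfun h -> (2 <= m <= n.-1)%N ->
  (forall x, W2 m x -> v 1 x != 0 -> v 2 x != 0 -> wcoef m.+1 x != 0 -> h x != 0) ->
  @W2 C n m `<=` closure (@W2 C n m `\` [set x | h x = 0]).
Proof.
move=> ph mn hn x Wx; have [e0 ej] := W2_v mn Wx.
have [Lx _] := (W2_wcoef _ mn).1 Wx; have [cx vx0] := (calLE x).1 Lx.
have [I I2] : exists I : C, I ^+ 2 = - 1 by exists (2.-root (- 1)); rewrite rootCK.
have [p p2] : exists p : C, p ^+ 2 = - v 1 x by exists (2.-root (- v 1 x)); rewrite rootCK.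
(* The sign of q has to fit v_0. *)
have [q q2 e0'] : exists2 q : C, q ^+ 2 = v m x & v 0 x = 2 * I * p ^+ m.-1 * q.
  pose q := 2.-root (v m x); have q2 : q ^+ 2 = v m x by rewrite rootCK.
  have : (v 0 x) ^+ 2 = (2 * I * p ^+ m.-1 * q) ^+ 2.
    by rewrite e0 -p2 -q2 exprAC; set P := p ^+ m.-1; rewrite !exprMn I2; ring.
  move=> /eqP; rewrite eqf_sqr => /orP[] /eqP e; first by exists q.
  by exists (- q); rewrite ?sqrrN// e mulrN.
pose q1 := if (m == n.-1) then q else 2.
pose c j t : C := let P := segment p 1 t in let Q := segment q q1 t in
  if j == 0%N then 2 * I * P ^+ m.-1 * Q else if j == 1%N then - P ^+ 2 else
  if (j <= m)%N then (P ^+ 2) ^+ (m - j) * Q ^+ 2 else segment (v j x) 1 t.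
have cm t : c m t = segment q q1 t ^+ 2.
  by rewrite /c leqnn subnn expr0 mul1r !ifF//; lia.
have c1 t : c n.-1 t = 1.
  have [mn1|mn1] := eqVneq m n.-1.
    by rewrite -mn1 cm /q1 mn1 eqxx segmentxx q2 mn1 v_top.
  rewrite /c !ifF ?v_top ?segmentxx//; lia.
have cW t : W2 m (chart n 0 (c ^~ t)).
  apply: W2_chart => //.
    rewrite cm /c /= opprK exprAC; set P := _ ^+ m.-1; set Q := segment _ _ _.
    by rewrite !exprMn I2; ring.
  move=> [|[|j]] // /andP[_ jm]; rewrite cm {1}/c /= jm.
  by rewrite /c /= opprK.
apply: (@closure_chart_path _ h (fun=> 0) c) => //.
- exact: polyfun1C.
- move=> j; rewrite /c.
  have pP := polyfun1_segment p 1; have pQ := polyfun1_segment q q1.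
  apply: polyfun1_if.
    apply: polyfun1M => //; apply: polyfun1M; last exact: polyfun1X.
    exact: polyfun1C.
  apply: polyfun1_if; first by apply: polyfun1N; exact: polyfun1X.
  apply: polyfun1_if; last exact: polyfun1_segment.
  by apply: polyfun1M; [apply: polyfun1X|]; exact: polyfun1X.
- move=> j; rewrite /c !segment0 p2 q2 -e0' opprK.
  case: j => [|[|j]] //=; case: ifP => // jm; rewrite (ej j.+2)//.
- have m1n : (m < n)%N by lia.
  have v1 : v 1 (chart n 0 (c ^~ 1)) = - 1.
    by rewrite v_chart//; [rewrite /c /= segment1 expr1n | lia].
  have cm1 : c m 1 != 0 /\ wcoef m.+1 (chart n 0 (c ^~ 1)) != 0.
    rewrite /wcoef ifF; last lia.
    rewrite v1 /= (v_chart _ _ (j := m))//.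
    have [mn1|mn1] := eqVneq m n.-1.
      rewrite mn1 c1 v_large ?oner_eq0 ?mulr0 ?add0r ?oner_eq0//; lia.
    rewrite v_chart//; last lia.
    have -> : c m.+1 1 = 1 by rewrite /c /= !ifF ?segment1//; lia.
    rewrite cm segment1 /q1 (negPf mn1).
    split; first by rewrite expf_neq0 ?pnatr_eq0.
    have -> : -1 * 1 + 2 ^+ 2 = 3%:R :> C by ring.
    by rewrite pnatr_eq0.
  apply: hn => //.
  + by rewrite v1 oppr_eq0 oner_eq0.
  + have -> : v 2 (chart n 0 (c ^~ 1)) = c 2%N 1 by rewrite v_chart//; lia.
    rewrite /c /= ifT; last lia.
    by rewrite segment1 !expr1n mul1r -cm; case: cm1.
  + by case: cm1.
Qed.

End Density.

(** * Algebraic sets and the diagram of strata *)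

Section AlgebraicSets.
Variables (C : numClosedFieldType) (m : nat).
Implicit Types X Y : set 'rV[C]_m.

Lemma algebraicT : algebraic [set: 'rV[C]_m].
Proof. by exists [::]; apply/seteqP; split => x // _ P /=; rewrite in_nil. Qed.

Lemma algebraic_zeros h : polyfun h -> algebraic [set x : 'rV[C]_m | h x = 0].
Proof.
move=> /zeros_polyfun[P PE]; exists [:: P]; rewrite -PE; apply/seteqP; split => x /=.
  by move=> Px Q /=; rewrite mem_seq1 => /eqP ->.
by apply => /=; rewrite mem_seq1.
Qed.

Lemma algebraicI X Y : algebraic X -> algebraic Y -> algebraic (X `&` Y).
Proof.
move=> [s ->] [t ->]; exists (s ++ t); apply/seteqP; split => x /=.
  by move=> [sx tx] P /=; rewrite mem_cat => /orP[/sx|/tx].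
by move=> stx; split => P /= Ps; apply: stx; rewrite /= mem_cat Ps ?orbT.
Qed.

Lemma algebraicU X Y : algebraic X -> algebraic Y -> algebraic (X `|` Y).
Proof.
move=> [s ->] [t ->]; exists [seq P * Q | P <- s, Q <- t]; apply/seteqP; split => x.
  move=> [sx|tx] P /= /allpairsP[[Q R] /= [Qs Rt ->]]; rewrite /zeros /= mevalM.
    by rewrite (sx Q Qs) mul0r.
  by rewrite (tx R Rt) mulr0.
move=> stx; apply: contrapT => /not_orP[nsx ntx].
move/existsNP: nsx => [P /not_implyP [Ps Px]].
move/existsNP: ntx => [Q /not_implyP [Qt Qx]].
have PQ : [set` [seq P * Q | P <- s, Q <- t]] (P * Q) by exact: allpairs_f.
have := stx _ PQ; rewrite /zeros /= mevalM => /eqP.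
by rewrite mulf_eq0 => /orP[/eqP/Px|/eqP/Qx].
Qed.

Lemma algebraic_bigcap (D : pred nat) (F : nat -> set 'rV[C]_m) N :
  (forall k, D k -> (k <= N)%N) -> (forall k, algebraic (F k)) ->
  algebraic (\bigcap_(k in [set k | D k]) F k).
Proof.
move=> DN aF.
have -> : \bigcap_(k in [set k | D k]) F k =
    \bigcap_(k in [set k | D k && (k <= N)%N]) F k.
  apply/seteqP; split => x Fx k /=; first by move=> /andP[Dk _]; exact: Fx.
  by move=> Dk; apply: Fx; rewrite /= Dk DN.
elim: N {DN} => [|N IH].
  have [D0|D0] := boolP (D 0%N).
    rewrite (_ : \bigcap_(_ in _) _ = F 0%N)//; apply/seteqP; split => x Fx.
      by apply: Fx; rewrite /= D0.
    by move=> k /=; rewrite leqn0 => /andP[_ /eqP ->].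
  rewrite (_ : \bigcap_(_ in _) _ = setT); first exact: algebraicT.
  apply/seteqP; split => // x _ k /=; rewrite leqn0 => /andP[Dk /eqP k0].
  by rewrite k0 (negPf D0) in Dk.
have -> : \bigcap_(k in [set k | D k && (k <= N.+1)%N]) F k =
    \bigcap_(k in [set k | D k && (k <= N)%N]) F k `&` (if D N.+1 then F N.+1 else setT).
  apply/seteqP; split => x.
    move=> Fx; split => [k /= /andP[Dk kN]|].
      by apply: Fx; rewrite /= Dk ltnW.
    by case: ifP => // DN; apply: Fx; rewrite /= DN leqnn.
  move=> [Fx FN] k /= /andP[Dk]; rewrite leq_eqVlt => /orP[/eqP kN|kN].
    by move: FN; rewrite kN -kN Dk.
  by apply: Fx; rewrite /= Dk -ltnS.
by apply: algebraicI => //; case: ifP => _ //; exact: algebraicT.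
Qed.

End AlgebraicSets.

Section Diagram.
Variables (C : numClosedFieldType) (n : nat).
Hypothesis n4 : (4 <= n)%N.
Implicit Types (x : pairs C n).

Let n3 : (3 <= n)%N := ltnW n4.

Lemma algebraic_critical_cover : algebraic (@critical_cover C n).
Proof.
rewrite (_ : @critical_cover C n =
  [set x | 2 * yco x * zco x + lam (par x) = 0] `&`
  [set x | n.-1%:R * zco x ^+ n.-2 + yco x ^+ 2
    + \sum_(i < n.-1 | (1 <= i)%N) i%:R * lami (par x) i * zco x ^+ i.-1 = 0]); last by [].
apply: algebraicI; apply: algebraic_zeros.
  apply: polyfunD; last exact: polyfun_lam.
  apply: polyfunM; last exact: polyfun_zco.
  by apply: polyfunM; [exact: polyfunC | exact: polyfun_yco].
apply: polyfunD; first apply: polyfunD.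
- by apply: polyfunM; [exact: polyfunC | apply: polyfunX; exact: polyfun_zco].
- by apply: polyfunX; exact: polyfun_yco.
- apply: polyfun_sum => i; apply: polyfunM; last by apply: polyfunX; exact: polyfun_zco.
  by apply: polyfunM; [exact: polyfunC | exact: polyfun_lami].
Qed.

Lemma algebraic_calL : algebraic (@calL C n).
Proof.
rewrite (_ : @calL C n = @critical_cover C n `&` [set x | cvalue x = 0]).
  by apply: algebraicI; [exact: algebraic_critical_cover | exact: algebraic_zeros
    (polyfun_cvalue _ _)].
by apply/seteqP; split => x /calLE.
Qed.

Lemma algebraic_V k : algebraic (@V C n k).
Proof. by apply: algebraicI; [exact: algebraic_calL | apply: algebraic_zeros;
  exact: polyfun_v]. Qed.

Lemma algebraic_W k : algebraic (@W C n k).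
Proof.
apply: algebraicI; first exact: algebraic_calL.
have pv j := @polyfun_v C n j.
case: (k == 2%N); last case: (k == n.-1); apply: algebraic_zeros.
- apply: polyfunD; last by apply: polyfunN; exact: polyfunX.
  by apply: polyfunM => //; apply: polyfunM => //; exact: polyfunC.
- exact: polyfunD.
- by apply: polyfunD => //; exact: polyfunM.
Qed.

Lemma algebraic_V0 m : algebraic (@V0 C n m).
Proof. by apply: (@algebraic_bigcap _ _ (fun k => (k <= m)%N) _ m) => //; exact: algebraic_V. Qed.

Lemma algebraic_W2 m : algebraic (@W2 C n m).
Proof.
apply: (@algebraic_bigcap _ _ (fun k => (2 <= k <= m)%N) _ m); last exact: algebraic_W.
by move=> k /andP[].
Qed.

Lemma algebraic_stratum t : algebraic (@stratum C n t).
Proof.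
case: t => [[|[|[|[|m]]]]|m]; [exact: algebraic_W2 | exact: algebraic_calL | exact: algebraic_W
  | | exact: algebraic_W2 | exact: algebraic_V0].
by apply: algebraicU; [exact: algebraic_V0 | exact: algebraic_W2].
Qed.

Lemma W2_2 : @W C n 2 = W2 2.
Proof.
apply/seteqP; split => x; last by apply.
by move=> Wx k /= k2; have -> : k = 2%N by lia.
Qed.

(** If v_1 = 0, the equations of the W_j reduce to v_0 = 0 and v_(j-1) = 0. *)
Lemma V0_W2 m i : (2 <= m <= n.-1)%N -> (1 <= i)%N -> (m.-1 <= i)%N ->
  @V0 C n i `<=` W2 m.
Proof.
move=> mn i1 mi x /V0_coords[Lx vx]; apply/(W2_wcoef n4 _ mn); split => // j jm.
rewrite /wcoef; case: ifP => j2; rewrite (vx 1%N) ?mul0r; try lia.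
  by rewrite vx ?leq0n// expr0n mul0r subr0.
by rewrite add0r vx//; lia.
Qed.

Lemma W2_sub m m' : (m <= m')%N -> @W2 C n m' `<=` W2 m.
Proof. by move=> mm x Wx k /= km; apply: Wx => /=; lia. Qed.

Lemma V0_sub m m' : (m <= m')%N -> @V0 C n m' `<=` V0 m.
Proof. by move=> mm x Wx k /= km; apply: Wx => /=; lia. Qed.

Lemma stratum_A m : (4 <= m)%N -> @stratum C n (A m) = W2 m.
Proof. by case: m => [|[|[|[|]]]]. Qed.

Lemma stratum_arrow a b : arrow n a b -> @stratum C n b `<=` stratum a.
Proof.
case: a => m; case: b => m' [] //= va vb.
- move=> mm'; rewrite {}mm' in vb *; case: m va vb => [|[|[|[|m]]]] //= va vb.
  + by move=> x [].
  + move=> x []; rewrite W2_2; last exact: W2_sub.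
    by apply: V0_W2; lia.
  + by move=> x Wx; right; move: Wx; exact: W2_sub.
  + exact: W2_sub.
- move=> [m3 mm']; rewrite {}mm' in vb *; case: m va vb m3 => [|[|[|[|m]]]] //= va vb _.
  + by move=> x Vx; left; move: Vx; exact: V0_sub.
  + by apply: V0_W2; lia.
- by move=> ->; apply: V0_sub; lia.
Qed.

Lemma stratum0 t : vertex n t -> @stratum C n t 0.
Proof.
have W0 m : (2 <= m <= n.-1)%N -> @W2 C n m 0.
  by move=> mn; apply/(W2_wcoef n4 _ mn); split; [exact: calL_at0 | move=> j jm;
    apply: wcoef_at0 => //; lia].
have V0' m : (m <= n.-2)%N -> @V0 C n m 0.
  by move=> mn; apply: V0I => //; [exact: calL_at0 | move=> j jm; apply: v_at0 => //; lia].
case: t => [[|[|[|[|m]]]]|m] //= vt.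
- exact: calL_at0.
- by rewrite W2_2; apply: W0; lia.
- by left; apply: V0'; lia.
- by apply: W0; lia.
- by apply: V0'; lia.
Qed.

Lemma generically_intro (S : set (pairs C n)) h Q : polyfun h ->
  S `<=` closure (S `\` [set x | h x = 0]) -> (forall x, S x -> h x != 0 -> Q x) ->
  generically S Q.
Proof.
move=> ph Sc SQ; exists [set x | h x = 0]; split => //; first exact: algebraic_zeros.
by move=> x [Sx /= hx]; apply: SQ => //; apply/eqP.
Qed.

Lemma type_A_W2 k m x : (2 <= m <= n.-1)%N -> W2 m x -> v 1 x != 0 -> wcoef m.+1 x != 0 ->
  singularity_of_type (A m) (f_ (k := k) (par x)) (row_mx 0 (rsubmx x)).
Proof.
move=> mn /(W2_wcoef n4 _ mn)[Lx wx] v1 wm.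
by apply: type_A_generic => //; lia.
Qed.

(** Off the zeros of v_1 w_(m+1) the type is A_m, off those of v_(m-1) it is D_m. For
    A_3 one polynomial has to serve both V_0^1 and W_2^3, and v_2 w_4 does: on V_0^1
    the type is D_3 = A_3 as soon as v_2 is not zero, and on W_2^3 the equation
    v_2 = - v_1 v_3 makes v_1 not zero. *)
Lemma generic_type k t : vertex n t -> generically (@stratum C n t) [set x |
  singularity_of_type t (f_ (k := k) (par x)) (row_mx 0 (rsubmx x))].
Proof.
have pv j := @polyfun_v C n j; have pw j := @polyfun_wcoef C n j.
have pvw i j := polyfunM (pv i) (pw j).
have W2_generic m : (2 <= m <= n.-1)%N -> generically (@W2 C n m) [set x |
    singularity_of_type (A m) (f_ (k := k) (par x)) (row_mx 0 (rsubmx x))].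
  move=> mn; apply: (generically_intro (pvw 1%N m.+1)).
    apply: W2_dense => // x _ v1 _ wm.
    by rewrite mulf_neq0.
  move=> x Wx; rewrite mulf_eq0 negb_or => /andP[v1 wm].
  exact: type_A_W2.
case: t => [[|[|[|[|m]]]]|m] //= vt.
- apply: (generically_intro (pvw 1%N 2%N)).
    apply: (@calL_dense _ _ n4 _ (@ones_from1 C)) => //.
    have o1 : ones_from1 C n.-1 = 1 by rewrite /ones_from1 (_ : n.-1 != 0%N)//; lia.
    rewrite /wcoef eqxx !v_chart//; try lia.
    by rewrite /ones_from1 /= expr0n mul0r subr0 !mulr1 oner_eq0.
  move=> x Lx; rewrite mulf_eq0 negb_or => /andP[v1 wm].
  by apply: type_A_generic => // j; lia.
- by rewrite W2_2; apply: W2_generic; lia.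
- apply: (generically_intro (pvw 2%N 4%N)) => [x [Vx|Wx]|x [Vx|Wx]].
  + have n2 : (1 <= n.-2)%N by lia.
    have := @V0_dense _ _ n4 1 _ (pvw 2%N 4%N) n2.
    move=> /(_ _ _ Vx) H; apply: (closureS _ (H _)) => [y [Vy hy]|y Vy yE].
      by split => //; left.
    have [_ /(_ 1%N) v1] := V0_coords Vy.
    by rewrite /wcoef /= v1// mul0r add0r !yE ?mul1r ?oner_eq0//; lia.
  + have n3' : (2 <= 3 <= n.-1)%N by lia.
    have := @W2_dense _ _ n4 3 _ (pvw 2%N 4%N) n3'.
    move=> /(_ _ _ Wx) H; apply: (closureS _ (H _)) => [y [Vy hy]|y Wy _ v2 w4].
      by split => //; right.
    by rewrite mulf_neq0.
  + rewrite mulf_eq0 negb_or => /andP[v2 _].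
    exact: type_A_of_V01.
  + rewrite mulf_eq0 negb_or => /andP[v2 w4].
    have n3' : (2 <= 3 <= n.-1)%N by lia.
    apply: (type_A_W2 k n3') => //.
    apply: contraNneq v2 => v1; have [|_ vj] := @W2_v _ _ n4 3 x _ Wx; first lia.
    by rewrite (vj 2%N)// v1 oppr0 expr1 mul0r.
- by apply: W2_generic; lia.
- apply: (generically_intro (pv m.-1)).
    apply: V0_dense => //; first lia.
    move=> x _ vx; rewrite vx ?oner_eq0//; lia.
  by move=> x Vx vm; apply: type_D_generic => //; lia.
Qed.

Lemma stratum_verifies k : verifies k (@stratum C n).
Proof.
split => [a b|t vt]; first exact: stratum_arrow.
by split; [exists 0; exact: stratum0 | exact: generic_type].
Qed.

(** On V_0^(m-2) with m >= 4 both v_0 and v_1 vanish, so that w_m = v_(m-1). *)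
Lemma V0_cip m : (4 <= m <= n.-1)%N -> @V0 C n m.-1 = V0 m.-2 `&` W2 m.
Proof.
move=> mn; apply/seteqP; split => x.
  move=> Vx; split; first by move: Vx; apply: V0_sub; lia.
  by move: Vx; apply: V0_W2; lia.
move=> [/V0_coords[Lx vx]]; have mn' : (2 <= m <= n.-1)%N by lia.
move=> /(W2_wcoef n4 _ mn')[_ wx]; apply: V0I => // j jm.
have [->|jm'] := eqVneq j m.-1; last by apply: vx; lia.
have := wx m; rewrite /wcoef ifF; last lia.
rewrite (vx 1%N) ?mul0r ?add0r; last lia.
by apply; lia.
Qed.

End Diagram.

(** * Cardinality and resultants *)

Lemma card_seq (T : choiceType) (s : seq T) : uniq s -> ([set` s] #= `I_(size s))%card.
Proof.
case: s => [|x0 s'] us; first by rewrite set_nil /= II0.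
set s := x0 :: s' in us *.
have -> : [set` s] = range (fun i : 'I_(size s) => nth x0 s i).
  apply/seteqP; split => x /=.
    by move=> xs; exists (Ordinal (introT idP (etrans (index_mem x s) xs))); rewrite //= nth_index.
  by move=> [i _ <-]; rewrite mem_nth.
apply: card_eq_trans (card_esym card_II).
apply: inj_card_eq => i j _ _ /eqP; rewrite nth_uniq// => /eqP ij.
exact: val_inj.
Qed.

Lemma card_seq_uniq (T : choiceType) (s : seq T) :
  ([set` s] #= `I_(size s))%card -> uniq s.
Proof.
move=> cs; have : ([set` undup s] #= `I_(size s))%card.
  by rewrite (_ : [set` undup s] = [set` s])//; apply/seteqP; split => x; rewrite /= mem_undup.
move/(card_eq_trans (card_esym (card_seq (undup_uniq s)))) => /card_eq_II E.
by rewrite -[uniq s]negbK -ltn_size_undup E ltnn.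
Qed.

Section Resultant.
Variable R : comNzRingType.

(** The Sylvester matrix for prescribed degrees [a] and [b]: its size does not depend
    on the polynomials, so that its determinant is visibly a polynomial in their
    coefficients. *)
Definition sylvester_entry (a b : nat) (p q : nat -> R) (i j : 'I_(b + a)) : R :=
  let S_ (r : nat -> R) k := r (j - k)%N *+ (k <= j)%N in
  match fintype.split i with inl k => S_ p k | inr k => S_ q k end.

Lemma resultant_sylvester (p q : {poly R}) a b : size p = a.+1 -> size q = b.+1 ->
  resultant p q = \det (\matrix_(i, j) @sylvester_entry a b (fun l => p`_l) (fun l => q`_l) i j).
Proof.
move=> sp sq; have ea : (size p).-1 = a by rewrite sp.
have eb : (size q).-1 = b by rewrite sq.
rewrite /resultant; case: a / ea {sp}; case: b / eb {sq}.
by congr (\det _); apply/matrixP => i j; rewrite Sylvester_mxE mxE.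
Qed.

End Resultant.

Lemma polyfun_resultant (C : numFieldType) m (p q : 'rV[C]_m -> {poly C}) a b :
  (forall x, size (p x) = a.+1) -> (forall x, size (q x) = b.+1) ->
  (forall i, polyfun (fun x => (p x)`_i)) -> (forall i, polyfun (fun x => (q x)`_i)) ->
  polyfun (fun x => resultant (p x) (q x)).
Proof.
move=> sp sq pp pq.
under eq_fun do rewrite (resultant_sylvester (sp _) (sq _)).
apply: polyfun_det => i j; rewrite /sylvester_entry.
by case: (fintype.split i) => k; apply: polyfunMn.
Qed.

Lemma resultant_neq0 (C : numClosedFieldType) (p q : {poly C}) : p != 0 ->
  (resultant p q != 0) = coprimep p q.
Proof.
move=> p0; rewrite resultant_eq0 -leqNgt coprimep_def eqn_leq.
by rewrite lt0n size_poly_eq0 gcdp_eq0 negb_and p0 andbT.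
Qed.

Lemma polyfun_dense (C : numFieldType) m (h : 'rV[C]_m -> C) b : polyfun h -> h b != 0 ->
  [set: 'rV[C]_m] `<=` closure ([set: 'rV[C]_m] `\` [set x | h x = 0]).
Proof.
move=> ph hb x _.
have := @closure_path C m setT h (fun t => x + t *: (b - x)) ph.
rewrite scale0r addr0 scale1r [x + (b - x)]addrC subrK; apply => // j.
under eq_fun do rewrite !mxE.
apply: polyfun1D; first exact: polyfun1C.
by apply: polyfun1M; [exact: polyfun1_id | exact: polyfun1C].
Qed.

Lemma size_deriv_char0 (C : numFieldType) (p : {poly C}) : size p^`() = (size p).-1.
Proof.
have [->|p0] := eqVneq p 0; first by rewrite deriv0 size_poly0.
have [p1|p1] := leqP (size p) 1.
  by rewrite (size1_polyC p1) derivC size_poly0 size_polyC; case: (_ != 0).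
apply/anti_leq/andP; split; first by rewrite -ltnS prednK ?lt_size_deriv// ltnW.
have -> : (size p).-1 = (size p).-2.+1 by case: (size p) p1 => [|[]].
rewrite ltnNge; apply/negP => /leq_sizeP /(_ _ (leqnn _)).
rewrite coef_deriv (_ : (size p).-2.+1 = (size p).-1); last by case: (size p) p1 => [|[]].
rewrite -lead_coefE => /eqP; rewrite mulrn_eq0 lead_coef_eq0 (negPf p0) orbF.
by case: (size p) p1 => [|[]].
Qed.

(** * Counting the critical points, and the discriminants *)

Section CriticalPoints.
Variables (C : numClosedFieldType) (n : nat).
Hypothesis n4 : (4 <= n)%N.
Implicit Type L : T1 C n.

Let n3 : (3 <= n)%N := ltnW n4.
Let nK : n.-1.+1 = n. Proof. by lia. Qed.
Let nat_neq0 m : (0 < m)%N -> m%:R != 0 :> C. Proof. by rewrite pnatr_eq0 -lt0n. Qed.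

Definition point2 (y z : C) : 'rV[C]_2 := \row_j (if j == ord0 then y else z).

Lemma point2y y z : point2 y z 0 ord0 = y. Proof. by rewrite mxE. Qed.
Lemma point2z y z : point2 y z 0 ord_max = z. Proof. by rewrite mxE. Qed.
Lemma point2_eta (q : 'rV[C]_2) : q = point2 (q 0 ord0) (q 0 ord_max).
Proof.
apply/rowP => i; rewrite mxE; have [->//|i0] := eqVneq i ord0.
by congr (q 0 _); apply/val_inj; case: i i0 => -[|[|]].
Qed.

Lemma critical_systemE L q : critical_system L q <->
  2 * q 0 ord0 * q 0 ord_max + lam L = 0 /\ (zpoly L)^`().[q 0 ord_max] + q 0 ord0 ^+ 2 = 0.
Proof.
by rewrite /critical_system /= critical_coverE par_row_mx yco_row_mx zco_row_mx.
Qed.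

Lemma cvalue_row_mx L q : cvalue (row_mx L q) =
  q 0 ord0 ^+ 2 * q 0 ord_max + lam L * q 0 ord0 + (zpoly L).[q 0 ord_max].
Proof. by rewrite /cvalue par_row_mx yco_row_mx zco_row_mx. Qed.

(** Eliminating y = - lambda / (2 z) from the critical system, normalized to be monic.
    For lambda != 0 its roots are the z_Lambda; for lambda = 0 it has a multiple root at
    0, which stands for the two critical points with z = 0. *)
Definition zresolvent L : {poly C} := n.-1%:R^-1 *: ('X^2 * (zpoly L)^`() + (lam L ^+ 2 / 4)%:P).

Lemma lead_coef_zpoly L : lead_coef (zpoly L) = 1.
Proof. by rewrite lead_coefE size_zpoly coef_zpoly ltnn eqxx. Qed.

Lemma coef_deriv_zpoly_top L : (zpoly L)^`()`_n.-2 = n.-1%:R.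
Proof.
by rewrite coef_deriv (_ : n.-2.+1 = n.-1) ?coef_zpoly ?ltnn ?eqxx//; lia.
Qed.

Lemma size_deriv_zpoly L : size (zpoly L)^`() = n.-1.
Proof. by rewrite size_deriv_char0 size_zpoly. Qed.

Lemma zresolventE L z : (zresolvent L).[z] =
  n.-1%:R^-1 * (z ^+ 2 * (zpoly L)^`().[z] + lam L ^+ 2 / 4).
Proof. by rewrite hornerZ hornerD hornerM hornerXn hornerC. Qed.

Lemma zresolvent_monic_size L : zresolvent L \is monic /\ size (zresolvent L) = n.+1.
Proof.
have p0 : (zpoly L)^`() != 0 by rewrite -size_poly_eq0 size_deriv_zpoly; lia.
have s1 : size ('X^2 * (zpoly L)^`()) = n.+1.
  by rewrite mulrC size_mulXn// size_deriv_zpoly; lia.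
have s2 : (size (lam L ^+ 2 / 4)%:P < size ('X^2 * (zpoly L)^`())%R)%N.
  by rewrite s1; apply: leq_ltn_trans (size_polyC_leq1 _) _; lia.
have i0 : n.-1%:R^-1 != 0 :> C by rewrite invr_eq0 nat_neq0//; lia.
split; last by rewrite size_scale// size_polyDl.
rewrite monicE lead_coefZ lead_coefDl// lead_coefM lead_coefXn mul1r.
by rewrite lead_coefE size_deriv_zpoly coef_deriv_zpoly_top mulVf ?nat_neq0//; lia.
Qed.

Lemma deriv_zresolventE L z : (zresolvent L)^`().[z] =
  n.-1%:R^-1 * (2 * z * (zpoly L)^`().[z] + z ^+ 2 * (zpoly L)^`()^`().[z]).
Proof.
rewrite derivZ derivD derivM derivXn derivC addr0 hornerZ hornerD !hornerM hornerMn.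
by rewrite !hornerXn /= mulr_natl expr1.
Qed.

(** Nondegeneracy of the critical point, in the form that the elimination uses: [z]
    is the unknown if it is not zero, and [y] otherwise. *)
Definition simple_critical L (q : 'rV[C]_2) :=
  if q 0 ord_max == 0 then q 0 ord0 != 0 else ~~ root (zresolvent L)^`() (q 0 ord_max).

Lemma simple_root_uniq (p : {poly C}) s z : p != 0 ->
  p = lead_coef p *: \prod_(r <- s) ('X - r%:P) -> uniq s -> root p z -> ~~ root p^`() z.
Proof.
move=> p0 pE us rz.
have sp : separable_poly p.
  by rewrite pE (eqp_separable (eqp_scale _ _)) ?lead_coef_eq0// separable_prod_XsubC.
by move: sp; rewrite separable_poly.unlock => /coprimep_root /(_ rz).
Qed.

(** The list counts the critical points with multiplicity. If lambda != 0, they are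
    given by the n roots of [zresolvent]. If lambda = 0, the first equation is y z = 0,
    and the critical points are (c, 0) and (- c, 0), with c^2 = - P'(0), and the
    (0, z) for the n - 2 roots z of P'. *)
Lemma critical_seq L : exists s : seq 'rV[C]_2, [/\ size s = n,
  critical_system L = [set` s],
  uniq s -> forall q, critical_system L q -> simple_critical L q &
  lam L != 0 -> separable_poly (zresolvent L) -> uniq s].
Proof.
have [Rm Rs] := zresolvent_monic_size L.
have R0 : zresolvent L != 0 by rewrite monic_neq0.
have iR : n.-1%:R^-1 != 0 :> C by rewrite invr_eq0 nat_neq0//; lia.
have [l0|l0] := eqVneq (lam L) 0; last first.
  have [s sE] := closed_field_poly_normal (zresolvent L).
  have zs z : (z \in s) = root (zresolvent L) z.
    by rewrite sE rootZ ?lead_coef_eq0// root_prod_XsubC.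
  have zn0 z : z \in s -> z != 0.
    rewrite zs rootE; apply: contraTneq => ->; rewrite zresolventE expr0n mul0r add0r.
    by rewrite mulf_eq0 (negPf iR) mulf_eq0 invr_eq0 pnatr_eq0 orbF expf_eq0.
  have in_s z : z != 0 -> (z \in s) = ((zpoly L)^`().[z] == - (- lam L / (2 * z)) ^+ 2).
    move=> z0; rewrite zs rootE zresolventE mulf_eq0 (negPf iR) /= -addr_eq0.
    have -> : z ^+ 2 * (zpoly L)^`().[z] + lam L ^+ 2 / 4 =
      z ^+ 2 * ((zpoly L)^`().[z] + (- lam L / (2 * z)) ^+ 2) by field.
    by rewrite mulf_eq0 expf_eq0 (negPf z0).
  pose f z := point2 (- lam L / (2 * z)) z.
  have crit_z q : critical_system L q -> q 0 ord_max != 0.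
    move=> /critical_systemE [e1 _]; apply: contra_neq l0 => z0.
    by rewrite -e1 z0 mulr0 add0r.
  have crit_y q : critical_system L q -> q 0 ord0 = - lam L / (2 * q 0 ord_max).
    move=> Lq; have z0 := crit_z _ Lq; have [e1 _] := (critical_systemE _ _).1 Lq.
    apply/(canRL (mulfK _)); first by rewrite mulf_neq0 ?pnatr_eq0.
    by apply/eqP; rewrite -addr_eq0 -[X in _ == X]e1; apply/eqP; ring.
  have crit_s q : critical_system L q -> q 0 ord_max \in s.
    move=> Lq; have [_ e2] := (critical_systemE _ _).1 Lq.
    by rewrite in_s ?crit_z// -crit_y// -addr_eq0 e2.
  exists [seq f z | z <- s]; split.
  - by move: Rs; rewrite {1}sE size_scale ?lead_coef_eq0// size_prod_XsubC size_map => -[].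
  - apply/seteqP; split => q /=.
      move=> Lq; apply/mapP; exists (q 0 ord_max); first exact: crit_s.
      by rewrite /f -crit_y// -point2_eta.
    move=> /mapP[z zsz ->]; apply/critical_systemE; rewrite point2y point2z.
    have z0 := zn0 z zsz; split; first by field.
    by move: zsz; rewrite in_s// => /eqP ->; rewrite addNr.
  - move=> us q qL; have := us => /map_uniq us'.
    have z0 := crit_z _ qL.
    rewrite /simple_critical (negPf z0); apply: simple_root_uniq sE us' _ => //.
    by rewrite -zs; apply: crit_s.
  - move=> _ sep; rewrite map_inj_uniq; last by move=> z z' /rowP /(_ ord_max); rewrite !mxE.
    by move: sep; rewrite sE (eqp_separable (eqp_scale _ _)) ?lead_coef_eq0// separable_prod_XsubC.
have [s sE] := closed_field_poly_normal (zpoly L)^`().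
have p0 : (zpoly L)^`() != 0 by rewrite -size_poly_eq0 size_deriv_zpoly; lia.
have zs z : (z \in s) = root (zpoly L)^`() z.
  by rewrite sE rootZ ?lead_coef_eq0// root_prod_XsubC.
pose c := 2.-root (- (zpoly L)^`().[0]).
have c2 : c ^+ 2 = - (zpoly L)^`().[0] by rewrite rootCK.
exists (point2 c 0 :: point2 (- c) 0 :: [seq point2 0 z | z <- s]); split.
- rewrite /= size_map; have := size_deriv_zpoly L.
  by rewrite {1}sE size_scale ?lead_coef_eq0// size_prod_XsubC => ->; exact: nK.
- apply/seteqP; split => q /=; rewrite !inE.
    move=> /critical_systemE [/eqP + e2]; rewrite l0 addr0 !mulf_eq0 pnatr_eq0 /=.
    have [z0 _|z0] := eqVneq (q 0 ord_max) 0.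
      move: e2; rewrite z0 => /eqP; rewrite addrC addr_eq0 -c2 eqf_sqr.
      have := point2_eta q; rewrite z0 => qE /orP[] /eqP y0; rewrite y0 in qE.
        by rewrite qE eqxx.
      by rewrite qE eqxx orbT.
    rewrite orbF => /eqP y0; apply/orP; right; apply/orP; right.
    apply/mapP; exists (q 0 ord_max); last by rewrite -y0 -point2_eta.
    by rewrite zs rootE -[X in _ == X]e2 y0 expr0n addr0.
  move=> qs; apply/critical_systemE; rewrite l0 addr0; move: qs.
  move=> /orP[/eqP ->|/orP[/eqP ->|/mapP[z + ->]]]; rewrite point2y point2z.
  + by rewrite mulr0 c2 addrN.
  + by rewrite mulr0 sqrrN c2 addrN.
  + by rewrite zs rootE => /eqP ->; rewrite mulr0 mul0r expr0n addr0.
- move=> /= /andP[cs /andP[_ /map_uniq us]] q /critical_systemE [/eqP + e2].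
  have c0 : c != 0 by apply: contra cs => /eqP ->; rewrite oppr0 mem_head.
  rewrite l0 addr0 !mulf_eq0 pnatr_eq0 /= /simple_critical.
  have [z0 _|z0] := eqVneq (q 0 ord_max) 0.
    apply: contra c0 => /eqP y0; rewrite -[c == 0](@expf_eq0 _ _ 2)// c2.
    by move: e2; rewrite z0 y0 expr0n addr0 => ->; rewrite oppr0.
  rewrite orbF => /eqP y0; have {}e2 : (zpoly L)^`().[q 0 ord_max] = 0.
    by rewrite -[RHS]e2 y0 expr0n addr0.
  rewrite rootE deriv_zresolventE e2 mulr0 add0r.
  rewrite (mulf_neq0 iR)// mulf_neq0 ?expf_neq0//; apply: simple_root_uniq sE us _ => //.
  exact/eqP.
- by [].
Qed.

Lemma critical_choices_exist : exists p : 'I_n -> T1 C n -> 'rV[C]_2, critical_choices p.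
Proof.
have [s sP] := choice critical_seq.
exists (fun i L => nth 0 (s L) i) => L; have [sz -> _ _] := sP L.
apply/seteqP; split => q /=.
  move=> qs; have iq : (index q (s L) < n)%N by rewrite -sz index_mem.
  by exists (Ordinal iq); rewrite //= nth_index.
by move=> [i _ <-]; rewrite mem_nth// sz.
Qed.

Lemma polyfun_lamT : polyfun (@lam C n).
Proof. by rewrite /lam; under eq_fun do rewrite mxE; exact: polyfun_coord. Qed.

Lemma polyfun_lamiT i : polyfun (fun L => lami L i).
Proof. by rewrite /lami; under eq_fun do rewrite mxE; exact: polyfun_coord. Qed.

Lemma polyfun_coef_zpoly i : polyfun (fun L => (zpoly L)`_i).
Proof.
under eq_fun do rewrite coef_zpoly.
apply: polyfun_if; last exact: polyfunC.
by case: insubP => [j _ _|_] /=; [exact: polyfun_lamiT | exact: polyfunC].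
Qed.

Lemma polyfun_coef_deriv (F : T1 C n -> {poly C}) i : (forall i, polyfun (fun L => (F L)`_i)) ->
  polyfun (fun L => (F L)^`()`_i).
Proof. by move=> pF; under eq_fun do rewrite coef_deriv; exact: polyfunMn. Qed.

Lemma polyfun_lam2 : polyfun (fun L => lam L ^+ 2 / 4).
Proof. by apply: polyfunM; [apply: polyfunX; exact: polyfun_lamT | exact: polyfunC]. Qed.

Lemma polyfun_coef_zresolvent i : polyfun (fun L => (zresolvent L)`_i).
Proof.
under eq_fun do rewrite coefZ coefD coefXnM coefC.
apply: polyfunM; first exact: polyfunC.
apply: polyfunD; apply: polyfun_if; try exact: polyfunC; last exact: polyfun_lam2.
by apply: polyfun_coef_deriv; exact: polyfun_coef_zpoly.
Qed.

(** lambda = 2 and all lambda_i = 0. The two discriminants below do not vanish there: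
    the resolvent and the node polynomial are z^n + 1 / (n - 1) and z^n - 1. *)
Definition base_point : T1 C n := row_mx (const_mx 2) 0.

Lemma lam_base_point : lam base_point = 2.
Proof. by rewrite /lam row_mxKl mxE. Qed.

Lemma zpoly_base_point : zpoly base_point = 'X^(n.-1).
Proof.
rewrite /zpoly big1 ?addr0// => i _.
by rewrite /lami row_mxKr mxE scale0r.
Qed.

(** The factor lambda is there because of the permanent multiple root of [zresolvent]
    when lambda = 0. *)
Definition critical_disc L := lam L * resultant (zresolvent L) (zresolvent L)^`().

Lemma polyfun_critical_disc : polyfun critical_disc.
Proof.
apply: polyfunM; first exact: polyfun_lamT.
apply: (@polyfun_resultant _ _ _ _ n n.-1).
- by move=> L; have [] := zresolvent_monic_size L.
- by move=> L; rewrite size_deriv_char0; have [_ ->] := zresolvent_monic_size L; rewrite nK.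
- exact: polyfun_coef_zresolvent.
- by move=> i; apply: polyfun_coef_deriv; exact: polyfun_coef_zresolvent.
Qed.

Lemma critical_disc_base_point : critical_disc base_point != 0.
Proof.
have [Rm _] := zresolvent_monic_size base_point.
rewrite mulf_neq0 ?lam_base_point ?pnatr_eq0//.
rewrite resultant_neq0 ?monic_neq0//; apply/Pdiv.ClosedField.coprimepP => z.
rewrite rootE zresolventE deriv_zresolventE lam_base_point zpoly_base_point.
rewrite !derivXn derivMn derivXn !hornerMn !hornerXn.
have n0 : n.-1%:R != 0 :> C by rewrite nat_neq0//; lia.
rewrite mulf_eq0 invr_eq0 (negPf n0) /= => e.
have z0 : z != 0.
  apply: contraTneq e => ->; rewrite expr0n mul0r add0r.
  by rewrite mulf_eq0 invr_eq0 expf_eq0 !pnatr_eq0.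
have -> : 2 * z * (z ^+ n.-2 *+ n.-1) + z ^+ 2 * (z ^+ n.-2.-1 *+ n.-2 *+ n.-1) =
    n.-1%:R * n%:R * z ^+ n.-1.
  have [m nm] : exists m, n = m.+3 by exists n.-2.-1; lia.
  rewrite nm /= (exprS z m.+1) (exprS z m); move: (z ^+ m) => a; ring.
by rewrite mulf_neq0 ?invr_eq0// !mulf_neq0 ?expf_neq0// nat_neq0//; lia.
Qed.

Lemma generic_card_critical_system :
  generically [set: T1 C n] [set L | (critical_system L #= `I_n)%card].
Proof.
exists [set L | critical_disc L = 0]; split.
- exact: algebraic_zeros polyfun_critical_disc.
- exact: polyfun_dense polyfun_critical_disc critical_disc_base_point.
- move=> L [_ /= /eqP]; rewrite mulf_eq0 negb_or => /andP[l0 rL].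
  have [s [sz -> _ us]] := critical_seq L.
  have [Rm _] := zresolvent_monic_size L.
  rewrite -[X in `I_X]sz; apply: card_seq; apply: us => //.
  by rewrite separable_poly.unlock -resultant_neq0 ?monic_neq0.
Qed.

(** z f_Lambda = (y z + lambda / 2)^2 + z P(z) - lambda^2 / 4 for vanishing x_i. *)
Definition node_poly L : {poly C} := 'X * zpoly L - (lam L ^+ 2 / 4)%:P.

Lemma node_poly_monic_size L : node_poly L \is monic /\ size (node_poly L) = n.+1.
Proof.
have p0 : zpoly L != 0 by rewrite -size_poly_eq0 size_zpoly.
have s1 : size ('X * zpoly L) = n.+1 by rewrite mulrC size_mulX// size_zpoly nK.
have s2 : (size (- (lam L ^+ 2 / 4)%:P)%R < size ('X * zpoly L)%R)%N.
  by rewrite s1 size_polyN; apply: leq_ltn_trans (size_polyC_leq1 _) _; lia.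
split; last by rewrite /node_poly size_polyDl.
by rewrite monicE lead_coefDl// lead_coefM lead_coefX mul1r lead_coef_zpoly.
Qed.

Definition node_disc L := resultant (node_poly L) (node_poly L)^`().

Lemma polyfun_node_disc : polyfun node_disc.
Proof.
have pN i : polyfun (fun L => (node_poly L)`_i).
  under eq_fun do rewrite coefB coefXM coefC.
  apply: polyfunD; first by apply: polyfun_if; [exact: polyfunC | exact: polyfun_coef_zpoly].
  by apply: polyfunN; apply: polyfun_if; [exact: polyfun_lam2 | exact: polyfunC].
apply: (@polyfun_resultant _ _ _ _ n n.-1) => //.
- by move=> L; have [] := node_poly_monic_size L.
- by move=> L; rewrite size_deriv_char0; have [_ ->] := node_poly_monic_size L; rewrite nK.
- by move=> i; exact: polyfun_coef_deriv.
Qed.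

Lemma node_disc_base_point : node_disc base_point != 0.
Proof.
have [Rm _] := node_poly_monic_size base_point.
rewrite resultant_neq0 ?monic_neq0//; apply/Pdiv.ClosedField.coprimepP => z.
rewrite rootE /node_poly lam_base_point zpoly_base_point -exprS nK.
rewrite derivB derivC subr0 derivXn hornerD hornerN hornerC hornerMn !hornerXn.
rewrite subr_eq0 => /eqP zn.
have z0 : z != 0.
  apply/eqP => z0; move: zn; rewrite z0 expr0n gtn_eqF; last lia.
  by move/eqP; rewrite eq_sym mulf_eq0 expf_eq0 invr_eq0 !pnatr_eq0.
by rewrite mulrn_eq0 negb_or expf_neq0// andbT; lia.
Qed.

(** At a common zero z != 0 of z P - lambda^2 / 4 and its derivative P + z P', the
    value y = - lambda / (2 z) gives P = y^2 z and P' = - y^2, which is a critical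
    point of value 0; the same computation goes backwards. If z = 0, then lambda = 0
    and P(0) = 0, and y is a square root of - P'(0). *)
Lemma node_discP L : node_disc L = 0 <->
  exists2 q, critical_system L q & calL (row_mx L q).
Proof.
have [Rm _] := node_poly_monic_size L; have N0 := monic_neq0 Rm.
have hE z : (node_poly L).[z] = z * (zpoly L).[z] - lam L ^+ 2 / 4.
  by rewrite hornerD hornerN hornerC hornerM hornerX.
have dE z : (node_poly L)^`().[z] = (zpoly L).[z] + z * (zpoly L)^`().[z].
  by rewrite derivB derivC subr0 derivM derivX mul1r hornerD hornerM hornerX.
split => [/eqP|[q Lq /calLE [_]]].
  rewrite -[_ == 0]negbK resultant_neq0// => /Pdiv.ClosedField.coprimepP.
  move=> /existsNP [z] /not_implyP [/eqP + /negP]; rewrite hE dE negbK => e1 /eqP e2.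
  have [z0|z0] := eqVneq z 0.
    move: e1 e2; rewrite z0 !mul0r sub0r addr0 => /eqP; rewrite oppr_eq0 mulf_eq0.
    rewrite invr_eq0 pnatr_eq0 orbF expf_eq0 /= => /eqP l0 p0.
    pose y := 2.-root (- (zpoly L)^`().[0]).
    have y2 : y ^+ 2 = - (zpoly L)^`().[0] by rewrite rootCK.
    have Lq : critical_system L (point2 y 0).
      by apply/critical_systemE; rewrite point2y point2z mulr0 l0 y2 addrN addr0.
    exists (point2 y 0) => //; apply/calLE; split => //.
    by rewrite cvalue_row_mx point2y point2z l0 p0 mulr0 mul0r !addr0.
  pose y := - lam L / (2 * z).
  have lE : lam L = - (2 * y * z) by rewrite /y; field.
  have p1 : (zpoly L).[z] = y ^+ 2 * z.
    apply: (mulfI z0); apply/eqP; rewrite -subr_eq0 -[X in _ == X]e1; apply/eqP.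
    by rewrite lE; field.
  have p2 : (zpoly L)^`().[z] = - y ^+ 2.
    by apply: (mulfI z0); apply/eqP; rewrite -subr_eq0 -[X in _ == X]e2 p1; apply/eqP; ring.
  have Lq : critical_system L (point2 y z).
    apply/critical_systemE; rewrite point2y point2z p2 addNr; split => //.
    by rewrite lE addrN.
  exists (point2 y z) => //; apply/calLE; split => //.
  by rewrite cvalue_row_mx point2y point2z p1 lE; ring.
rewrite cvalue_row_mx; have [e1 e2] := (critical_systemE _ _).1 Lq.
set y := q 0 ord0 in e1 e2 *; set z := q 0 ord_max in e1 e2 *.
have lE : lam L = - (2 * y * z) by apply/eqP; rewrite -addr_eq0 addrC e1.
have p2 : (zpoly L)^`().[z] = - y ^+ 2 by apply/eqP; rewrite -addr_eq0 e2.
rewrite lE => e3; have p1 : (zpoly L).[z] = y ^+ 2 * z.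
  by apply/eqP; rewrite -subr_eq0 -[X in _ == X]e3; apply/eqP; ring.
apply/eqP; rewrite -[_ == 0]negbK resultant_neq0//.
apply/negP => /Pdiv.ClosedField.coprimepP /(_ z).
rewrite rootE hE dE p1 p2 lE => H.
have : y ^+ 2 * z + z * - y ^+ 2 != 0 by apply: H; apply/eqP; field.
by move/eqP; apply; ring.
Qed.

Lemma trace_union (p : 'I_n -> T1 C n -> 'rV[C]_2) : critical_choices p ->
  \bigcup_i trace (p i) (@calL C n) = [set L | node_disc L = 0].
Proof.
move=> cp; apply/seteqP; split => L /=.
  move=> [i _ Li]; apply/node_discP; exists (p i L) => //.
  by rewrite cp; exists i.
by move=> /node_discP [q]; rewrite cp => -[i _ <-] Lq; exists i.
Qed.

Lemma hypersurface_trace_union (p : 'I_n -> T1 C n -> 'rV[C]_2) : critical_choices p ->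
  hypersurface [set: T1 C n] (\bigcup_i trace (p i) (@calL C n)).
Proof.
move=> cp; rewrite trace_union//; apply: (hypersurface_intro polyfun_node_disc).
- by rewrite setTI.
- exists 0; apply/node_discP; exists 0.
    have /calLE [+ _] := calL_at0 C n4.
    by rewrite /critical_system /= row_mx0.
  by rewrite row_mx0; exact: calL_at0.
- exact: polyfun_dense polyfun_node_disc node_disc_base_point.
Qed.

End CriticalPoints.

(** * The node locus *)

Section Nodes.
Variables (C : numClosedFieldType) (n : nat).
Hypothesis n4 : (4 <= n)%N.
Implicit Type L : T1 C n.

Lemma is_diff_normal_form_A1 k : is_diff (0 : 'rV[C]_(k + 2)) (normal_form (A 1) (k := k))
  (fun=> 0).
Proof.
have dx i : is_diff (0 : 'rV[C]_(k + 2)) (fun y => xco y i) (fun y => xco y i).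
  by rewrite /xco; under eq_fun do rewrite mxE; exact: is_diff_rV_coord.
have dy : is_diff (0 : 'rV[C]_(k + 2)) (fun y => yco y) (fun y => yco y).
  by rewrite /yco; under eq_fun do rewrite mxE; exact: is_diff_rV_coord.
have dz : is_diff (0 : 'rV[C]_(k + 2)) (fun y => zco y) (fun y => zco y).
  by rewrite /zco; under eq_fun do rewrite mxE; exact: is_diff_rV_coord.
have D1 := is_difff_sum (index_enum 'I_k) xpredT (fun i => is_difffX 2 (dx i)).
apply: is_diff_eq (is_difffD (is_difffD D1 (is_difffX 2 dy)) (is_difffX 2 dz)) _.
apply/funext => h; rewrite big1 => [|i _].
  by rewrite yco0 zco0 !expr1 !mulr0 !mul0r !addr0.
by rewrite xco0 expr1 mulr0 mul0r.
Qed.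

(** The function is a unit times the normal form in other coordinates, and the
    normal form and its differential vanish at the origin. *)
Lemma node_critical_point k (f : 'rV[C]_(k + 2) -> C) p : differentiable f p ->
  singularity_of_type (A 1) f p -> f p = 0 /\ critical_points f p.
Proof.
move=> df [U [V [phi [psi [u [[oU oV U0 Vp e] h1 h2 h3 h4]]]]]].
have [_ psip _] := h1 _ U0; rewrite e in psip.
have fE y : V y -> u (psi y) * normal_form (A 1) (psi y) = f y.
  by move=> Vy; have [Uy ey _] := h2 _ Vy; rewrite -h4// ey.
have g0 : normal_form (A 1) (0 : 'rV[C]_(k + 2)) = 0.
  rewrite /normal_form yco0 zco0 !expr0n !addr0 sum_squares_xco big1// => i _.
  by rewrite xco0 expr0n.
split; first by rewrite -fE// psip g0 mulr0.
split => //.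
have [_ _ dpsi] := h2 _ Vp; have [du _] := h3 _ U0.
have da : differentiable (fun y => u (psi y)) p.
  by apply: differentiablef_comp => //; rewrite psip.
have db : is_diff p (fun y => normal_form (A 1) (psi y)) (fun=> 0).
  have dg : is_diff (psi p) (normal_form (A 1) (k := k)) (fun=> 0).
    by rewrite psip; exact: is_diff_normal_form_A1.
  exact: (is_diff_comp (differentiableP dpsi) dg).
have dG := is_difffM (differentiableP da) db.
have [|_ ->] := @near_eq_diff _ _ _ _ f p (ex_diff (is_diff_def := dG)).
  have nV : nbhs p V by exact: open_nbhs_nbhs.
  by apply: filterS nV => y /fE.
by move=> h; rewrite (diff_val (is_diff_def := dG)) psip g0 !mulr0 addr0.
Qed.

(** A node is a critical point of value 0, so that the locus lies in the zero set of
    the discriminant, which is closed. Conversely the points of L where the type is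
    A_1 are dense in L, and the projection of the critical cover to T^1 is
    continuous. *)
Lemma closure_node_locus k : closure (@node_locus C n k) = [set L | node_disc L = 0].
Proof.
apply/seteqP; split => L /=.
- move=> cL; apply/eqP; apply: contrapT => /negP dL.
  have := near_neq0 (polyfun_differentiable _ (polyfun_node_disc C n4)) dL.
  move=> /cL [L' [[p pA]] /negP]; apply; apply/eqP/node_discP => //.
  have [fp] := node_critical_point (ex_diff (is_diff_def := is_diff_f_ L' p)) pA.
  rewrite critical_pointsE => -[q Lq qp]; exists q => //.
  apply/calLE; split => //.
  by rewrite -(cvalueE k) par_row_mx row_mxKr qp.
- move=> /node_discP -/(_ n4) [q Lq Lx].
  have v1 : vertex n (A 1) by rewrite /=; lia.
  have [Z [_ dZ ZQ]] := @generic_type C n n4 k _ v1.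
  move=> B nB; have dpar : differentiable (@par C n) (row_mx L q).
    exact: differentiable_lsubmx.
  have nB' : nbhs (row_mx L q : pairs C n) (fun y => B (par y)).
    by apply: (near_comp dpar); rewrite par_row_mx.
  have [y [Ly By]] := dZ _ Lx _ nB'.
  exists (par y); split => //.
  by exists (row_mx 0 (rsubmx y)); exact: ZQ.
Qed.

End Nodes.

(** * Holomorphic choices of the critical points *)

Section Branches.
Variables (C : numClosedFieldType) (n : nat).
Hypothesis n4 : (4 <= n)%N.
Implicit Type L : T1 C n.

Let nat_neq0 m : (0 < m)%N -> m%:R != 0 :> C. Proof. by rewrite pnatr_eq0 -lt0n. Qed.

Lemma differentiable_point2 (X : normedModType C) (y z : X -> C) x :
  differentiable y x -> differentiable z x -> differentiable (fun u => point2 (y u) (z u)) x.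
Proof.
move=> dy dz; apply: differentiable_rV => j; under eq_fun do rewrite mxE.
by case: (j == ord0).
Qed.

Lemma differentiable_lam L : differentiable (@lam C n) L.
Proof. exact: polyfun_differentiable (polyfun_lamT C n). Qed.

(** The elimination of z = - lambda / (2 y) from the critical system, which is
    multiplied by y^(n-2) to become a monic polynomial in y; it replaces [zresolvent]
    near the critical points with z = 0. *)
Definition yresolvent L : {poly C} := 'X^n +
  \sum_(i < n.-1) ((zpoly L)^`()`_i * (- lam L / 2) ^+ i) *: 'X^(n.-2 - i).

Lemma yresolventE L y : y != 0 -> (yresolvent L).[y] =
  y ^+ n.-2 * ((zpoly L)^`().[- lam L / (2 * y)] + y ^+ 2).
Proof.
move=> y0; rewrite hornerD hornerXn horner_sum mulrDr -exprD addrC (_ : (n.-2 + 2)%N = n); last lia.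
congr (_ + _); rewrite (@horner_coef_wide _ n.-1) ?size_deriv_zpoly// mulr_sumr.
apply: eq_bigr => i _; rewrite hornerZ hornerXn.
have -> : y ^+ n.-2 = y ^+ (n.-2 - i) * y ^+ i by rewrite -exprD subnK//; have := ltn_ord i; lia.
have -> : - lam L / (2 * y) = - lam L / 2 / y by field.
rewrite [(- lam L / 2 / y) ^+ _]expr_div_n; move: ((- lam L / 2) ^+ i) => a.
by field; rewrite expf_neq0.
Qed.

Lemma yresolvent_monic_size L : yresolvent L \is monic /\ size (yresolvent L) = n.+1.
Proof.
set s := \sum_(i < n.-1) ((zpoly L)^`()`_i * (- lam L / 2) ^+ i) *: 'X^(n.-2 - i).
have sl : (size s < size ('X^n : {poly C}))%N.
  rewrite size_polyXn ltnS; apply: leq_trans (size_sum _ _ _) _; apply/bigmax_leqP => i _.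
  apply: leq_trans (size_scale_leq _ _) _; rewrite size_polyXn; lia.
split; last by rewrite /yresolvent size_polyDl// size_polyXn.
by rewrite monicE lead_coefDl// lead_coefXn.
Qed.

Lemma polyfun_coef_yresolvent i : polyfun (fun L => (yresolvent L)`_i).
Proof.
under eq_fun do rewrite coefD coefXn coef_sum.
apply: polyfunD; first exact: polyfunC.
apply: polyfun_sum => j; under eq_fun do rewrite coefZ.
apply: polyfunM; last exact: polyfunC; apply: polyfunM.
  by apply: polyfun_coef_deriv => l; exact: polyfun_coef_zpoly.
apply: polyfunX; apply: polyfunM; last exact: polyfunC.
by apply: polyfunN; exact: polyfun_lamT.
Qed.

(** A simple critical point gives a simple root of one of the two resolvents, which
    extends to a holomorphic branch; the other coordinate follows from
    2 y z = - lambda. *)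
Lemma critical_branch L0 q0 : critical_system L0 q0 -> simple_critical L0 q0 ->
  exists b : T1 C n -> 'rV[C]_2, [/\ b L0 = q0,
    \forall L \near L0, differentiable b L & \forall L \near L0, critical_system L (b L)].
Proof.
move=> /critical_systemE [e1 e2]; rewrite /simple_critical.
rewrite [q0]point2_eta; move: e1 e2; rewrite !mxE eqxx /=.
set y0 := q0 0 ord0; set z0 := q0 0 ord_max => e1 e2.
have l0 : lam L0 = - (2 * y0 * z0) by apply/eqP; rewrite -addr_eq0 addrC e1.
have p0 : (zpoly L0)^`().[z0] = - y0 ^+ 2 by apply/eqP; rewrite -addr_eq0 e2.
case: eqP => [z00 yn0|/eqP z0n0 rz].
- rewrite z00 mulr0 oppr0 in l0; rewrite z00 in e2 p0.
  have [eta [eta0 deta reta _]] : exists eta, root_branch yresolvent L0 y0 eta.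
    apply: (@polynomial_root_branch _ _ n).
    + by move=> L; have [] := yresolvent_monic_size L.
    + by move=> L; have [] := yresolvent_monic_size L.
    + by move=> i L; exact: polyfun_differentiable (polyfun_coef_yresolvent i).
    + by rewrite rootE yresolventE// l0 oppr0 mul0r e2 mulr0.
    + have -> : yresolvent L0 = 'X^n - y0 ^+ 2 *: 'X^(n.-2).
        rewrite /yresolvent l0 oppr0 mul0r.
        have n1 : (0 < n.-1)%N by lia.
        rewrite (bigD1 (Ordinal n1))//= big1 ?addr0 => [|i].
          by rewrite expr0 mulr1 subn0 -horner_coef0 p0 scaleNr.
        by rewrite -val_eqE /= => i0; rewrite expr0n (negPf i0) mulr0 scale0r.
      rewrite rootE derivB derivZ !derivXn hornerD hornerN hornerZ !hornerMn !hornerXn.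
      have -> : y0 ^+ n.-1 *+ n - y0 ^+ 2 * (y0 ^+ n.-2.-1 *+ n.-2) = 2 * y0 ^+ n.-1.
        have [m nm] : exists m, n = m.+3 by exists n.-2.-1; lia.
        by rewrite nm /= (exprS y0 m.+1) (exprS y0 m); move: (y0 ^+ m) => a; ring.
      by rewrite mulf_neq0 ?expf_neq0 ?pnatr_eq0.
  have neta : \forall L \near L0, eta L != 0.
    by apply: near_neq0; [exact: nbhs_singleton deta | rewrite eta0].
  exists (fun L => point2 (eta L) (- lam L / (2 * eta L))); split.
  + by rewrite eta0 l0 oppr0 mul0r z00.
  + apply: filterS2 deta neta => L dL nL; apply: differentiable_point2 => //.
    apply: differentiablefM; first by apply: differentiablefN; exact: differentiable_lam.
    apply: differentiablefV; first by rewrite mulf_neq0 ?pnatr_eq0.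
    by apply: differentiablefM => //; exact: differentiablefC.
  + apply: filterS2 reta neta => L rL nL; apply/critical_systemE; rewrite point2y point2z.
    split; first by field.
    move: rL; rewrite rootE yresolventE// mulf_eq0 expf_eq0 (negPf nL) andbF /=.
    by move/eqP.
- have [ze [ze0 dze rze _]] : exists ze, root_branch (@zresolvent C n) L0 z0 ze.
    apply: (@polynomial_root_branch _ _ n) => //.
    + by move=> L; have [] := zresolvent_monic_size n4 L.
    + by move=> L; have [] := zresolvent_monic_size n4 L.
    + by move=> i L; exact: polyfun_differentiable (polyfun_coef_zresolvent _ _ i).
    + by rewrite rootE zresolventE p0 l0; apply/eqP; field; rewrite nat_neq0//; lia.
  have nze : \forall L \near L0, ze L != 0.
    by apply: near_neq0; [exact: nbhs_singleton dze | rewrite ze0].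
  exists (fun L => point2 (- lam L / (2 * ze L)) (ze L)); split.
  + by rewrite ze0 l0; congr point2; field.
  + apply: filterS2 dze nze => L dL nL; apply: differentiable_point2 => //.
    apply: differentiablefM; first by apply: differentiablefN; exact: differentiable_lam.
    apply: differentiablefV; first by rewrite mulf_neq0 ?pnatr_eq0.
    by apply: differentiablefM => //; exact: differentiablefC.
  + apply: filterS2 rze nze => L rL nL; apply/critical_systemE; rewrite point2y point2z.
    split; first by field.
    move: rL; rewrite rootE zresolventE mulf_eq0 invr_eq0 (negPf (nat_neq0 _)) /=; last lia.
    have -> : ze L ^+ 2 * (zpoly L)^`().[ze L] + lam L ^+ 2 / 4 =
      ze L ^+ 2 * ((zpoly L)^`().[ze L] + (- lam L / (2 * ze L)) ^+ 2) by field.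
    by rewrite mulf_eq0 expf_eq0 (negPf nL) /= => /eqP.
Qed.

End Branches.

Section LocalChoices.
Variables (C : numClosedFieldType) (n : nat).
Hypothesis n4 : (4 <= n)%N.
Implicit Type L : T1 C n.

Lemma near_ord_forall (X : normedModType C) (x : X) m (P : 'I_m -> X -> Prop) :
  (forall i, \forall y \near x, P i y) -> \forall y \near x, forall i, P i y.
Proof. by move=> nP; apply: filter_forall. Qed.

(** The derivatives of f_Lambda in y and z vanish at its critical points, so that only
    the explicit dependence on Lambda counts, and the derivative with respect to
    lambda_0 is 1. *)
Lemma critical_value_submersion (p : T1 C n -> 'rV[C]_2) L :
  differentiable p L -> critical_system L (p L) ->
  differentiable (critical_value p) L /\ ~ 'd (critical_value p) L =1 cst 0.
Proof.
move=> dp /critical_systemE [e1 e2].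
have dY : differentiable (fun L => p L 0 ord0) L.
  apply: (@differentiablef_comp _ _ _ _ p (fun y : 'rV[C]_2 => y 0 ord0) _ dp);
    exact: differentiable_rV_coord.
have dZ : differentiable (fun L => p L 0 ord_max) L.
  apply: (@differentiablef_comp _ _ _ _ p (fun y : 'rV[C]_2 => y 0 ord_max) _ dp);
    exact: differentiable_rV_coord.
have dl : is_diff L (@lam C n) (@lam C n).
  by rewrite /lam; under eq_fun do rewrite mxE; exact: is_diff_rV_coord.
have dli i : is_diff L (fun M : T1 C n => lami M i) (fun M => lami M i).
  by rewrite /lami; under eq_fun do rewrite mxE; exact: is_diff_rV_coord.
have D := @is_diff_Dn_function C n (T1 C n) 'I_0 (fun _ _ => 0) (fun _ _ => 0) _ _ _ _ _ _ _ _ L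
  (fun=> is_difffC 0 L) (differentiableP dY) (differentiableP dZ) dl dli.
have cvE : critical_value p = (fun u : T1 C n => \sum_(i : 'I_0) 0 ^+ 2
    + p u 0 ord0 ^+ 2 * p u 0 ord_max + p u 0 ord_max ^+ n.-1 + lam u * p u 0 ord0
      + \sum_(i < n.-1) lami u i * p u 0 ord_max ^+ i).
  apply/funext => u; rewrite /critical_value /f_ /= yco_row_mx zco_row_mx.
  by rewrite sum_squares_row_mx big_ord0.
rewrite cvE; split; first exact: (ex_diff (is_diff_def := D)).
have i0 : (0 < n.-1)%N by lia.
(* The direction of lambda_0. *)
pose h : T1 C n := row_mx 0 (delta_mx 0 (Ordinal i0)).
have lh : lam h = 0 by rewrite /lam row_mxKl mxE.
have lih i : lami h i = (i == Ordinal i0)%:R by rewrite /lami row_mxKr mxE eqxx.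
rewrite (diff_val (is_diff_def := D)) => /(_ h).
rewrite big_ord0 e1 mul0r !add0r lh mulr0 add0r /cst.
have -> : n.-1%:R * p L 0 ord_max ^+ n.-2 + p L 0 ord0 ^+ 2 +
  \sum_(i < n.-1 | (0 < i)%N) i%:R * lami L i * p L 0 ord_max ^+ i.-1 = 0.
  by rewrite -[RHS]e2 deriv_zpolyE addrAC.
rewrite mul0r add0r (bigD1 (Ordinal i0))//= lih eqxx expr0 mulr1 big1 => [|i ii0].
  by rewrite addr0 => /eqP; rewrite oner_eq0.
by rewrite lih (negPf ii0) mulr0.
Qed.

(** The branches through the n distinct critical points remain distinct nearby, and
    there are never more than n critical points: the branches exhaust them. *)
Lemma local_critical_choices L0 : (critical_system L0 #= `I_n)%card ->
  exists2 p : 'I_n -> T1 C n -> 'rV[C]_2, critical_choices p &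
    \forall L \near L0, forall i,
      [/\ differentiable (p i) L, differentiable (critical_value (p i)) L &
          ~ 'd (critical_value (p i)) L =1 cst 0].
Proof.
move=> cL0; have [s sP] := choice (@critical_seq C n n4).
have [sz sE simple _] := sP L0.
have us : uniq (s L0) by apply: card_seq_uniq; rewrite -sE sz.
pose q (i : 'I_n) := nth 0 (s L0) i.
have Lq i : critical_system L0 (q i) by rewrite sE /= mem_nth// sz.
have [b bP] := choice (fun i => critical_branch n4 (Lq i) (simple us _ (Lq i))).
pose G L := (forall i, critical_system L (b i L)) /\
  (forall i j, i != j -> b i L != b j L).
have nd : \forall L \near L0, forall i, differentiable (b i) L.
  by apply: near_ord_forall => i; case: (bP i).
have nG : nbhs L0 G.
  have n1 : \forall L \near L0, forall i, critical_system L (b i L).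
    by apply: near_ord_forall => i; case: (bP i).
  have n2 : \forall L \near L0, forall i j, i != j -> b i L != b j L.
    apply: near_ord_forall => i; apply: near_ord_forall => j.
    have [->|ij] := eqVneq i j; first by apply: near_all.
    have qij : q i != q j by rewrite nth_uniq ?sz// -val_eqE in ij *.
    have /existsP[k qk] : [exists k, q i 0 k - q j 0 k != 0].
      apply: contraNT qij => /existsPn H; apply/eqP/rowP => k.
      by apply/eqP; rewrite -subr_eq0; apply/negPn; exact: H.
    have db l : differentiable (fun L => b l L 0 k) L0.
      apply: (@differentiablef_comp _ _ _ _ (b l) (fun y : 'rV[C]_2 => y 0 k)).
        by case: (bP l) => _ d _; exact: nbhs_singleton d.
      exact: differentiable_rV_coord.
    have dd : differentiable (fun L => b i L 0 k - b j L 0 k) L0.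
      by apply: differentiablefD => //; exact: differentiablefN.
    have bq l : b l L0 = q l by case: (bP l).
    have := near_neq0 dd; rewrite !bq => /(_ qk); apply: filterS => L bk _.
    by apply: contraNneq bk => ->; rewrite subrr.
  by apply: filterS2 n1 n2.
(* Away from the neighborhood any enumeration will do. *)
pose p i L := if `[< G L >] then b i L else nth 0 (s L) i.
have cp : critical_choices p.
  move=> L; have [szL sEL _ _] := sP L; rewrite sEL /p; case: asboolP => GL.
    case: GL => Lb bb; pose t := [seq b i L | i <- enum 'I_n].
    have ut : uniq t.
      rewrite map_inj_in_uniq ?enum_uniq// => i j _ _ /eqP bij; apply/eqP.
      by apply: contraTT bij; exact: bb.
    have st : {subset t <= s L}.
      by move=> _ /mapP[i _ ->]; have := Lb i; rewrite sEL.
    have [|_ ts] := uniq_min_size ut st; first by rewrite size_map size_enum_ord szL.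
    apply/seteqP; split => y /=; rewrite -ts.
      by move=> /mapP[i _ ->]; exists i.
    by move=> [i _ <-]; apply: map_f; rewrite mem_enum.
  apply/seteqP; split => y /=.
    move=> ys; have iy : (index y (s L) < n)%N by rewrite -szL index_mem.
    by exists (Ordinal iy); rewrite //= nth_index.
  by move=> [i _ <-]; rewrite mem_nth// szL.
exists p => //.
move: nd (nbhs_interior nG); apply: filterS2 => L dL nGL i.
have dpi : differentiable (p i) L.
  apply: (proj1 (near_eq_diff (dL i) _)).
  by apply: filterS nGL => M GM; rewrite /p asboolT.
have Lp : critical_system L (p i L) by rewrite cp; exists i.
by have [? ?] := critical_value_submersion dpi Lp.
Qed.

End LocalChoices.

(** * The origin *)

Section Origin.
Variables (C : numClosedFieldType) (n : nat).
Hypothesis n4 : (4 <= n)%N.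

(** The point is determined by its coordinates, which are those of the origin. *)
Lemma V0_top (x : pairs C n) : V0 n.-2 x -> x = 0.
Proof.
move=> /V0_coords[/calLE [cx x0] vx].
have [c0 e0] := (calLE _).1 (calL_at0 C n4).
rewrite (critical_cover_chart n4 cx) [RHS](critical_cover_chart n4 c0) x0 e0.
congr chart; apply/funext => j.
have [jn|jn] := leqP j n.-2; first by rewrite vx// v_at0//; lia.
have [->|jn1] := eqVneq j n.-1; first by rewrite !v_top//; lia.
by rewrite !v_large//; lia.
Qed.

Lemma critical_system0 (q : 'rV[C]_2) : critical_system (0 : T1 C n) q -> q = 0.
Proof.
move=> /critical_systemE [].
have z0 : zpoly (0 : T1 C n) = 'X^(n.-1).
  by rewrite /zpoly big1 ?addr0// => i _; rewrite /lami !mxE scale0r.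
have l0 : lam (0 : T1 C n) = 0 by rewrite /lam !mxE.
rewrite z0 l0 addr0 derivXn hornerMn hornerXn => /eqP.
rewrite !mulf_eq0 pnatr_eq0 /= => yz e2.
have n2 : (0 < n.-2)%N by lia.
have [y0 z00] : q 0 ord0 = 0 /\ q 0 ord_max = 0.
  case/orP: yz => /eqP e; split => //; apply/eqP; move: e2; rewrite e expr0n.
    rewrite addr0 => /eqP; rewrite mulrn_eq0 expf_eq0 n2 /=.
    by case/orP => //; lia.
  by rewrite gtn_eqF// mul0rn add0r => /eqP; rewrite expf_eq0.
by rewrite [q]point2_eta y0 z00; apply/rowP => i; rewrite !mxE; case: ifP.
Qed.

End Origin.

(** * The theorem *)

Theorem theorem6p6 (R : realType) (n N : nat) (hn : (4 <= n)%N) (hN : (1 <= N)%N) :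
  let C := complexes R in
  (* the critical points of the deformations, n of them for generic Lambda *)
  [/\ forall L : T1 C n, critical_points (f_ (k := N.-1) L)
        = [set row_mx 0 q | q in critical_system L],
      generically [set: T1 C n] [set L | (critical_system L #= `I_n)%card],
      (exists p : 'I_n -> T1 C n -> 'rV[C]_2, critical_choices p),
  (* the deformations to a simple node form the union of n hypersurfaces *)
      (forall p : 'I_n -> T1 C n -> 'rV[C]_2, critical_choices p ->
        closure (@node_locus C n N.-1) = \bigcup_i trace (p i) (@calL C n) /\
        hypersurface [set: T1 C n] (\bigcup_i trace (p i) (@calL C n))) &
      (forall L0 : T1 C n, (critical_system L0 #= `I_n)%card ->
        exists2 p : 'I_n -> T1 C n -> 'rV[C]_2, critical_choices p &
          \forall L \near L0, forall i,
            [/\ differentiable (p i) L, differentiable (critical_value (p i)) L &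
                ~ 'd (critical_value (p i)) L =1 cst 0])] /\
  (* the stratification, and its verification of the adjacency diagram *)
  [/\ algebraic (@critical_cover C n) /\
        hypersurface (@critical_cover C n) (@calL C n),
      (forall k, (k <= n.-2)%N -> hypersurface (@calL C n) (@V C n k)),
      (forall k, (2 <= k <= n.-1)%N -> hypersurface (@calL C n) (@W C n k)),
      (forall t, vertex n t -> algebraic (@stratum C n t)) &
      verifies N.-1 (@stratum C n)] /\
  (* the diagram of subsets of T^1, for any choice of a hypersurface L *)
  forall (p : 'I_n -> T1 C n -> 'rV[C]_2) (i : 'I_n), critical_choices p ->
  let S t := trace (p i) (@stratum C n t) in
  [/\ S (A 1) = [set L | f_ (k := N.-1) L (row_mx 0 (p i L)) = 0],
      (forall a b, arrow n a b -> S b `<=` S a),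
      (forall m, (4 <= m <= n.-1)%N ->
        cip_square (S (D m.+1)) (S (D m)) (S (A m)) (S (A m.-1))) &
      S (D n) = [set 0]].
Proof.
move=> C; split; [|split].
- split.
  + by move=> L; exact: critical_pointsE.
  + exact: generic_card_critical_system.
  + exact: critical_choices_exist.
  + move=> p cp; split; last exact: hypersurface_trace_union.
    by rewrite closure_node_locus// trace_union.
  + by move=> L0; exact: local_critical_choices.
- split.
  + by split; [exact: algebraic_critical_cover | exact: hypersurface_calL].
  + by move=> k; exact: hypersurface_V.
  + by move=> k; exact: hypersurface_W.
  + by move=> t _; exact: algebraic_stratum.
  + exact: stratum_verifies.
- move=> p i cp S.
  have Lp L : critical_system L (p i L) by rewrite cp; exists i.
  have arr a b : arrow n a b -> S b `<=` S a.
    by move=> ab L; exact: stratum_arrow.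
  split => //.
  + apply/seteqP; split => L; rewrite /S /trace /=.
      by move=> /calLE [_]; rewrite -(cvalueE N.-1) par_row_mx row_mxKr.
    move=> fL; apply/calLE; split; first exact: Lp.
    by rewrite -(cvalueE N.-1) par_row_mx row_mxKr.
  + move=> m mn; have m4 : (4 <= m)%N by lia.
    split.
    * by split; apply: arr; split => //=; lia.
    * by split; apply: arr; split => //=; lia.
    * by rewrite /S (stratum_A _ _ m4) /trace /= (@V0_cip C n hn m mn).
  + apply/seteqP; split => L; rewrite /S /trace /=.
      by move=> /(V0_top hn) /(congr1 (@par _ n)); rewrite par_row_mx => ->; rewrite /par linear0.
    move=> ->; rewrite (critical_system0 hn (Lp 0)) row_mx0.
    by apply: (@stratum0 C n hn (D n)); rewrite /=; lia.
Qed.
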